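(* Let $\Omega\subset X$ be an open set, and suppose that $u_i\to u$ in $L^1_{\mathrm{loc}}(\Omega)$ and $\Vert Du_i\Vert(\Omega)\to\Vert Du\Vert(\Omega)$, with $\Vert Du\Vert(\Omega)<\infty$ and $\Vert Du_i\Vert(\Omega)<\infty$ for all $i\in\mathbb{N}$. Then for every $\varepsilon>0$ there exists $\delta>0$ such that if $A\subset\Omega$ with $\mathrm{Cap}_1(A)<\delta$, then $\Vert Du_i\Vert(A)<\varepsilon$ for all $i\in\mathbb{N}$.
   Context: Standing assumptions. $(X,d,\mu)$ is a complete metric space with a Borel regular outer measure $\mu$ that is doubling: there is $C_d\ge 1$ with $0<\mu(B(x,2r))\le C_d\,\mu(B(x,r))<\infty$ for all balls. $X$ supports a $(1,1)$-Poincaré inequality: there are $C_P\ge1$, $\lambda\ge1$ such that for every ball $B(x,r)$, every $u\in L^1_{\mathrm{loc}}(X)$ and every upper gradient $g$ of $u$, $\frac{1}{\mu(B(x,r))}\int_{B(x,r)}|u-u_{B(x,r)}|\,d\mu\le C_P\,r\,\frac{1}{\mu(B(x,\lambda r))}\int_{B(x,\lambda r)}g\,d\mu$, where $u_{B(x,r)}$ is the mean of $u$ over $B(x,r)$. Upper gradients. A curve is a rectifiable continuous map from a compact interval into $X$, parametrized by arc length. For $A\subset X$, a nonnegative Borel function $g$ on $A$ is an upper gradient of an extended real-valued function $u$ on $A$ if for all curves $\gamma$ in $A$ with end points $x,y$, $|u(x)-u(y)|\le\int_\gamma g\,ds$ (the left side is $\infty$ if $u(x)$ or $u(y)$ is infinite).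 A nonnegative $\mu$-measurable $g$ is a $1$-weak upper gradient of $u$ in $A$ if this holds for $1$-almost every curve in $A$, i.e. except for a family $\Gamma$ of curves for which there is a nonnegative Borel $\rho\in L^1(X)$ with $\int_\gamma\rho\,ds=\infty$ for all $\gamma\in\Gamma$. The minimal $1$-weak upper gradient $g_u$ of $u$ in an open set $\Omega$ is the one with $g_u\le g$ $\mu$-a.e. in $\Omega$ for every $1$-weak upper gradient $g\in L^1_{\mathrm{loc}}(\Omega)$ of $u$ in $\Omega$. Spaces and capacity. $\|u\|_{N^{1,1}(X)}:=\|u\|_{L^1(X)}+\inf\|g\|_{L^1(X)}$, the infimum over all $1$-weak upper gradients $g$ of $u$ in $X$, and $N^{1,1}(X):=\{u:\|u\|_{N^{1,1}(X)}<\infty\}$ (functions defined at every point). $\mathrm{Cap}_1(A):=\inf\|u\|_{N^{1,1}(X)}$ over all $u\in N^{1,1}(X)$ with $u\ge1$ in $A$. For $\mu$-measurable $A$, $u\in L^1_{\mathrm{loc}}(A)$ means that for every $x\in A$ there is $r>0$ with $u\in L^1(A\cap B(x,r))$; $\mathrm{Lip}_{\mathrm{loc}}(A)$ is defined similarly. $u_i\to u$ in $L^1_{\mathrm{loc}}(A)$ means that for every $x\in A$ there is $r>0$ with $u_i\to u$ in $L^1(A\cap B(x,r))$. Total variation. For $\Omega\subset X$ open and $u\in L^1_{\mathrm{loc}}(\Omega)$, $\|Du\|(\Omega):=\inf\{\liminf_{i\to\infty}\int_\Omega g_{u_i}\,d\mu:\ u_i\in\mathrm{Lip}_{\mathrm{loc}}(\Omega),\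 u_i\to u\text{ in }L^1_{\mathrm{loc}}(\Omega)\}$, where $g_{u_i}$ is the minimal $1$-weak upper gradient of $u_i$ in $\Omega$. For arbitrary $A\subset X$, $\|Du\|(A):=\inf\{\|Du\|(\Omega'):\ A\subset\Omega',\ \Omega'\subset X\text{ open}\}$ (over those $\Omega'$ for which $u\in L^1_{\mathrm{loc}}(\Omega')$). The condition $\|Du\|(\Omega)<\infty$ includes the requirement $u\in L^1_{\mathrm{loc}}(\Omega)$. *)

(* Defs.v *)
From HB Require Import structures.
From mathcomp Require Import all_boot all_order all_algebra.
From mathcomp Require Import all_classical all_reals all_analysis.
From mathcomp Require Import measurable_realfun.

Set Implicit Arguments.
Unset Strict Implicit.
Unset Printing Implicit Defensive.

Import Order.TTheory GRing.Theory Num.Theory.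
Import numFieldNormedType.Exports.

Local Open Scope classical_set_scope.
Local Open Scope ring_scope.

#[short(type="completeMetricType")]
HB.structure Definition CompleteMetric (K : numDomainType) :=
  {M of Metric K M & Complete M}.

Section Curves.
Context {R : realType} {X : completeMetricType R}.

Definition curve_length (c : R -> X) (a b : R) : \bar R :=
  ereal_sup [set (\sum_(0 <= n < size s)
                    mdist (c (nth b (a :: s) n)) (c (nth b (a :: s) n.+1)))%:E
            | s in itv_partition a b].

(* An arc-length parametrization on [0, clen] of a rectifiable curve.  Only the
   values of cpath on [0, clen] matter.  Curves are nonconstant (0 < clen):
   with the convention on infinite values below, a constant curve would forbid
   every upper gradient for a function taking an infinite value. *)
Record curve := Curve {
  clen : R ;
  cpath :> R -> X ;
  clen_gt0 : 0 < clen ;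
  cpath_continuous : {within `[0, clen], continuous cpath} ;
  cpath_arclength : forall s t : R, 0 <= s -> s <= t -> t <= clen ->
    curve_length cpath s t = (t - s)%:E }.

Definition cstart (c : curve) : X := c 0.
Definition cend (c : curve) : X := c (clen c).

Definition curve_in (A : set X) (c : curve) : Prop :=
  c @` `[0, clen c] `<=` A.

(* When f is not Borel, this is the lower integral, which is the Lebesgue
   integral as soon as f \o c is Lebesgue measurable on [0, clen c]. *)
Definition curve_integral (c : curve) (f : X -> \bar R) : \bar R :=
  (\int[@lebesgue_measure R]_(t in `[0%R, clen c]) f (c t))%E.

(* In \bar R both +oo - +oo and -oo - -oo are -oo, so the left-hand side is +oo
   as soon as one of the two values of u is infinite. *)
Definition gradient_ineq (u g : X -> \bar R) (c : curve) : Prop :=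
  (`| u (cstart c) - u (cend c) | <= curve_integral c g)%E.

Definition borel_fun (f : X -> \bar R) : Prop :=
  @measurable_fun _ _ (g_sigma_algebraType (@open X)) _ setT f.

Definition upper_gradient (u g : X -> \bar R) : Prop :=
  [/\ borel_fun g, (forall x, 0 <= g x)%E & forall c, gradient_ineq u g c].

Definition lipschitz_in (A : set X) (u : X -> R) : Prop :=
  exists L : R, forall y z, A y -> A z -> `|u y - u z| <= L * mdist y z.

Definition lip_loc (A : set X) (u : X -> R) : Prop :=
  forall x, A x -> exists2 r : R, 0 < r & lipschitz_in (A `&` ball x r) u.

End Curves.
Arguments curve {R} X.

Section Measure.
Context {R : realType} {X : completeMetricType R}.
Variable mu : {outer_measure set X -> \bar R}.

(* The outer measure mu, as a measure on its Caratheodory sigma-algebra; the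
   mu-measurable sets and functions are those of caratheodory_type mu. *)
Definition cmeas : {measure set (caratheodory_type mu) -> \bar R} := mu.

Definition borel_regular : Prop :=
  (forall B, <<s @open X >> B -> mu.-caratheodory B) /\
  (forall A : set X, exists B, [/\ <<s @open X >> B, A `<=` B & mu A = mu B]).

Definition doubling : Prop :=
  exists2 Cd : R, 1 <= Cd & forall (x : X) (r : R), 0 < r ->
    [/\ 0 < mu (ball x (2 * r)),
        mu (ball x (2 * r)) <= Cd%:E * mu (ball x r) &
        Cd%:E * mu (ball x r) < +oo]%E.

Definition L1 (A : set X) (u : X -> \bar R) : Prop := cmeas.-integrable A u.

Definition L1_loc (A : set X) (u : X -> \bar R) : Prop :=
  forall x, A x -> exists2 r : R, 0 < r & L1 (A `&` ball x r) u.

(* For u outside L1_loc(A) the condition L1_loc_cvg A u_ u never holds, so that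
   tv_open below is then +oo. *)
Definition L1_cvg (A : set X) (u_ : nat -> X -> \bar R) (u : X -> \bar R) :=
  [/\ forall i, L1 A (u_ i), L1 A u &
      (\int[cmeas]_(x in A) `| u_ i x - u x |)%E @[i --> \oo] --> 0%E].

Definition L1_loc_cvg (A : set X) (u_ : nat -> X -> \bar R)
    (u : X -> \bar R) : Prop :=
  forall x, A x -> exists2 r : R, 0 < r & L1_cvg (A `&` ball x r) u_ u.

Definition mean (A : set X) (u : X -> \bar R) : \bar R :=
  ((\int[cmeas]_(x in A) u x) / mu A)%E.

Definition poincare : Prop :=
  exists CP lambda : R, [/\ 1 <= CP, 1 <= lambda &
    forall (x : X) (r : R) (u g : X -> \bar R),
      0 < r -> L1_loc setT u -> upper_gradient u g ->
      (mean (ball x r) (fun y => `| u y - mean (ball x r) u |) <=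
       CP%:E * r%:E * mean (ball x (lambda * r)) g)%E].

Definition exceptional (G : set (curve X)) : Prop :=
  exists rho : X -> \bar R,
    [/\ borel_fun rho, (forall x, 0 <= rho x)%E, L1 setT rho &
        forall c, G c -> curve_integral c rho = +oo%E].

Definition weak_upper_gradient (A : set X) (u g : X -> \bar R) : Prop :=
  [/\ @measurable_fun _ _ (caratheodory_type mu) _ A g,
      (forall x, A x -> 0 <= g x)%E &
      exists2 G, exceptional G &
        forall c, curve_in A c -> ~ G c -> gradient_ineq u g c].

Definition minimal_weak_upper_gradient (O : set X) (u g : X -> \bar R) : Prop :=
  weak_upper_gradient O u g /\
  forall g', weak_upper_gradient O u g' -> L1_loc O g' ->
    {ae cmeas, forall x, O x -> (g x <= g' x)%E}.

Definition N11_norm (u : X -> \bar R) : \bar R :=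
  (\int[cmeas]_x `| u x | +
   ereal_inf [set \int[cmeas]_x g x | g in weak_upper_gradient setT u])%E.

Definition N11 (u : X -> \bar R) : Prop :=
  L1 setT u /\ (N11_norm u < +oo)%E.

Definition Cap1 (A : set X) : \bar R :=
  ereal_inf [set N11_norm u | u in
    [set u | N11 u /\ forall x, A x -> (1 <= u x)%E]].

(* ||Du||(O) for O open.  A locally Lipschitz function v on O has a minimal
   1-weak upper gradient, unique up to a null set; it is the second component
   of the approximating pairs. *)
Definition tv_open (O : set X) (u : X -> \bar R) : \bar R :=
  ereal_inf [set limn_einf (fun i => \int[cmeas]_(x in O) p.2 i x)%E | p in
    [set p : (nat -> X -> R) * (nat -> X -> \bar R) |
      [/\ forall i, lip_loc O (p.1 i),
          L1_loc_cvg O (fun i => EFin \o p.1 i) u &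
          forall i, minimal_weak_upper_gradient O (EFin \o p.1 i) (p.2 i)]]].

Definition tv (A : set X) (u : X -> \bar R) : \bar R :=
  ereal_inf [set tv_open O u | O in
    [set O | [/\ open O, A `<=` O & L1_loc O u]]].

End Measure.

(* Main.v *)
Require Import Defs.
From mathcomp Require Import all_boot all_order all_algebra.
From mathcomp Require Import all_classical all_reals all_analysis.
From mathcomp Require Import measurable_realfun.
From mathcomp Require Import ring lra.

Set Implicit Arguments.
Unset Strict Implicit.
Unset Printing Implicit Defensive.

Import Order.TTheory GRing.Theory Num.Theory.
Import numFieldNormedType.Exports.

Local Open Scope classical_set_scope.
Local Open Scope ring_scope.

(** Variation is defined through minimal gradients on the given open set. A gradient built by hand,
    or restricted to a smaller open set, must therefore be replaced by a minimal one of no larger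
    energy, so existence of minimal gradients has to be proved. For this, and for products with a
    cutoff, the gradient inequality is needed on all subcurves: the exceptional family is enlarged
    to all curves along which its density has infinite integral, which discards every curve with a
    bad subcurve.

    The truncation is needed because the product rule costs the size of the function times the
    gradient of the cutoff, and only the integral of that gradient is small. With capacity below
    [s ^ 2], [s = 1 / (k + 1)], and height [k + 1], both the added energy and the error in the mean
    on the support of the cutoff are multiples of [s].

    All [f n] share one upper gradient because the energy of [p] on the union of the sets
    [f n > 1/2] is only approached for large [n]: the index is chosen after [p], at a cost
    independent of it. Chains are used since a step may join any two close points, which makes [f n]
    Lipschitz at a fixed scale. *)

(* Suppose that [A k] has capacity tending to 0 while the variation of
   [v k := u_ (i k)] on [A k] stays above [eps], with [i k] tending to infinity
   (finitely many indices are treated as constant sequences).  Small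
   capacity yields, after replacing a weak upper gradient of an almost optimal
   function by a lower semicontinuous majorant, an increasing sequence of locally
   Lipschitz functions [f n : X -> [0, 1]] with a common upper gradient of small
   integral, vanishing outside a set of small measure, such that [A k] lies in the
   union of the open sets [f n > 1/2].  The function [f n x] is an infimum over
   chains leaving [x] with steps at most [1 / (n + 1)]; if it stayed below 1/2 for
   all [n] at a point of [A k], a limit of almost optimal chains, which exists as
   complete doubling spaces are proper, would be a curve contradicting the upper
   gradient inequality.

   Multiply the truncation at height [M k] of an almost optimal locally Lipschitz
   approximant [p] of [v k] by a cutoff vanishing where [f n > 1/2].  This removes
   the energy of [p] there, at least [eps / 2], and adds at most [2 * M k] times
   the integral of the upper gradient of [f n], which is negligible when [M k]
   tends to infinity slowly.  The new functions still converge to [u] in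
   [L1_loc], so that the variation of [u] would be at most the limit of the
   variations of the [v k] minus a positive amount. *)

(** * Lower integrals, and increments bounded by integrals on the real line *)

Section integral_general.
Context d (T : measurableType d) (R : realType).
Variable mu : {measure set T -> \bar R}.
Local Open Scope ereal_scope.

(* The integral of a nonnegative function is defined as a supremum over simple
   functions below it, hence is monotone without measurability. *)
Lemma ge0_le_lower_integral (D : set T) (f g : T -> \bar R) :
  (forall x, D x -> 0 <= f x) -> (forall x, D x -> f x <= g x) ->
  \int[mu]_(x in D) f x <= \int[mu]_(x in D) g x.
Proof.
move=> f0 fg; have g0 x : D x -> 0 <= g x.
  by move=> Dx; exact: le_trans (f0 _ Dx) (fg _ Dx).
rewrite !ge0_integralE//; apply: le_ereal_sup => _ [h /= hf <-].
exists h => // x; apply: (le_trans (hf x)); rewrite !patchE.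
by case: ifPn => // /[!inE]; exact: fg.
Qed.

End integral_general.

Section real_line.
Context {R : realType}.
Notation leb := (@lebesgue_measure R).

(** Cut the interval into equal steps no longer than [r]. *)
Lemma local_nondecreasing (f : R -> R) (a b r : R) : 0 < r ->
  (forall s t, a <= s -> s <= t -> t <= b -> t - s <= r -> f s <= f t) ->
  a <= b -> f a <= f b.
Proof.
move=> r0 floc ab.
have [n nr] : exists n : nat, (b - a) / n.+1%:R <= r.
  exists (Num.truncn ((b - a) / r)).
  rewrite ler_pdivrMr// mulrC -ler_pdivrMr//.
  by rewrite ltW// truncnS_gt.
pose h := (b - a) / n.+1%:R.
have h0 : 0 <= h by rewrite divr_ge0// subr_ge0.
have hn : h * n.+1%:R = b - a by rewrite /h divfK.
have step i : (i <= n.+1)%N -> f a <= f (a + h * i%:R).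
  elim: i => [|i IH] iN; first by rewrite mulr0 addr0.
  apply: (le_trans (IH (ltnW iN))); apply: floc.
  - by rewrite lerDl mulr_ge0.
  - by rewrite lerD2l ler_wpM2l// ler_nat.
  - by rewrite -(subrK a b) -hn addrC lerD2r ler_wpM2l// ler_nat.
  - by rewrite opprD addrACA subrr add0r -mulrBr -natrB// subSnn mulr1.
by have := step n.+1 (leqnn _); rewrite hn addrC subrK.
Qed.

Section additivity.
Local Open Scope ereal_scope.

Lemma ge0_integral_itvD (k : R -> \bar R) (a b c : R) :
  (a <= b)%R -> (b <= c)%R -> measurable_fun `[a, c] k ->
  (forall x, x \in `[a, c] -> 0 <= k x) ->
  \int[leb]_(x in `[a, c]) k x =
  \int[leb]_(x in `[a, b]) k x + \int[leb]_(x in `[b, c]) k x.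
Proof.
move=> ab bc mk k0.
have E : [set` `[a, c]] = [set` `[a, b]] `|` [set` `]b, c]].
  apply/seteqP; split => x /=; rewrite !in_itv/=.
    move=> /andP[ax xc]; have [xb|bx] := leP x b; [left|right].
      by rewrite ax.
    by rewrite xc.
  move=> [|] /andP[h1 h2]; apply/andP; split => //.
  - exact: le_trans bc.
  - exact: le_trans ab (ltW h1).
rewrite E ge0_integral_setU//.
- congr (_ + _); rewrite integral_itv_obnd_cbnd//.
  by apply: measurable_funS mk => //; rewrite E; exact: subsetUr.
- by rewrite -E.
- by move=> x; rewrite -E; exact: k0.
- apply/disj_setPS => x/= [] /=; rewrite !in_itv/= => /andP[_ xb] /andP[bx _].
  by have := lt_le_trans bx xb; rewrite ltxx.
Qed.

(** With [J] the primitive of [k], the hypothesis says that [J + F] and [J - F] are nondecreasing at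
    scale [r], hence on the whole interval. If the integral is infinite there is nothing to
    prove. *)
Lemma local_le_integral (F : R -> R) (k : R -> \bar R) (a b r : R) :
  (0 < r)%R -> (a <= b)%R -> measurable_fun `[a, b] k ->
  (forall x, x \in `[a, b] -> 0 <= k x) ->
  (forall s t, (a <= s)%R -> (s <= t)%R -> (t <= b)%R -> (t - s <= r)%R ->
     (`|F t - F s|)%:E <= \int[leb]_(x in `[s, t]) k x) ->
  (`|F b - F a|)%:E <= \int[leb]_(x in `[a, b]) k x.
Proof.
move=> r0 ab mk k0 Floc.
have [->|kfin] := eqVneq (\int[leb]_(x in `[a, b]) k x) +oo; first exact: leey.
have ksub s t : (a <= s)%R -> (t <= b)%R -> [set` `[s, t]] `<=` [set` `[a, b]].
  move=> as_ tb; apply: subset_itv; by rewrite bnd_simp.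
have mks s t : (a <= s)%R -> (t <= b)%R -> measurable_fun `[s, t] k.
  by move=> as_ tb; apply: measurable_funS mk => //; exact: ksub.
have kge0 s t : (a <= s)%R -> (t <= b)%R ->
    0 <= \int[leb]_(x in `[s, t]) k x.
  by move=> as_ tb; apply: integral_ge0 => x /(ksub _ _ as_ tb) /k0.
have kfins s t : (a <= s)%R -> (t <= b)%R ->
    \int[leb]_(x in `[s, t]) k x \is a fin_num.
  move=> as_ tb; rewrite ge0_fin_numE ?kge0//.
  apply: (@le_lt_trans _ _ (\int[leb]_(x in `[a, b]) k x)).
    by apply: ge0_subset_integral => //; exact: ksub.
  by rewrite lt_neqAle kfin leey.
pose J t := fine (\int[leb]_(x in `[a, t]) k x).
have Jst s t : (a <= s)%R -> (s <= t)%R -> (t <= b)%R ->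
    J t = (J s + fine (\int[leb]_(x in `[s, t]) k x))%R.
  move=> as_ st tb; rewrite /J -fineD ?kfins//; last exact: le_trans tb.
  rewrite -ge0_integral_itvD//; first exact: mks.
  by move=> x /(ksub _ _ (lexx _) tb)/k0.
have Ja : J a = 0%R by rewrite /J set_itv1 integral_set1.
rewrite -(fineK (kfins _ _ (lexx a) (lexx b))) lee_fin -/(J b).
have Floc' s t : (a <= s)%R -> (s <= t)%R -> (t <= b)%R -> (t - s <= r)%R ->
    (`|F t - F s| <= J t - J s)%R.
  move=> as_ st tb str; rewrite (Jst s t)// addrAC subrr add0r -lee_fin.
  by rewrite fineK ?kfins//; exact: Floc.
rewrite ler_norml; apply/andP; split.
  have := @local_nondecreasing (fun t => J t + F t)%R a b r r0 _ ab.
  rewrite Ja add0r lerNl opprB lerBlDr; apply => s t as_ st tb str.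
  by have := Floc' _ _ as_ st tb str; rewrite ler_norml => /andP[? ?]; lra.
have := @local_nondecreasing (fun t => J t - F t)%R a b r r0 _ ab.
rewrite Ja add0r => H; suff : (- F a <= J b - F b)%R by lra.
apply: H => s t as_ st tb str.
by have := Floc' _ _ as_ st tb str; rewrite ler_norml => /andP[? ?]; lra.
Qed.

End additivity.

(** Near-covering form of compactness: around each point of [K1], all small positive [r] work
    simultaneously for the nearby points. *)
Lemma compact_disjoint_dist (K1 K2 : set R) : compact K1 -> compact K2 ->
  K1 `&` K2 = set0 ->
  exists2 r : R, 0 < r & forall x y, K1 x -> K2 y -> r < `|x - y|.
Proof.
move=> cK1 cK2 K12.
have clK2 : closed K2 by apply: compact_closed => //; exact: Rhausdorff.
have /(compact_near_coveringP _).1 := cK1.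
move=> /(_ _ (0:R)^'+ (fun r x => forall y, K2 y -> r < `|x - y|) _)[].
- move=> x K1x.
  have : nbhs x (~` K2).
    apply: open_nbhs_nbhs; split; first exact: closed_openC.
    by move=> K2x; have : (K1 `&` K2) x by []; rewrite K12.
  move=> /nbhs_ballP[e /= e0 exK2].
  exists (ball x (e / 2), [set r | r < e / 2]); first split => /=.
  + by apply: nbhsx_ballx; rewrite divr_gt0.
  + by apply: nbhs_right_lt; rewrite divr_gt0.
  + move=> [x' r] /= [xx' re] y K2y; apply: (lt_trans re).
    rewrite ltNge; apply/negP => x'y; apply: (exK2 y) => //.
    move: xx'; rewrite /ball/= => xx'.
    rewrite (le_lt_trans (ler_distD x' _ _))//.
    by rewrite (splitr e) ltr_leD.
- move=> r /= r0 rP.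
  exists (r / 2); first by rewrite divr_gt0.
  move=> x y K1x K2y; apply: (rP (r / 2)) => //=.
  + by rewrite /= sub0r normrN gtr0_norm ?divr_gt0// ltr_pdivrMr// ltr_pMr// ltr1n.
  + by rewrite divr_gt0.
Qed.


Section min_integral.
Local Open Scope ereal_scope.

(** Absolute continuity of the integral. The real-valued case is applied to [fine] of the
    restriction of [k], which agrees with [k] almost everywhere on the interval. *)
Lemma integral_small_measure (k : R -> \bar R) (a b e : R) : (0 < e)%R ->
  leb.-integrable `[a, b] k ->
  exists2 d : R, (0 < d)%R & forall A : set R, measurable A ->
    A `<=` `[a, b] -> leb A < d%:E -> \int[leb]_(x in A) `|k x| < e%:E.
Proof.
move=> e0 ik.
have mab : @measurable _ (measurableTypeR R) [set` `[a, b]].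
  exact: measurable_itv.
pose f := fun x => fine ((k \_ `[a, b]) x).
have ik' : leb.-integrable setT (k \_ `[a, b]) by exact/(integrable_mkcond _ mab).1.
have ifk : leb.-integrable setT (EFin \o f).
  apply: (le_integrable _ _ _ ik') => //.
  - apply/measurable_EFinP; apply: measurableT_comp => //.
    exact: measurable_int ik'.
  - move=> x _ /=; rewrite /f; case: ((k \_ _) x) => [r| |] //=.
      by rewrite normr0 leey.
    by rewrite normr0 leey.
have [d [d0 dP]] := integral_normr_continuous ifk e0.
exists d => // A mA Aab Ad.
have := dP A mA Ad; rewrite /Rintegral -lte_fin.
have -> : \int[leb]_(x in A) (`|f x|)%:E = \int[leb]_(x in A) `|k x|.
  apply: ae_eq_integral => //.
  - apply/measurable_EFinP; apply: measurableT_comp => //.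
    by apply/measurable_EFinP; apply: measurable_funTS; exact: measurable_int ifk.
  - apply: measurableT_comp => //.
    by apply: measurable_funS (measurable_int _ ik) => //.
  - have := integrable_ae mab ik.
    apply: filterS => x kx Ax /=.
    have xab := Aab _ Ax.
    by rewrite /f patchE mem_set//= -[in RHS](fineK (kx xab)).
rewrite fineK// ge0_fin_numE; last by apply: integral_ge0.
apply: (@le_lt_trans _ _ (\int[leb]_(x in `[a, b]) `|k x|)).
  apply: ge0_subset_integral => //.
  by apply: measurableT_comp => //; exact: measurable_int ik.
by have /integrableP[] := ik.
Qed.

(* On a piece short enough to miss one of two compact sets exhausting
   [{h1 <= h2}] and [{h2 < h1}] up to small measure, use the bound by the other
   of [h1], [h2]. *)
Lemma le_integral_mine (F : R -> R) (h1 h2 : R -> \bar R) (a b : R) :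
  (a <= b)%R ->
  (forall x, x \in `[a, b] -> 0 <= h1 x) ->
  (forall x, x \in `[a, b] -> 0 <= h2 x) ->
  leb.-integrable `[a, b] h1 -> leb.-integrable `[a, b] h2 ->
  (forall s t, (a <= s)%R -> (s <= t)%R -> (t <= b)%R ->
     (`|F t - F s|)%:E <= \int[leb]_(x in `[s, t]) h1 x) ->
  (forall s t, (a <= s)%R -> (s <= t)%R -> (t <= b)%R ->
     (`|F t - F s|)%:E <= \int[leb]_(x in `[s, t]) h2 x) ->
  (`|F b - F a|)%:E <= \int[leb]_(x in `[a, b]) mine (h1 x) (h2 x).
Proof.
move=> ab h10 h20 ih1 ih2 F1 F2; apply/lee_addgt0Pr => e e0.
have mab : @measurable _ (measurableTypeR R) [set` `[a, b]].
  exact: measurable_itv.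
have mh1 := measurable_int _ ih1; have mh2 := measurable_int _ ih2.
have ih := integrableD mab ih1 ih2.
have h0 x : x \in `[a, b] -> 0 <= h1 x + h2 x.
  by move=> xab; rewrite adde_ge0 ?h10 ?h20.
have [d d0 dP] := integral_small_measure e0 ih.
pose E1 := [set` `[a, b]] `&` [set x | h1 x <= h2 x].
pose E2 := [set` `[a, b]] `&` [set x | h2 x < h1 x].
have mE1 : measurable E1 by exact: measurable_lee.
have mE2 : measurable E2 by exact: measurable_lte.
have labfin : leb [set` `[a, b]] < +oo.
  by rewrite lebesgue_measure_itv/= ; case: ifP => // _; rewrite -EFinB ltry.
have lfin A : measurable A -> A `<=` [set` `[a, b]] -> leb A < +oo.
  by move=> mA Aab; apply: le_lt_trans labfin; apply: le_measure; rewrite ?inE.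
have d20 : (0 < d / 2)%R by rewrite divr_gt0.
have [K1 [cK1 K1E dK1]] := lebesgue_regularity_inner mE1
  (lfin _ mE1 (@subIsetl _ _ _)) d20.
have [K2 [cK2 K2E dK2]] := lebesgue_regularity_inner mE2
  (lfin _ mE2 (@subIsetl _ _ _)) d20.
have K12 : K1 `&` K2 = set0.
  apply/seteqP; split => // x [/K1E[_ /= h12] /K2E[_ /=]].
  by rewrite ltNge h12.
have [r r0 rP] := compact_disjoint_dist cK1 cK2 K12.
have mK1 : measurable K1 by apply: closed_measurable; apply: compact_closed => //; exact: Rhausdorff.
have mK2 : measurable K2 by apply: closed_measurable; apply: compact_closed => //; exact: Rhausdorff.
pose D := [set` `[a, b]] `\` (K1 `|` K2).
have mD : measurable D by apply: measurableD => //; exact: measurableU.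
have Dd : leb D < d%:E.
  apply: (@le_lt_trans _ _ (leb (E1 `\` K1) + leb (E2 `\` K2))).
    apply: (@le_trans _ _ (leb ((E1 `\` K1) `|` (E2 `\` K2)))).
      apply: le_measure; rewrite ?inE//.
        by apply: measurableU; exact: measurableD.
      move=> x [xab]; rewrite not_orP => -[nK1 nK2].
      have [h12|h21] := leP (h1 x) (h2 x); [left|right]; split => //; split => //.
    by apply: measureU2; exact: measurableD.
  by rewrite (splitr d) EFinD; apply: lteD.
have mm : measurable_fun `[a, b] (fun x => mine (h1 x) (h2 x)).
  exact: measurable_mine.
have m0 x : x \in `[a, b] -> 0 <= mine (h1 x) (h2 x).
  by move=> xab; rewrite le_min h10// h20.
(* Off the two compact sets the sum of [h1] and [h2] is paid; [D] is so small that this adds at most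
   [e] in total. *)
pose err := (fun x => h1 x + h2 x) \_ D.
have Dab : D `<=` [set` `[a, b]] by move=> x [].
have merr : measurable_fun `[a, b] err.
  apply/measurable_restrict => //.
  apply: measurable_funS (measurable_int _ ih) => //.
have err0 x : 0 <= err x.
  rewrite /err patchE; case: ifPn => // /[!inE] /Dab; exact: h0.
apply: (@le_trans _ _ (\int[leb]_(x in `[a, b]) (mine (h1 x) (h2 x) + err x))).
  apply: (@local_le_integral _ _ a b r) => //.
  - exact: emeasurable_funD.
  - by move=> x xab; rewrite adde_ge0// m0.
  - move=> s t as_ st tb str.
    have sub : [set` `[s, t]] `<=` [set` `[a, b]].
      by apply: subset_itv; rewrite bnd_simp.
    have /orP[/asboolP K|/asboolP K] : `[< [set` `[s, t]] `&` K1 = set0 >]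
      || `[< [set` `[s, t]] `&` K2 = set0 >].
      apply/orP; have [|/eqP/set0P[x [xst K1x]]] := pselect ([set` `[s, t]] `&` K1 = set0).
        by move=> ->; left; apply/asboolP.
      right; apply/asboolP/seteqP; split => // y [yst K2y].
      have := rP _ _ K1x K2y; rewrite ltNge => /negP; apply.
      move: xst yst; rewrite /= !in_itv/= => /andP[? ?] /andP[? ?].
      by rewrite ler_norml; apply/andP; split; lra.
    + apply: (le_trans (F2 _ _ as_ st tb)).
      apply: ge0_le_lower_integral => x xst; first by rewrite h20//; exact: sub.
      have xab := sub _ xst.
      have nK1 : ~ K1 x by move=> K1x; have : ([set` `[s, t]] `&` K1) x by []; rewrite K.
      have [K2x|nK2] := pselect (K2 x).
        have [_ /= /ltW h21] := K2E _ K2x.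
        by rewrite (min_idPr h21) leeDl.
      rewrite /err patchE mem_set; last by split => //; case.
      apply: (@le_trans _ _ (h1 x + h2 x)); first by rewrite leeDr// h10.
      by rewrite leeDr// m0.
    + apply: (le_trans (F1 _ _ as_ st tb)).
      apply: ge0_le_lower_integral => x xst; first by rewrite h10//; exact: sub.
      have xab := sub _ xst.
      have nK2 : ~ K2 x by move=> K2x; have : ([set` `[s, t]] `&` K2) x by []; rewrite K.
      have [K1x|nK1] := pselect (K1 x).
        have [_ /= h12] := K1E _ K1x.
        by rewrite (min_idPl h12) leeDl.
      rewrite /err patchE mem_set; last by split => //; case.
      apply: (@le_trans _ _ (h1 x + h2 x)); first by rewrite leeDl// h20.
      by rewrite leeDr// m0.
rewrite ge0_integralD//; apply: leeD => //.
rewrite /err -integral_mkcondr (setIidr Dab).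
apply/ltW; have := dP D mD Dab Dd; apply: le_lt_trans.
by apply: ge0_le_lower_integral => x Dx; [exact/h0/Dab|exact: lee_abs].
Qed.

End min_integral.

Section shift.
Local Open Scope ereal_scope.

(** Translation invariance of Lebesgue measure, checked on the half-open intervals that determine
    it. *)
Lemma integral_itv_shift (k : R -> \bar R) (a b s : R) :
  measurable_fun `[(s + a)%R, (s + b)%R] k ->
  (forall x, x \in `[(s + a)%R, (s + b)%R] -> 0 <= k x) ->
  \int[leb]_(x in `[a, b]) k (s + x)%R = \int[leb]_(x in `[(s + a)%R, (s + b)%R]) k x.
Proof.
move=> mk k0.
pose phi : measurableTypeR R -> measurableTypeR R := fun x => (s + x)%R.
have mphi : measurable_fun setT phi by apply: measurable_funD.
have phiE : forall A, measurable A -> leb A = pushforward leb phi A.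
  apply: lebesgue_measure_unique => _ [[x y] /= _ <-].
  rewrite /pushforward /=.
  have -> : phi @^-1` [set` `]x, y]] = [set` `](x - s)%R, (y - s)%R]].
    apply/seteqP; split => z /=; rewrite /phi !in_itv/= => /andP[? ?]; apply/andP; split; lra.
  rewrite !lebesgue_measure_itv/= !lte_fin ltrD2r; case: ifP => // _.
  by rewrite -!EFinB; congr (_ %:E); ring.
transitivity (\int[pushforward leb phi]_(x in `[(s + a)%R, (s + b)%R]) k x).
  rewrite ge0_integral_pushforward//; last by move=> x; rewrite inE; exact: k0.
  congr (integral _ _ _).
  apply/seteqP; split => z /=; rewrite /phi !in_itv/= => /andP[? ?]; apply/andP; split; lra.
apply: eq_measure_integral => A mA _; apply/esym; exact: phiE.
Qed.

End shift.

End real_line.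

(** * Length of curves and arc-length parametrization *)

Section curve_length.
Context {R : realType} {X : completeMetricType R}.
Implicit Types (c : R -> X).

(** Recursive form of the sum in [curve_length], suited to induction on the partition. *)
Fixpoint polygonal_length c (a : R) (s : seq R) : R :=
  if s is y :: s' then mdist (c a) (c y) + polygonal_length c y s' else 0.

Lemma polygonal_lengthE c (a b : R) (s : seq R) :
  \sum_(0 <= n < size s)
    mdist (c (nth b (a :: s) n)) (c (nth b (a :: s) n.+1)) =
  polygonal_length c a s.
Proof.
elim: s a => [|y s IH] a /=; first by rewrite big_geq.
by rewrite big_nat_recl//= IH.
Qed.

Lemma polygonal_length_le c (a b : R) (s : seq R) : itv_partition a b s ->
  ((polygonal_length c a s)%:E <= curve_length c a b)%E.
Proof.
by move=> sab; apply: ereal_sup_ubound; exists s => //; rewrite polygonal_lengthE.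
Qed.

Lemma curve_length_le c (a b : R) (M : \bar R) :
  (forall s, itv_partition a b s -> (polygonal_length c a s)%:E <= M)%E ->
  (curve_length c a b <= M)%E.
Proof.
move=> H; apply: ge_ereal_sup => _ [s sab <-]; rewrite polygonal_lengthE.
exact: H.
Qed.

Lemma curve_length_ge_mdist c (a b : R) : a <= b ->
  ((mdist (c a) (c b))%:E <= curve_length c a b)%E.
Proof.
rewrite le_eqVlt => /predU1P[->|ab].
  by rewrite mdistxx; apply: (@polygonal_length_le c b b [::]); split => /=.
have := @polygonal_length_le c a b [:: b] (itv_partition1 ab).
by rewrite /= addr0.
Qed.

Lemma curve_length_ge0 c (a b : R) : a <= b -> (0 <= curve_length c a b)%E.
Proof.
by move=> /(curve_length_ge_mdist c); apply: le_trans; rewrite lee_fin mdist_ge0.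
Qed.

Lemma polygonal_length_lip c (a b : R) (s : seq R) :
  (forall u v, a <= u -> u <= v -> v <= b -> mdist (c u) (c v) <= v - u) ->
  itv_partition a b s -> polygonal_length c a s <= b - a.
Proof.
elim: s a => [|y s IH] a clip sab.
  by rewrite (itv_partition_nil sab) /= subrr.
have ay : a < y by case: sab => /= /andP[].
have syb := itv_partition_cons sab.
have yb := itv_partition_le syb.
have := clip _ _ (lexx _) (ltW ay) yb.
have : polygonal_length c y s <= b - y; last by move=> /=; lra.
by apply: IH => // u v yu; apply: clip; rewrite (le_trans (ltW ay)).
Qed.

Lemma curve_length_lip c (a b : R) :
  (forall u v, a <= u -> u <= v -> v <= b -> mdist (c u) (c v) <= v - u) ->
  (curve_length c a b <= (b - a)%:E)%E.
Proof.
by move=> clip; apply: curve_length_le => s /(polygonal_length_lip clip).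
Qed.

Lemma polygonal_length_cat c (a b : R) (s t : seq R) : last a s = b ->
  polygonal_length c a (s ++ t) = polygonal_length c a s + polygonal_length c b t.
Proof.
elim: s a => [|y s IH] a /= lab; first by rewrite add0r lab.
by rewrite IH// addrA.
Qed.

Section lipschitz.
Variable c : R -> X.
Hypothesis clip : forall u v, mdist (c u) (c v) <= `|u - v|.

Let clip' u v : u <= v -> mdist (c u) (c v) <= v - u.
Proof.
by move=> uv; have := clip u v; rewrite distrC ger0_norm// subr_ge0.
Qed.

(** A 1-Lipschitz path has finite length on bounded intervals, so real arithmetic is available. *)
Definition lengthR (a b : R) := fine (curve_length c a b).

Lemma lengthRK a b : a <= b -> (lengthR a b)%:E = curve_length c a b.
Proof.
move=> ab; rewrite fineK// ge0_fin_numE; last exact: curve_length_ge0.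
apply: le_lt_trans (ltry (b - a)).
by apply: curve_length_lip => u v _ uv _; exact: clip'.
Qed.

Lemma lengthR_le a b : a <= b -> lengthR a b <= b - a.
Proof.
move=> ab; rewrite -lee_fin lengthRK//.
by apply: curve_length_lip => u v _ uv _; exact: clip'.
Qed.

Lemma lengthR_ge a b : a <= b -> mdist (c a) (c b) <= lengthR a b.
Proof. by move=> ab; rewrite -lee_fin lengthRK// curve_length_ge_mdist. Qed.

Lemma lengthR_polygonal a b s : a <= b -> itv_partition a b s ->
  polygonal_length c a s <= lengthR a b.
Proof. by move=> ab /(polygonal_length_le c); rewrite -lengthRK. Qed.

Lemma lengthR_ub a b M : a <= b ->
  (forall s, itv_partition a b s -> polygonal_length c a s <= M) ->
  lengthR a b <= M.
Proof.
move=> ab H; rewrite -lee_fin lengthRK//; apply: curve_length_le => s /H.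
by rewrite lee_fin.
Qed.

Lemma lengthR_superadd a b d : a <= b -> b <= d ->
  lengthR a b + lengthR b d <= lengthR a d.
Proof.
move=> ab bd; rewrite -lerBrDr; apply: lengthR_ub => // s sab.
rewrite lerBrDr addrC -lerBrDr; apply: lengthR_ub => // t tbd.
rewrite lerBrDr addrC -(@polygonal_length_cat _ a b).
  apply: lengthR_polygonal; first exact: le_trans bd.
  exact: itv_partition_cat tbd.
by case: sab => _ /eqP.
Qed.

(** Induction on the partition: points before [b] are peeled off by superadditivity, and the one
    segment that jumps over [b] is split there by the triangle inequality. *)
Lemma lengthR_subadd a b d : a <= b -> b <= d ->
  lengthR a d <= lengthR a b + lengthR b d.
Proof.
move=> ab bd; apply: lengthR_ub; first exact: le_trans bd.
move=> s; elim: s a ab => [|y s IH] a ab sad.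
  rewrite /= addr_ge0//.
    by apply: le_trans (lengthR_ge ab); rewrite mdist_ge0.
  by apply: le_trans (lengthR_ge bd); rewrite mdist_ge0.
have ay : a < y by case: sad => /= /andP[].
have syd := itv_partition_cons sad; have yd := itv_partition_le syd.
have [yb|/ltW yb] := leP y b => /=.
  have := IH _ yb syd; have := lengthR_superadd (ltW ay) yb.
  by have := lengthR_ge (ltW ay); lra.
have := metric_triangle (c a) (c b) (c y).
have := lengthR_ge ab; have := lengthR_ge yb.
by have := lengthR_superadd yb yd; have := lengthR_polygonal yd syd; lra.
Qed.

Lemma lengthRD a b d : a <= b -> b <= d ->
  lengthR a d = lengthR a b + lengthR b d.
Proof.
move=> ab bd; apply/eqP; rewrite eq_le lengthR_subadd//=.
exact: lengthR_superadd.
Qed.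

End lipschitz.

Lemma lipschitz_within_continuous (A : set R) c :
  (forall u v, A u -> A v -> mdist (c u) (c v) <= `|u - v|) ->
  {within A, continuous c}.
Proof.
move=> clip; apply/subspace_continuousP => x Ax.
apply/cvg_ballP => e e0; rewrite near_withinE.
near=> y => Ay; rewrite ballEmdist/=; apply: (le_lt_trans (clip _ _ Ax Ay)).
by near: y; exact: nbhsx_ballx.
Unshelve. all: by end_near. Qed.

End curve_length.

Section lipschitz_real.
Context {R : realType}.

Lemma IVT_lipschitz (f : R -> R) (a b v : R) : a <= b ->
  (forall s t, a <= s -> s <= t -> t <= b -> 0 <= f t - f s <= t - s) ->
  f a <= v <= f b -> exists2 t, t \in `[a, b] & f t = v.
Proof.
move=> ab flip /andP[fav vfb]; apply: IVT => //; last first.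
  have fab : f a <= f b by exact: le_trans fav vfb.
  by rewrite (min_idPl fab) (max_idPr fab) fav.
apply/subspace_continuousP => x xab.
apply/cvg_ballP => e e0; rewrite near_withinE.
near=> y => yab.
apply: (@le_lt_trans _ _ `|x - y|); last by near: y; exact: nbhsx_ballx.
move: xab yab; rewrite /= !in_itv/= => /andP[ax xb] /andP[ay yb].
have [xy|/ltW yx] := leP x y.
  have /andP[h1 h2] := flip _ _ ax xy yb.
  by rewrite distrC ger0_norm// distrC ger0_norm// subr_ge0.
have /andP[h1 h2] := flip _ _ ay yx xb.
by rewrite ger0_norm// ger0_norm// subr_ge0.
Unshelve. all: by end_near. Qed.

End lipschitz_real.

Section curves.
Context {R : realType} {X : completeMetricType R}.

Lemma curve_lipschitz (c : curve X) (u v : R) : 0 <= u -> u <= v ->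
  v <= clen c -> mdist (c u) (c v) <= v - u.
Proof.
move=> u0 uv vL; rewrite -lee_fin -(cpath_arclength u0 uv vL).
exact: curve_length_ge_mdist.
Qed.

Lemma curve_dist (c : curve X) (u v : R) : 0 <= u <= clen c ->
  0 <= v <= clen c -> mdist (c u) (c v) <= `|u - v|.
Proof.
move=> /andP[u0 uL] /andP[v0 vL]; have [uv|/ltW vu] := leP u v.
  by rewrite distrC ger0_norm ?subr_ge0//; exact: curve_lipschitz.
by rewrite metric_sym ger0_norm ?subr_ge0//; exact: curve_lipschitz.
Qed.

(** Translation by [s] matches the partitions of the two intervals and preserves polygonal lengths.
    The inequality [s < t] is strict because a [curve] has positive length. *)
Lemma subcurve_exists (c : curve X) (s t : R) : 0 <= s -> s < t ->
  t <= clen c -> exists c' : curve X,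
    clen c' = t - s /\ forall u, c' u = c (s + u).
Proof.
move=> s0 st tL; pose p u := c (s + u).
have L0 : 0 < t - s by rewrite subr_gt0.
have pc : {within `[0, t - s], continuous p}.
  apply: lipschitz_within_continuous => u v /=; rewrite !in_itv/=.
  move=> /andP[u0 ut] /andP[v0 vt]; apply: (le_trans (curve_dist _ _)).
  - by apply/andP; split; lra.
  - by apply/andP; split; lra.
  - by rewrite opprD addrACA subrr add0r.
have pl u v : 0 <= u -> u <= v -> v <= t - s -> curve_length p u v = (v - u)%:E.
  move=> u0 uv vt.
  transitivity (curve_length c (s + u) (s + v)); last first.
    by rewrite cpath_arclength; [congr (_%:E); lra|lra|lra|lra].
  apply/eqP; rewrite eq_le; apply/andP; split.
    apply: curve_length_le => l luv.
    have -> : polygonal_length p u l = polygonal_length c (s + u) (map (+%R s) l).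
      by elim: l {luv} u {u0 uv} => //= y l IH u; rewrite IH.
    apply: polygonal_length_le; split.
      rewrite path_map; case: luv => + _; apply: sub_path => x y /=.
      by rewrite /relpre/= ltrD2l.
    by rewrite last_map; case: luv => _ /eqP ->.
  apply: curve_length_le => l luv.
  have -> : polygonal_length c (s + u) l =
      polygonal_length p u (map (fun x => x - s) l).
    have {2}-> : u = (s + u) - s by rewrite addrC addKr.
    elim: l {luv} (s + u) => //= y l IH w; rewrite IH /p.
    by rewrite !(addrC s) !subrK.
  apply: polygonal_length_le; split.
    have {1}-> : u = (s + u) - s by rewrite addrC addKr.
    rewrite (@path_map _ _ (fun x => x - s) <%R (s + u) l); case: luv => + _; apply: sub_path => x y /=.
    by rewrite /relpre/= ltrD2r.
  have {1}-> : u = (s + u) - s by rewrite addrC addKr.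
  rewrite (last_map (fun x => x - s) l (s + u)); case: luv => _ /eqP ->.
  by apply/eqP; lra.
by exists (Curve L0 pc pl).
Qed.

(** [s] is the length function of [g], and the curve is [g] composed with a right inverse [tau] of
    [s] given by the intermediate value theorem. The choice of [tau] is immaterial, as [g] is
    constant wherever [s] is. *)
Lemma arclength_reparam (g : R -> X) (l : R) : 0 <= l ->
  (forall u v, mdist (g u) (g v) <= `|u - v|) -> g 0 != g l ->
  exists (c : curve X) (s : R -> R), [/\ s 0 = 0, s l = clen c,
    (forall t t', 0 <= t -> t <= t' -> t' <= l -> 0 <= s t' - s t <= t' - t) &
    forall t, 0 <= t <= l -> c (s t) = g t].
Proof.
move=> l0 glip g0l; pose s := lengthR g 0.
have s0 : s 0 = 0.
  apply/eqP; rewrite eq_le; apply/andP; split.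
    by have := lengthR_le glip (lexx 0); rewrite subrr.
  by apply: le_trans (lengthR_ge glip (lexx 0)); rewrite mdist_ge0.
have sst t t' : 0 <= t -> t <= t' -> s t' - s t = lengthR g t t'.
  by move=> t0 tt'; rewrite /s (lengthRD glip t0 tt') addrAC subrr add0r.
have slip t t' : 0 <= t -> t <= t' -> t' <= l -> 0 <= s t' - s t <= t' - t.
  move=> t0 tt' t'l; rewrite sst//; apply/andP; split; last exact: lengthR_le.
  by apply: le_trans (lengthR_ge glip tt'); rewrite mdist_ge0.
have sdist t t' : 0 <= t -> 0 <= t' -> mdist (g t) (g t') <= `|s t - s t'|.
  move=> t0 t'0; have [tt'|/ltW tt'] := leP t t'.
    rewrite distrC (le_trans _ (ler_norm _))// sst//; exact: lengthR_ge.
  rewrite metric_sym (le_trans _ (ler_norm _))// sst//; exact: lengthR_ge.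
pose L := s l.
have L0 : 0 < L.
  rewrite -mdist_gt0 in g0l; apply: (lt_le_trans g0l).
  by rewrite /L /s; exact: lengthR_ge.
(* Clamping makes the new path 1-Lipschitz on the whole line, as the lemmas on [lengthR] require. *)
pose clamp (x : R) := Num.max 0 (Num.min x L).
have clampL x : 0 <= clamp x <= L.
  by rewrite /clamp le_max lexx/= ge_max (ltW L0)/= ge_min lexx orbT.
have clampid x : 0 <= x <= L -> clamp x = x.
  by move=> /andP[x0 xL]; rewrite /clamp (min_idPl xL) (max_idPr x0).
have clamp_dist x y : `|clamp x - clamp y| <= `|x - y|.
  have le1 u v : u <= v -> `|clamp u - clamp v| <= `|u - v|.
    move=> uv; rewrite [leRHS]distrC [leRHS]ger0_norm ?subr_ge0//.
    rewrite /clamp; rewrite ler_norml.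
    have m1 (a b : R) : a <= b -> 0 <= Num.max 0 b - Num.max 0 a <= b - a.
      by case: (leP 0 a) => ?; case: (leP 0 b) => ? ?; apply/andP; split; lra.
    have m2 (a b : R) : a <= b -> 0 <= Num.min b L - Num.min a L <= b - a.
      by case: (leP a L) => ?; case: (leP b L) => ? ?; apply/andP; split; lra.
    have /andP[n1 n2] := m2 _ _ uv; rewrite subr_ge0 in n1.
    by have /andP[n3 n4] := m1 _ _ n1; apply/andP; split; lra.
  by case: (leP x y) => [/le1//|/ltW/le1]; rewrite distrC [leRHS]distrC.
have [tau tauP] : exists tau : R -> R,
    forall x, tau x \in `[0, l] /\ s (tau x) = clamp x.
  suff /choice[tau tauP] : forall x, exists t, t \in `[0, l] /\ s t = clamp x.
    by exists tau.
  move=> x; have [|t tl st] := @IVT_lipschitz R s 0 l (clamp x) l0 slip.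
    by rewrite s0; exact: clampL.
  by exists t.
pose c x := g (tau x).
have tau0 x : 0 <= tau x by have [] := tauP x; rewrite in_itv/= => /andP[].
have taul x : tau x <= l by have [] := tauP x; rewrite in_itv/= => /andP[].
have clip u v : mdist (c u) (c v) <= `|u - v|.
  apply: (le_trans (sdist _ _ (tau0 u) (tau0 v))).
  by rewrite (tauP u).2 (tauP v).2 clamp_dist.
have cs t : 0 <= t <= l -> c (s t) = g t.
  move=> /andP[t0 tl]; apply: mdist_positivity; apply/eqP.
  rewrite eq_le mdist_ge0 andbT; apply: (le_trans (sdist _ _ (tau0 _) t0)).
  rewrite (tauP _).2 clampid ?subrr ?normr0//.
  have /andP[+ _] := slip 0 t (lexx _) t0 tl; rewrite s0 subr0 => -> /=.
  by have /andP[+ _] := slip t l t0 tl (lexx _); rewrite subr_ge0.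
have pc : {within `[0, L], continuous c}.
  by apply: lipschitz_within_continuous => u v _ _.
(* [s] need not be strictly increasing, so the image of a partition need not be a partition;
   superadditivity of the length avoids this. *)
have poly t t' r : 0 <= t -> t' <= l -> itv_partition t t' r ->
    polygonal_length g t r <= lengthR c (s t) (s t').
  elim: r t => [|y r IH] t t0 t'l rtt'.
    rewrite (itv_partition_nil rtt') /=.
    by apply: le_trans (lengthR_ge clip (lexx _)); rewrite mdist_ge0.
  have ty : t < y by case: rtt' => /= /andP[].
  have ryt' := itv_partition_cons rtt'; have yt' := itv_partition_le ryt'.
  have y0 : 0 <= y by exact: le_trans (ltW ty).
  have yl := le_trans yt' t'l.
  have sty : s t <= s y.
    by rewrite -subr_ge0; have /andP[] := slip _ _ t0 (ltW ty) yl.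
  have syt' : s y <= s t'.
    by rewrite -subr_ge0; have /andP[] := slip _ _ y0 yt' t'l.
  apply: (le_trans _ (lengthR_superadd clip sty syt')) => /=.
  apply: lerD; last exact: IH.
  apply: le_trans (lengthR_ge clip sty); rewrite !cs//.
    by rewrite y0.
  by rewrite t0 (le_trans (ltW ty)).
have pl u v : 0 <= u -> u <= v -> v <= L -> curve_length c u v = (v - u)%:E.
  move=> u0 uv vL; apply/eqP; rewrite eq_le; apply/andP; split.
    apply: curve_length_lip => x y _ xy _.
    by have := clip x y; rewrite distrC ger0_norm// subr_ge0.
  rewrite -(lengthRK clip uv) lee_fin.
  have su : s (tau u) = u by rewrite (tauP u).2 clampid// u0 (le_trans uv).
  have sv : s (tau v) = v by rewrite (tauP v).2 clampid// vL (le_trans u0).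
  have [tuv|/ltW tvu] := leP (tau u) (tau v); last first.
    have := slip _ _ (tau0 v) tvu (taul u); rewrite su sv => /andP[h _].
    have -> : v - u = 0 by lra.
    by apply: le_trans (lengthR_ge clip uv); rewrite mdist_ge0.
  rewrite -{1}su -{1}sv sst//.
  apply: lengthR_ub => // r rP; have := poly _ _ _ (tau0 u) (taul v) rP.
  by rewrite su sv.
by exists (Curve L0 pc pl), s; split.
Qed.

End curves.

(** * Exhaustion of open sets and finite covers *)

Section metric_topology.
Context {R : realType} {X : completeMetricType R}.

Lemma open_mball (x : X) (r : R) : open (ball x r).
Proof.
rewrite openE => y; rewrite ballEmdist/= => xy.
apply/nbhs_ballP; exists (r - mdist x y); first by rewrite /= subr_gt0.
move=> z; rewrite !ballEmdist/= => yz.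
by have := metric_triangle x y z; lra.
Qed.

Lemma closed_mdist_le (x : X) (r : R) : closed [set y | mdist x y <= r].
Proof.
rewrite (_ : [set y | _] = ~` [set y | r < mdist x y]); last first.
  by apply/seteqP; split => y /=; [move=> h; rewrite ltNge h|move/negP; rewrite -leNgt].
apply: open_closedC; rewrite openE => y /= ry.
apply/nbhs_ballP; exists (mdist x y - r); first by rewrite /= subr_gt0.
move=> z; rewrite ballEmdist/= => yz.
by have := metric_triangle x z y; rewrite (metric_sym z y); lra.
Qed.

Lemma closed_ball_sub (O : set X) (d : R) : closed [set x | ball x d `<=` O].
Proof.
rewrite (_ : [set x | _] = ~` (\bigcup_(y in ~` O) ball y d)); last first.
  apply/seteqP; split => x /=.
    move=> xO [y /= nOy]; rewrite ballEmdist/= metric_sym => yx.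
    by apply: nOy; apply: xO; rewrite ballEmdist.
  move=> H y; rewrite ballEmdist/= => xy; apply: contrapT => nOy; apply: H.
  by exists y => //; rewrite ballEmdist/= metric_sym.
by apply: open_closedC; apply: bigcup_open => y _; exact: open_mball.
Qed.

Lemma open_ball_subP (O : set X) (x : X) : open O -> O x ->
  exists2 r : R, 0 < r & ball x r `<=` O.
Proof.
rewrite openE => oO Ox; have /nbhs_ballP[r /= r0 rO] := oO _ Ox.
by exists r.
Qed.

(** Closed and bounded, hence compact once [X] is proper, and absorbing every compact subset of an
    open [O]: local convergence on [O] reduces to convergence on countably many sets. *)
Definition exhaustion (O : set X) (n : nat) : set X :=
  [set x | mdist point x <= n%:R /\ ball x n.+1%:R^-1 `<=` O].

Lemma exhaustion_sub O n : exhaustion O n `<=` O.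
Proof.
by move=> x [_]; apply; rewrite ballEmdist/= mdistxx invr_gt0.
Qed.

Lemma closed_exhaustion O n : closed (exhaustion O n).
Proof.
rewrite /exhaustion (_ : [set x | _] = [set x | mdist point x <= n%:R] `&`
  [set x | ball x n.+1%:R^-1 `<=` O])//.
by apply: closedI; [exact: closed_mdist_le|exact: closed_ball_sub].
Qed.

Lemma exhaustion_mono O m n : (m <= n)%N -> exhaustion O m `<=` exhaustion O n.
Proof.
move=> mn x [x1 x2]; split; first by rewrite (le_trans x1)// ler_nat.
move=> y; rewrite ballEmdist/= => xy; apply: x2; rewrite ballEmdist/=.
by rewrite (lt_le_trans xy)// lef_pV2 ?posrE// ler_nat ltnS.
Qed.

Lemma exhaustion_ball O x : open O -> O x ->
  exists2 r : R, 0 < r & exists n, ball x r `<=` exhaustion O n.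
Proof.
move=> oO Ox; have [r r0 rO] := open_ball_subP oO Ox.
have r20 : 0 < r / 2 by rewrite divr_gt0.
exists (r / 2) => //.
pose n := maxn (Num.truncn (mdist point x + r / 2)).+1 (Num.truncn (r / 2)^-1).
have n1 : mdist point x + r / 2 <= n%:R.
  by rewrite (le_trans (ltW (truncnS_gt _)))// ler_nat leq_maxl.
have n2 : n.+1%:R^-1 <= r / 2.
  rewrite -[leRHS]invrK lef_pV2 ?posrE ?invr_gt0//.
  by rewrite (le_trans (ltW (truncnS_gt _)))// ler_nat ltnS leq_maxr.
exists n => y; rewrite ballEmdist/= => xy; split.
  by have := metric_triangle point x y; lra.
move=> z; rewrite ballEmdist/= => yz; apply: rO; rewrite ballEmdist/=.
have {}yz := lt_le_trans yz n2; rewrite (splitr r).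
by apply: (le_lt_trans (metric_triangle x y z)); exact: ltrD.
Qed.

Lemma compact_sub_exhaustion O K : open O -> compact K -> K `<=` O ->
  exists n, K `<=` exhaustion O n.
Proof.
move=> oO cK KO; have /(compact_near_coveringP _).1 := cK.
move=> /(_ _ \oo (fun n x => exhaustion O n x) _)[].
  move=> x /KO Ox; have [r r0 [n rn]] := exhaustion_ball oO Ox.
  exists (ball x r, [set m | (n <= m)%N]).
    by split; [exact: nbhsx_ballx|exact: nbhs_infty_ge].
  by move=> [y m] /= [xy nm]; apply: (exhaustion_mono nm); exact: rn.
by move=> n _ /(_ n (leqnn n)) Kn; exists n.
Qed.

Lemma compact_finite_ball (K : set X) (r : X -> R) : compact K ->
  (forall x, K x -> 0 < r x) ->
  exists2 s : seq X, (forall x, x \in s -> K x) &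
    forall y, K y -> exists2 x, x \in s & ball x (r x) y.
Proof.
move=> cK r0; move: (cK); rewrite compact_cover.
move=> /(_ X K (fun x => ball x (r x)))[].
- by move=> x _; exact: open_mball.
- by move=> x Kx; exists x => //; apply: ballxx; exact: r0.
- move=> D DK KD; exists (finmap.enum_fset D) => [x xD|y /KD[x /= xD xy]].
    by have := DK _ xD; rewrite inE.
  by exists x.
Qed.

End metric_topology.

(** * Doubling measures: properness and outer regularity *)

Section measure_space.
Context {R : realType} {X : completeMetricType R}.
Variable mu : {outer_measure set X -> \bar R}.
Hypothesis mu_regular : borel_regular mu.
Hypothesis mu_doubling : doubling mu.

Notation cara := (mu.-caratheodory).

Lemma borel_cara (A : set X) : <<s @open X >> A -> cara A.
Proof. by case: mu_regular => + _; apply. Qed.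

Lemma open_borel (A : set X) : open A -> <<s @open X >> A.
Proof. by move=> oA; apply: sub_sigma_algebra. Qed.

Lemma open_cara (A : set X) : open A -> cara A.
Proof. by move=> /open_borel/borel_cara. Qed.

Lemma closed_cara (A : set X) : closed A -> cara A.
Proof.
by move=> cA; rewrite -(setCK A); apply: caratheodory_measurable_setC;
  apply: open_cara; exact: closed_openC.
Qed.

Lemma ball_fin (x : X) (r : R) : (mu (ball x r) < +oo)%E.
Proof.
have [r0|r0] := ltP 0 r.
  have [Cd Cd1 /(_ x r r0)[_ _]] := mu_doubling.
  by apply: le_lt_trans; rewrite lee_pemull// outer_measure_ge0.
rewrite (_ : ball x r = set0) ?outer_measure0//.
apply/seteqP; split => // y; rewrite ballEmdist/= => xy.
by have := mdist_ge0 x y; lra.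
Qed.

Lemma ball_gt0 (x : X) (r : R) : 0 < r -> (0 < mu (ball x r))%E.
Proof.
move=> r0; have [Cd Cd1 /(_ x (r / 2))[]] := mu_doubling.
  by rewrite divr_gt0.
by rewrite mulrC divfK.
Qed.

Lemma doubling_iter (r s : R) : 0 < s -> exists2 C : R, 0 < C &
  forall x : X, (mu (ball x r) <= C%:E * mu (ball x s))%E.
Proof.
move=> s0; have [Cd Cd1 dbl] := mu_doubling.
have Cd0 : 0 < Cd by rewrite (lt_le_trans _ Cd1).
have iter n (x : X) : (mu (ball x (2 ^+ n * s)) <= (Cd ^+ n)%:E * mu (ball x s))%E.
  elim: n => [|n IH]; first by rewrite !expr0 mul1r mul1e.
  have [_ + _] := dbl x (2 ^+ n * s) (mulr_gt0 (exprn_gt0 _ (ltr0Sn _ _)) s0).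
  rewrite mulrA -exprS => /le_trans; apply.
  by rewrite exprS EFinM -muleA; apply: lee_wpmul2l => //; rewrite lee_fin ltW.
pose n := Num.truncn (r / s).
exists (Cd ^+ n) => [|x]; first exact: exprn_gt0.
apply: (le_trans _ (iter n x)); apply: le_outer_measure => y.
rewrite !ballEmdist/= => /lt_le_trans; apply.
rewrite -ler_pdivrMr// (le_trans (ltW (truncnS_gt _)))// -/n.
by rewrite -natrX ler_nat ltn_expl.
Qed.

(* Separated points in a ball have disjoint balls around them, of comparable
   measure by doubling, so that there are only boundedly many of them. *)
Lemma bounded_totally_bounded (K : set X) (x : X) (r e : R) : 0 < r -> 0 < e ->
  K `<=` ball x r ->
  exists s : seq X, forall y, K y -> exists2 z, z \in s & ball z e y.
Proof.
move=> r0 e0 Kr; apply: contrapT => nex.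
have [C C0 dC] := @doubling_iter (2 * r) (e / 2) (divr_gt0 e0 (ltr0Sn _ _)).
have step n : exists s : seq X, size s = n /\ [/\ forall y, y \in s -> K y &
   (n%:R%:E * mu (ball x r) <=
    C%:E * mu (\big[setU/set0]_(y <- s) ball y (e / 2)))%E] /\
    pairwise (fun y z => e <= mdist y z) s.
  elim: n => [|n [s [sn [[sK sm] sp]]]].
    by exists [::]; do !split => //; rewrite mul0e mule_ge0 ?lee_fin ?outer_measure_ge0// ltW.
  have [y [Ky ys]] : exists y, K y /\ forall z, z \in s -> e <= mdist z y.
    apply: contrapT => ney; apply: nex; exists s => y Ky.
    apply: contrapT => nz; apply: ney; exists y; split => // z zs.
    by rewrite leNgt; apply/negP => zy; apply: nz; exists z => //; rewrite ballEmdist.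
  exists (y :: s); split; first by rewrite /= sn.
  split; last first.
    by rewrite /= sp andbT; apply/allP => z zs; rewrite metric_sym ys.
  split; first by move=> z; rewrite inE => /orP[/eqP->//|/sK].
  rewrite big_cons.
  have dis : ball y (e / 2) `&` \big[setU/set0]_(z <- s) ball z (e / 2) = set0.
    apply/seteqP; split => // z []; rewrite ballEmdist/= => yz.
    rewrite -bigcup_seq => -[w /= ws]; rewrite ballEmdist/= => wz.
    have := metric_triangle w z y; have := ys _ ws.
    by rewrite (metric_sym z y); lra.
  have -> : mu (ball y (e / 2) `|` \big[setU/set0]_(z <- s) ball z (e / 2)) =
      (mu (ball y (e / 2)) + mu (\big[setU/set0]_(z <- s) ball z (e / 2)))%E.
    apply: (@measureU _ _ _ (cmeas mu)) => //.
      by apply: open_cara; exact: open_mball.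
    apply: open_cara; rewrite -bigcup_seq; apply: bigcup_open => z _.
    exact: open_mball.
  rewrite ge0_muleDr ?outer_measure_ge0// -natr1 EFinD ge0_muleDl ?lee_fin//.
  rewrite addeC mul1e; apply: leeD => //.
  apply: (le_trans _ (dC y)); apply: le_outer_measure => z.
  have := Kr _ Ky; rewrite !ballEmdist/= => xy xz.
  by have := metric_triangle y x z; rewrite (metric_sym y x); lra.
have M0 : (0 < mu (ball x r))%E by exact: ball_gt0.
pose M := (C%:E * mu (ball x (r + e)))%E.
have Mfin : M \is a fin_num.
  rewrite fin_numM// ge0_fin_numE ?ball_fin//; exact: outer_measure_ge0.
have mfin : mu (ball x r) \is a fin_num.
  rewrite ge0_fin_numE ?ball_fin//; exact: outer_measure_ge0.
pose n := (Num.truncn (fine M / fine (mu (ball x r)))).+1.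
have [s [sn [[sK sm] _]]] := step n.
have : (n%:R%:E * mu (ball x r) <= M)%E.
  apply: (le_trans sm); apply: lee_wpmul2l; first by rewrite lee_fin ltW.
  apply: le_outer_measure => z; rewrite -bigcup_seq => -[w /= ws].
  have := Kr _ (sK _ ws); rewrite !ballEmdist/= => xw wz.
  by have := metric_triangle x w z; lra.
have f0 : 0 < fine (mu (ball x r)) by rewrite fine_gt0// M0 ball_fin.
rewrite -(fineK Mfin) -(fineK mfin) -EFinM lee_fin leNgt => /negP; apply.
by rewrite -ltr_pdivrMr// truncnS_gt.
Qed.

(** An ultrafilter containing a totally bounded set contains one ball of each finite cover, hence is
    Cauchy and converges by completeness. *)
Lemma closed_bounded_compact (K : set X) (x : X) (r : R) :
  closed K -> K `<=` ball x r -> compact K.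
Proof.
move=> clK Kr; have [r0|r0] := ltP 0 r; last first.
  have -> : K = set0; last exact: compact0.
  apply/seteqP; split => // y /Kr; rewrite ballEmdist/= => xy.
  by have := mdist_ge0 x y; lra.
rewrite compact_ultra => F FU FK.
have FP : ProperFilter F by exact: ultra_proper.
suff Fc : cauchy F.
  have [l Fl] := (cvg_ex _).1 (cauchy_cvg F Fc).
  exists l; split => //; apply: (@closed_cvg _ _ F _ id K clK _ l Fl).
  exact: FK.
apply/cauchy_exP => e e0; apply: contrapT => nF.
have [s sK] := bounded_totally_bounded r0 e0 Kr.
have nFs (t : seq X) : F [set y | forall z, z \in t -> ~ ball z e y].
  elim: t => [|z t IH]; first by apply: filterS FK => y _ z.
  have [Fz|nFz] := in_ultra_setVsetC (ball z e) FU.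
    by exfalso; apply: nF; exists z.
  apply: filterS (filterI nFz IH) => y [/= nzy nty] w.
  by rewrite inE => /orP[/eqP->//|/nty].
have [y [Ky ny]] := @filter_ex _ F FP _ (filterI FK (nFs s)).
by have [z zs zy] := sK _ Ky; exact: (ny z).
Qed.

Lemma compact_exhaustion O n : compact (@exhaustion R X O n).
Proof.
apply: (@closed_bounded_compact _ point n.+1%:R); first exact: closed_exhaustion.
move=> x [xn _]; rewrite ballEmdist/= (le_lt_trans xn)//.
by rewrite ltr_nat.
Qed.

Section outer_regularity.

(** Approximation from both sides, so that the property passes to complements, and measured inside
    balls, since [mu] may be infinite. *)
Let approx (E : set X) := forall (n : nat) (e : R), 0 < e ->
  exists F U : set X, [/\ closed F, open U, F `<=` E, E `<=` U &
    (mu ((U `\` F) `&` ball point n.+1%:R) <= e%:E)%E].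

Let approxC E : approx E -> approx (~` E).
Proof.
move=> aE n e e0; have [F [U [cF oU FE EU m]]] := aE n e e0.
exists (~` U), (~` F); split; [exact: open_closedC|exact: closed_openC| | |].
- exact: subsetC.
- exact: subsetC.
- by rewrite (_ : ~` F `\` ~` U = U `\` F)// setDE setCK setIC.
Qed.

Let decr_small (G : (set X)^nat) (B : set X) (e : R) : 0 < e ->
  (forall i, cara (G i)) -> nonincreasing_seq G ->
  \bigcap_i G i `<=` B -> (mu (G 0%N) < +oo)%E ->
  exists N, (mu (G N) <= mu B + e%:E)%E.
Proof.
move=> e0 mG niG GB G0.
have mI : cara (\bigcap_i G i).
  by apply: (@bigcapT_measurable _ (caratheodory_type mu)).
have cvG : mu (G N) @[N --> \oo] --> mu (\bigcap_i G i).
  exact: (@nonincreasing_cvg_mu _ _ _ (cmeas mu)).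
have ni : nonincreasing_seq (fun N => mu (G N)).
  by move=> m n mn; apply: le_outer_measure; apply/subsetPset; exact: niG.
have infE : ereal_inf (range (fun N => mu (G N))) = mu (\bigcap_i G i).
  exact: cvg_unique (ereal_nonincreasing_cvgn ni) cvG.
have le0 : (mu (\bigcap_i G i) <= mu B)%E by exact: le_outer_measure.
have finI : ereal_inf (range (fun N => mu (G N))) \is a fin_num.
  rewrite infE ge0_fin_numE ?outer_measure_ge0// (le_lt_trans _ G0)//.
  by apply: le_outer_measure => x /(_ 0%N Logic.I).
have [_ [N _ <-] Ne] := lb_ereal_inf_adherent e0 finI.
exists N; apply: (le_trans (ltW Ne)); apply: leeD => //.
by rewrite infE.
Qed.

Let approx_open O : open O -> approx O.
Proof.
move=> oO n e e0; pose F k := [set x : X | ball x k.+1%:R^-1 `<=` O].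
have cF k : closed (F k) by exact: closed_ball_sub.
have [||||N] := @decr_small (fun k => (O `\` F k) `&` ball point n.+1%:R) set0 e e0.
- move=> k; apply: caratheodory_measurable_setI; last first.
    by apply: open_cara; exact: open_mball.
  by apply: caratheodory_measurable_setD; [exact: open_cara|exact: closed_cara].
- move=> i j ij; apply/subsetPset => x [[Ox nFx] xb]; split => //; split => //.
  move=> Fx; apply: nFx => y; rewrite ballEmdist/= => xy; apply: Fx.
  by rewrite ballEmdist/= (lt_le_trans xy)// lef_pV2 ?posrE// ler_nat ltnS.
- move=> x xF; have [[Ox _] _] := xF 0%N Logic.I.
  have [r r0 rO] := open_ball_subP oO Ox.
  have [[_ nF] _] := xF (Num.truncn r^-1) Logic.I; apply: nF => y.
  rewrite ballEmdist/= => xy; apply: rO; rewrite ballEmdist/= (lt_le_trans xy)//.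
  by rewrite -[leRHS]invrK lef_pV2 ?posrE ?invr_gt0// ltW// truncnS_gt.
- by apply: le_lt_trans (ball_fin point n.+1%:R); apply: le_outer_measure => x [].
rewrite outer_measure0 add0e => mN.
exists (F N), O; split => //.
by move=> x; apply; rewrite ballEmdist/= mdistxx invr_gt0.
Qed.

Let approx_bigcup (E : (set X)^nat) : (forall k, approx (E k)) ->
  approx (\bigcup_k E k).
Proof.
move=> aE n e e0; have e20 : 0 < e / 2 by rewrite divr_gt0.
have /choice[FU FUP] : forall k, exists FU : set X * set X,
    [/\ closed FU.1, open FU.2, FU.1 `<=` E k, E k `<=` FU.2 &
    (mu ((FU.2 `\` FU.1) `&` ball point n.+1%:R) <= (e / 2 / (2 ^ k.+1)%:R)%:E)%E].
  move=> k; have [|F [U H]] := aE k n (e / 2 / (2 ^ k.+1)%:R).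
    by rewrite divr_gt0// ltr0n expn_gt0.
  by exists (F, U).
pose U := \bigcup_k (FU k).2.
pose F N := \big[setU/set0]_(k < N) (FU k).1.
have cF N : closed (F N).
  by apply: closed_bigsetU => k _; have [] := FUP k.
have oU : open U by apply: bigcup_open => k _; have [] := FUP k.
pose B := \bigcup_k (((FU k).2 `\` (FU k).1) `&` ball point n.+1%:R).
have mB : (mu B <= (e / 2)%:E)%E.
  apply: (le_trans (outer_measure_sigma_subadditive mu _)).
  apply: (le_trans _ (@epsilon_trick0 R (e / 2) xpredT (ltW e20))).
  apply: lee_nneseries => k; first by rewrite outer_measure_ge0.
  by have [] := FUP k.
(* An infinite union of closed sets need not be closed. Half of [e] covers the errors of the single
   sets, the other half the passage to a finite union. *)
have [||||N] := @decr_small (fun N => (U `\` F N) `&` ball point n.+1%:R) B _ e20.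
- move=> k; apply: caratheodory_measurable_setI; last first.
    by apply: open_cara; exact: open_mball.
  by apply: caratheodory_measurable_setD; [exact: open_cara|exact: closed_cara].
- move=> i j ij; apply/subsetPset => x [[Ux nFx] xb]; split => //; split => //.
  by apply: contra_not nFx; apply: (@subset_bigsetU _ (fun k => (FU k).1)).
- move=> x xF; have [[[k _ Ux] _] xb] := xF 0%N Logic.I.
  exists k => //; split => //; split => // Fx.
  have [[_ nF] _] := xF k.+1 Logic.I; apply: nF.
  by rewrite /F big_ord_recr/=; right.
- by apply: le_lt_trans (ball_fin point n.+1%:R); apply: le_outer_measure => x [].
move=> mN; exists (F N), U; split => //.
- move=> x; rewrite /F -(bigcup_mkord N (fun k => (FU k).1)) => -[k /= _ Fx]; exists k => //.
  by have [_ _ + _ _] := FUP k; exact.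
- by move=> x [k _ Ex]; exists k => //; have [_ _ _ + _] := FUP k; exact.
- by apply: (le_trans mN); rewrite [in leRHS](splitr e) EFinD leeD2r.
Qed.

(** The sets satisfying [approx] form a sigma-algebra containing the open sets, so the Borel hull
    [B] of [E] is one of them. Its open neighbourhoods, cut to balls of radius [n + 1], are glued
    with errors [e / 2 ^ (n + 1)]. *)
Lemma outer_regular (E : set X) (e : R) : 0 < e ->
  exists U, [/\ open U, E `<=` U & (mu U <= mu E + e%:E)%E].
Proof.
move=> e0; have [B [bB EB ->]] := (mu_regular.2) E.
have aB : approx B.
  apply: (bB approx); split; last by exact: approx_open.
  split.
  - move=> n d d0; exists set0, set0; split => //; [exact: closed0|exact: open0|].
    by rewrite set0D set0I outer_measure0 lee_fin ltW.
  - by move=> A aA; rewrite setTD; exact: approxC.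
  - exact: approx_bigcup.
have /choice[U UP] : forall n, exists U : set X, [/\ open U, B `<=` U &
    (mu ((U `\` B) `&` ball point n.+1%:R) <= (e / (2 ^ n.+1)%:R)%:E)%E].
  move=> n; have [|F [U [cF oU FB BU m]]] := aB n (e / (2 ^ n.+1)%:R).
    by rewrite divr_gt0// ltr0n expn_gt0.
  exists U; split => //; apply: le_trans m; apply: le_outer_measure.
  by apply: setSI => x [Ux nBx]; split => // /FB.
pose V := \bigcup_n (U n `&` ball point n.+1%:R).
have BV : B `<=` V.
  move=> x Bx; exists (Num.truncn (mdist point x)) => //; split.
    by have [_ + _] := UP (Num.truncn (mdist point x)); exact.
  by rewrite ballEmdist/= truncnS_gt.
exists V; split; last 2 first.
- exact: subset_trans BV.
- apply: (@le_trans _ _ (mu B + mu (V `\` B))%E).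
    apply: le_trans (outer_measureU2 _ _ _); apply: le_outer_measure => x Vx.
    by have [Bx|nBx] := pselect (B x); [left|right].
  apply: leeD => //.
  apply: (@le_trans _ _ (mu (\bigcup_n ((U n `\` B) `&` ball point n.+1%:R)))).
    by apply: le_outer_measure => x [[n _ [Ux xb]] nBx]; exists n.
  apply: (le_trans (outer_measure_sigma_subadditive mu _)).
  apply: (le_trans _ (@epsilon_trick0 R e xpredT (ltW e0))).
  apply: lee_nneseries => k; first by rewrite outer_measure_ge0.
  by have [] := UP k.
apply: bigcup_open => n _; apply: openI; last exact: open_mball.
by have [] := UP n.
Qed.

End outer_regularity.

End measure_space.

(** * Integrals along curves and Borel majorants *)

Section curve_integrals.
Context {R : realType} {X : completeMetricType R}.
Notation leb := (@lebesgue_measure R).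

(** The inequality on all subcurves: arguments that cut a curve into short pieces need more than its
    end points. *)
Definition upper_along (u : X -> R) (g : X -> \bar R) (c : curve X) :=
  forall s t, 0 <= s -> s <= t -> t <= clen c ->
  ((`|u (c t) - u (c s)|)%:E <= \int[leb]_(r in `[s, t]) g (c r))%E.

Lemma measurable_curve (c : curve X) (h : X -> \bar R) : borel_fun h ->
  measurable_fun `[0, clen c] (h \o c).
Proof.
move=> bh; apply: (measurableT_comp bh).
apply: (@measurability _ _ (measurableTypeR R) (g_sigma_algebraType (@open X))
  _ _ (@open X)); first by [].
move=> _ [U oU <-].
apply: open_measurable_subspace; first exact: measurable_itv.
by move/continuousP : (@cpath_continuous _ _ c); exact.
Qed.

Lemma measurable_subcurve (c : curve X) (h : X -> \bar R) (s t : R) :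
  borel_fun h -> 0 <= s -> t <= clen c ->
  measurable_fun `[s, t] (fun r => h (c r)).
Proof.
move=> bh s0 tL; have := @measurable_curve c h bh; apply: measurable_funS => //.
by apply: subset_itv; rewrite bnd_simp.
Qed.

Lemma integral_subcurve_le (c : curve X) (h : X -> \bar R) (s t : R) :
  borel_fun h -> (forall x, 0 <= h x)%E -> 0 <= s -> t <= clen c ->
  (\int[leb]_(r in `[s, t]) h (c r) <= curve_integral c h)%E.
Proof.
move=> bh h0 s0 tL; apply: ge0_subset_integral => //.
- exact: measurable_curve.
- by apply: subset_itv; rewrite bnd_simp.
Qed.

Lemma integral_subcurve (c c' : curve X) (h : X -> \bar R) (s t : R) :
  borel_fun h -> (forall x, 0 <= h x)%E -> 0 <= s -> t <= clen c ->
  clen c' = t - s -> (forall u, c' u = c (s + u)) ->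
  curve_integral c' h = (\int[leb]_(r in `[s, t]) h (c r))%E.
Proof.
move=> bh h0 s0 tL lc' c'E; rewrite /curve_integral lc'.
have E0 : s + 0 = s by rewrite addr0.
have E1 : s + (t - s) = t by rewrite addrC subrK.
have := @integral_itv_shift R (fun r => h (c r)) 0 (t - s) s.
rewrite E0 E1 => <-//; last exact: measurable_subcurve.
by apply: eq_integral => r _; rewrite c'E.
Qed.

Lemma compact_curve (c : curve X) : compact (c @` `[0, clen c]).
Proof.
apply: continuous_compact; first exact: cpath_continuous.
exact: segment_compact.
Qed.

End curve_integrals.

Section measure_space.
Context {R : realType} {X : completeMetricType R}.
Variable mu : {outer_measure set X -> \bar R}.
Hypothesis mu_regular : borel_regular mu.
Hypothesis mu_doubling : doubling mu.

Notation cara := (mu.-caratheodory).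
Notation leb := (@lebesgue_measure R).
Notation mmu := (cmeas mu).
Notation mfun A f := (@measurable_fun _ _ (caratheodory_type mu) _ A f).
Local Open Scope ereal_scope.

Lemma borel_mfun (h : X -> \bar R) (A : set X) : borel_fun h -> cara A ->
  mfun A h.
Proof.
move=> bh cA _ Y mY; apply: caratheodory_measurable_setI => //.
by apply: borel_cara => //; rewrite -[_ @^-1` _]setTI; exact: bh.
Qed.

(** Equality of measures gives a null difference only when the measure is finite, so Borel
    regularity is applied to the bounded parts of [E]. *)
Lemma borel_hull (E : set X) : cara E ->
  exists B, [/\ <<s @open X >> B, E `<=` B & mu (B `\` E) = 0].
Proof.
move=> cE.
have /choice[B BP] : forall n : nat, exists B,
    [/\ <<s @open X >> B, E `&` ball point n.+1%:R `<=` B &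
      mu (E `&` ball point n.+1%:R) = mu B].
  by move=> n; exact: mu_regular.2.
have cEn n : cara (E `&` ball point n.+1%:R).
  by apply: caratheodory_measurable_setI => //; apply: open_cara => //; exact: open_mball.
have B0 n : mu (B n `\` (E `&` ball point n.+1%:R)) = 0.
  have [bB EB mE] := BP n.
  have fin : mu (E `&` ball point n.+1%:R) < +oo.
    apply: le_lt_trans (ball_fin mu_doubling point n.+1%:R).
    by apply: le_outer_measure; exact: subIsetr.
  have cB : cara (B n) by exact: borel_cara.
  have finB : mu (B n) < +oo by rewrite -mE.
  have := @measureD _ (caratheodory_type mu) _ mmu (B n) _ cB (cEn n) finB.
  rewrite (setIidr EB) => ->.
  rewrite /= mE subee//= -mE ge0_fin_numE//; exact: outer_measure_ge0.
exists (\bigcup_n B n); split.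
- have [_ _ h] := smallest_sigma_algebra [set: X] (@open X).
  by apply: h => n; have [] := BP n.
- move=> x Ex; exists (Num.truncn (mdist point x)) => //.
  have [_ + _] := BP (Num.truncn (mdist point x)); apply; split => //.
  by rewrite ballEmdist/= truncnS_gt.
- apply/eqP; rewrite eq_le outer_measure_ge0 andbT.
  apply: (@le_trans _ _ (mu (\bigcup_n (B n `\` (E `&` ball point n.+1%:R))))).
    apply: le_outer_measure => x [[n _ Bx] nEx]; exists n => //; split => //.
    by move=> [].
  apply: (le_trans (outer_measure_sigma_subadditive mu _)).
  by rewrite eseries0// => n _ _ /=; rewrite B0.
Qed.

(** On [O], [g] is the supremum over nonnegative rationals [q] of [q] times the indicator of the set
    where [g] exceeds [q]. Replacing these sets by Borel hulls cut to [O] changes the supremum only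
    on a null set. *)
Lemma borel_majorant (O : set X) (g : X -> \bar R) : open O -> mfun O g ->
  (forall x, O x -> 0 <= g x) ->
  exists h : X -> \bar R, [/\ borel_fun h, (forall x, 0 <= h x),
    (forall x, ~ O x -> h x = 0), (forall x, O x -> g x <= h x) &
    {ae mmu, forall x, O x -> h x = g x}].
Proof.
move=> oO mg g0.
(* Enumerates the nonnegative rationals; codes of negative rationals and invalid codes give 0. *)
pose q (n : nat) : R := Num.max 0%R (ratr (odflt 0%R (unpickle n : option rat))).
have q0 n : (0 <= q n)%R by rewrite /q le_max lexx.
pose E n := O `&` [set x | (q n)%:E < g x].
have cO := open_cara mu_regular oO.
have cE n : cara (E n) by exact: (@emeasurable_fun_o_infty _ (caratheodory_type mu)).
have /choice[B BP] : forall n, exists B,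
   [/\ <<s @open X >> B, E n `<=` B & mu (B `\` E n) = 0].
  by move=> n; exact: borel_hull.
pose B' n : set (g_sigma_algebraType (@open X)) := B n `&` O.
have mB' n : measurable (B' n).
  by apply: measurableI; [have [] := BP n|exact: open_borel].
pose hn n x := (q n * \1_(B' n) x)%:E : \bar R.
have hn0 n x : 0 <= hn n x by rewrite lee_fin mulr_ge0.
pose h x := esups (hn ^~ x) 0%N.
have hle x y : (forall n, hn n x <= y) -> h x <= y.
  by move=> H; apply: ge_ereal_sup => _ [n _ <-].
have leh x n : hn n x <= h x.
  by apply: ereal_sup_ubound; exists n.
have hge x : O x -> g x <= h x.
  move=> Ox; rewrite leNgt; apply/negP => hg.
  have [r hr] : exists r, h x = r%:E.
    exists (fine (h x)); rewrite fineK// ge0_fin_numE ?(lt_le_trans hg (leey _))//.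
    exact: le_trans (leh x 0%N).
  have r0 : (0 <= r)%R by rewrite -lee_fin -hr; exact: le_trans (leh x 0%N).
  have [r' rr' r'g] : exists2 r', (r < r')%R & r'%:E <= g x.
    case: (g x) hg => [s| |]; rewrite hr.
    - by rewrite lte_fin => rs; exists s.
    - by move=> _; exists (r + 1)%R; rewrite ?ltrDl ?leey.
    - by [].
  have [p pr] := rat_in_itvoo rr'; move: pr; rewrite in_itv/= => /andP[rp pr'].
  have qE : q (pickle p) = ratr p.
    by rewrite /q pickleK/= (max_idPr _)// (le_trans r0 (ltW rp)).
  have Ex : E (pickle p) x.
    by split => //=; rewrite qE (lt_le_trans _ r'g)// lte_fin.
  have B'x : B' (pickle p) x by split => //; have [_ + _] := BP (pickle p); exact.
  have := leh x (pickle p).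
  by rewrite /hn indicE mem_set// mulr1 qE hr lee_fin leNgt rp.
exists h; split.
- apply: measurable_fun_esups => n; apply/measurable_EFinP.
  by apply: measurable_funM => //; exact: measurable_indic.
- by move=> x; exact: le_trans (leh x 0%N).
- move=> x nOx; apply/eqP; rewrite eq_le; apply/andP; split.
    apply: hle => n; rewrite /hn indicE memNset ?mulr0//.
    by move=> [].
  exact: le_trans (leh x 0%N).
- exact: hge.
- exists (\bigcup_n (B n `\` E n)); split.
  + apply: (@bigcupT_measurable _ (caratheodory_type mu)) => n.
    apply: caratheodory_measurable_setD => //.
    by apply: borel_cara => //; have [] := BP n.
  + apply/eqP; rewrite eq_le [X in _ && X]outer_measure_ge0 andbT.
    apply: (le_trans (outer_measure_sigma_subadditive mu _)).
    by rewrite eseries0// => n _ _ /=; have [_ _ ->] := BP n.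
  + move=> x /= /not_implyP[Ox hg]; apply: contrapT => nx; apply: hg.
    apply/eqP; rewrite eq_le; apply/andP; split; last first.
      exact: hge.
    apply: hle => n; rewrite /hn indicE; have [|_] := boolP (x \in B' n).
      rewrite inE => -[Bx _]; rewrite mulr1.
      have [[_ /ltW//]|nEx] := pselect (E n x).
      by exfalso; apply: nx; exists n.
    by rewrite mulr0; exact: g0.
Qed.

End measure_space.

(** * Local integrability and convergence on compact sets *)

Section local_integrability.
Context {R : realType} {X : completeMetricType R}.
Variable mu : {outer_measure set X -> \bar R}.
Hypothesis mu_regular : borel_regular mu.
Hypothesis mu_doubling : doubling mu.

Notation cara := (mu.-caratheodory).
Notation mmu := (cmeas mu).
Notation mfun A f := (@measurable_fun _ _ (caratheodory_type mu) _ A f).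
Local Open Scope ereal_scope.

Lemma le_integral_setU (A B : set X) (f : X -> \bar R) : cara A -> cara B ->
  mfun A f -> mfun B f -> (forall x, 0 <= f x) ->
  \int[mmu]_(x in A `|` B) f x <= \int[mmu]_(x in A) f x + \int[mmu]_(x in B) f x.
Proof.
move=> cA cB mA mB f0.
have E : A `|` B = A `|` (B `\` A).
  apply/seteqP; split => x [Ax|]; [by left| |by left|by case; right].
  by move=> Bx; have [Ax|nAx] := pselect (A x); [left|right].
have cBA : cara (B `\` A) by exact: caratheodory_measurable_setD.
rewrite E ge0_integral_setU//.
- apply: leeD => //; apply: ge0_subset_integral => //.
- by apply/measurable_funU => //; split => //; apply: measurable_funS mB.
- by apply/disj_setPS => x [Ax []].
Qed.

Lemma L1S (A B : set X) (f : X -> \bar R) : cara A -> cara B -> A `<=` B ->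
  L1 mu B f -> L1 mu A f.
Proof. by move=> cA cB AB; exact: integrableS. Qed.

Lemma L1U (A B : set X) (f : X -> \bar R) : cara A -> cara B ->
  L1 mu A f -> L1 mu B f -> L1 mu (A `|` B) f.
Proof.
move=> cA cB /integrableP[mA iA] /integrableP[mB iB]; apply/integrableP; split.
  by apply/measurable_funU.
apply: (le_lt_trans (@le_integral_setU _ _ (fun x => `|f x|) _ _ _ _ _)) => //.
- exact: measurableT_comp.
- exact: measurableT_comp.
- exact: lte_add_pinfty.
Qed.

Lemma L1_measurable_diff (A : set X) (f g : X -> \bar R) :
  L1 mu A f -> L1 mu A g -> mfun A (fun x => `|f x - g x|).
Proof.
move=> /measurable_int mf /measurable_int mg.
by apply: measurableT_comp => //; exact: emeasurable_funB.
Qed.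

Lemma L1_cvgS (A B : set X) f_ f : cara A -> cara B -> A `<=` B ->
  L1_cvg mu B f_ f -> L1_cvg mu A f_ f.
Proof.
move=> cA cB AB [i_ i1 cv]; split => [i||]; [exact: L1S (i_ i)|exact: L1S i1|].
apply: (squeeze_cvge _ (cvg_cst 0) cv).
apply: nearW => n; rewrite integral_ge0//=; apply: ge0_subset_integral => //.
exact: L1_measurable_diff.
Qed.

Lemma L1_cvgU (A B : set X) f_ f : cara A -> cara B ->
  L1_cvg mu A f_ f -> L1_cvg mu B f_ f -> L1_cvg mu (A `|` B) f_ f.
Proof.
move=> cA cB [i1 i2 cv] [j1 j2 cw]; split => [i||]; [exact: L1U|exact: L1U|].
have cvw := cvgeD (isT : (0 : \bar R) +? 0) cv cw.
rewrite adde0 in cvw.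
apply: (squeeze_cvge _ (cvg_cst 0) (cvw _)).
apply: nearW => n; rewrite integral_ge0//=; apply: le_integral_setU => //.
- exact: L1_measurable_diff.
- exact: L1_measurable_diff.
Qed.

(** Common pattern for passing from balls to compact sets, used for integrability and for
    convergence in the mean. *)
Lemma compact_cover_ind (P : set X -> Prop) (O K : set X) : compact K -> K `<=` O ->
  P set0 -> (forall A B, P A -> P B -> P (A `|` B)) ->
  (forall x, O x -> exists2 r : R, (0 < r)%R & P (O `&` ball x r)) ->
  exists2 U, P U & K `<=` U.
Proof.
move=> cK KO P0 PU Ploc.
have /choice[r rP] : forall x, exists r : R, O x -> (0 < r)%R /\ P (O `&` ball x r).
  move=> x; have [Ox|nOx] := pselect (O x); last by exists 0%R.
  by have [r r0 Pr] := Ploc x Ox; exists r.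
have [|s sK Ks] := @compact_finite_ball _ _ K r cK.
  by move=> x /KO/rP[].
exists (\big[setU/set0]_(x <- s) (O `&` ball x (r x))).
  elim: s sK {Ks} => [|x s IH] sK; first by rewrite big_nil.
  rewrite big_cons; apply: PU.
    by have /KO/rP[] : K x by apply: sK; rewrite inE eqxx.
  by apply: IH => y ys; apply: sK; rewrite inE ys orbT.
move=> y Ky; have [x xs xy] := Ks _ Ky.
by rewrite -bigcup_seq; exists x => //; split => //; exact: KO.
Qed.

Lemma L1_set0 (f : X -> \bar R) : L1 mu set0 f.
Proof.
by apply/integrableP; split; [exact: measurable_fun_set0|rewrite integral_set0].
Qed.

Lemma L1_compact (O K : set X) (f : X -> \bar R) : open O -> compact K ->
  K `<=` O -> L1_loc mu O f -> L1 mu K f.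
Proof.
move=> oO cK KO Lf.
have [|||U [cU LU] KU] :=
    @compact_cover_ind (fun A => cara A /\ L1 mu A f) O K cK KO.
- split; [exact: caratheodory_measurable_set0|exact: L1_set0].
- move=> A B [cA LA] [cB LB]; split; last exact: L1U.
  exact: caratheodory_measurable_setU.
- move=> x /Lf[r r0 Lr]; exists r => //; split => //.
  apply: open_cara => //; apply: openI => //; exact: open_mball.
- apply: L1S LU => //; apply: closed_cara => //; apply: compact_closed => //.
  exact: metric_hausdorff.
Qed.

Lemma L1_cvg_compact (O K : set X) f_ f : open O -> compact K ->
  K `<=` O -> L1_loc_cvg mu O f_ f -> L1_cvg mu K f_ f.
Proof.
move=> oO cK KO Lf.
have [|||U [cU LU] KU] :=
    @compact_cover_ind (fun A => cara A /\ L1_cvg mu A f_ f) O K cK KO.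
- split; first exact: caratheodory_measurable_set0.
  split => [i||]; [exact: L1_set0|exact: L1_set0|].
  by under eq_fun do rewrite integral_set0; exact: cvg_cst.
- move=> A B [cA LA] [cB LB]; split; last exact: L1_cvgU.
  exact: caratheodory_measurable_setU.
- move=> x /Lf[r r0 Lr]; exists r => //; split => //.
  apply: open_cara => //; apply: openI => //; exact: open_mball.
- apply: L1_cvgS LU => //; apply: closed_cara => //; apply: compact_closed => //.
  exact: metric_hausdorff.
Qed.

Lemma exhaustion_cara (O : set X) n : cara (exhaustion O n).
Proof. by apply: closed_cara => //; exact: closed_exhaustion. Qed.

Lemma L1_exhaustion (O : set X) n (f : X -> \bar R) : open O ->
  L1_loc mu O f -> L1 mu (exhaustion O n) f.
Proof.
move=> oO; apply: L1_compact => //; last exact: exhaustion_sub.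
exact: (compact_exhaustion mu_regular mu_doubling).
Qed.

Lemma L1_cvg_exhaustion (O : set X) n f_ f : open O ->
  L1_loc_cvg mu O f_ f -> L1_cvg mu (exhaustion O n) f_ f.
Proof.
move=> oO; apply: L1_cvg_compact => //; last exact: exhaustion_sub.
exact: (compact_exhaustion mu_regular mu_doubling).
Qed.

Lemma L1_loc_cvg_exhaustion (O : set X) f_ f : open O ->
  (forall n, L1_cvg mu (exhaustion O n) f_ f) -> L1_loc_cvg mu O f_ f.
Proof.
move=> oO H x Ox; have [r r0 [n rn]] := exhaustion_ball oO Ox.
exists r => //; apply: L1_cvgS (H n); last by move=> y [_ /rn].
- by apply: open_cara => //; apply: openI => //; exact: open_mball.
- exact: exhaustion_cara.
Qed.

End local_integrability.

(** * Exceptional families and minimal weak upper gradients *)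

Section weak_upper_gradients.
Context {R : realType} {X : completeMetricType R}.
Variable mu : {outer_measure set X -> \bar R}.
Hypothesis mu_regular : borel_regular mu.
Hypothesis mu_doubling : doubling mu.

Notation cara := (mu.-caratheodory).
Notation leb := (@lebesgue_measure R).
Notation mmu := (cmeas mu).
Notation mfun A f := (@measurable_fun _ _ (caratheodory_type mu) _ A f).
Local Open Scope ereal_scope.

Lemma exceptional_sub (G G' : set (curve X)) : G `<=` G' ->
  exceptional mu G' -> exceptional mu G.
Proof.
move=> GG' [rho [b r0 i H]]; exists rho; split => // c /GG'; exact: H.
Qed.

Lemma caraT : cara [set: X].
Proof. by apply: (@measurableT _ (caratheodory_type mu)). Qed.

Lemma exceptional_integrable (h : X -> \bar R) : borel_fun h ->
  (forall x, 0 <= h x) -> \int[mmu]_x h x < +oo ->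
  exceptional mu [set c | curve_integral c h = +oo].
Proof.
move=> bh h0 ih; exists h; split => //; apply/integrableP; split.
  by apply: borel_mfun => //; exact: caraT.
by under eq_integral do rewrite gee0_abs//.
Qed.

(** Positive weights [k n] make the densities summable with total integral at most 1; an infinite
    line integral of a single density survives its weight. *)
Lemma exceptional_bigcup (G : (set (curve X))^nat) :
  (forall n, exceptional mu (G n)) -> exceptional mu (\bigcup_n G n).
Proof.
move=> /choice[rho rhoP].
have rho0 n x : 0 <= rho n x by have [] := rhoP n.
have brho n : borel_fun (rho n) by have [] := rhoP n.
have mrho n : mfun setT (rho n) by apply: borel_mfun => //; exact: caraT.
have I0 n : 0 <= \int[mmu]_x rho n x by apply: integral_ge0.
have Ifin n : \int[mmu]_x rho n x \is a fin_num.
  by have [_ _ + _] := rhoP n; exact: integrable_fin_num.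
pose k n : R := (1 / (2 ^ n.+1)%:R / (1 + fine (\int[mmu]_x rho n x)))%R.
have kd n : (0 < 1 + fine (\int[mmu]_x rho n x))%R.
  by rewrite ltr_pwDl// fine_ge0.
have k0 n : (0 < k n)%R by rewrite /k !divr_gt0// ltr0n expn_gt0.
pose f n x := (k n)%:E * rho n x.
have f0 n x : 0 <= f n x by rewrite mule_ge0// lee_fin ltW.
pose r x := \sum_(n <oo) f n x.
have br : borel_fun r.
  apply: (@ge0_emeasurable_sum _ (g_sigma_algebraType (@open X)) _ _ f xpredT).
    by move=> n x _ _; exact: f0.
  by move=> n _; apply: measurable_funeM; exact: brho.
exists r; split => //.
- by move=> x; apply: nneseries_ge0 => n _ _; exact: f0.
- apply/integrableP; split.
    by apply: borel_mfun => //; exact: caraT.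
  under eq_integral.
    move=> x _; rewrite gee0_abs; last by apply: nneseries_ge0 => n _ _; exact: f0.
    over.
  rewrite integral_nneseries//; last first.
    by move=> n; apply: measurable_funeM; exact: mrho.
  apply: (@le_lt_trans _ _ 1%:E); last exact: ltry.
  apply: (le_trans _ (@epsilon_trick0 R 1 xpredT ler01)).
  apply: lee_nneseries => [n _ _|n _]; first exact: integral_ge0.
  rewrite ge0_integralZl_EFin//; last exact: ltW.
  rewrite -[X in _ * X](fineK (Ifin n)) -EFinM lee_fin /k mulrAC ler_pdivrMr//.
  by rewrite ler_wpM2l ?lerDr// divr_ge0.
- move=> c [n _ Gc]; have [_ _ _ /(_ c Gc) H] := rhoP n.
  apply/eqP; rewrite -leye_eq.
  have <- : curve_integral c (f n) = +oo.
    rewrite /curve_integral ge0_integralZl_EFin//.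
    + by rewrite -[X in _ * X]/(curve_integral c (rho n)) H gt0_muley// lte_fin.
    + exact: measurable_curve.
    + exact: ltW.
  apply: ge0_le_lower_integral => // t _; rewrite /r.
  have := @nneseries_lim_ge R (fun n => f n (c t)) xpredT 0%N n.+1
    (fun n _ _ => f0 n (c t)).
  apply: le_trans; rewrite big_nat_recr//= leeDr//.
  by apply: sume_ge0.
Qed.

Lemma exceptionalU (G G' : set (curve X)) : exceptional mu G ->
  exceptional mu G' -> exceptional mu (G `|` G').
Proof.
move=> eG eG'.
apply: (@exceptional_sub _ (\bigcup_n (if n is 0%N then G else G'))).
  by move=> c [Gc|Gc]; [exists 0%N|exists 1%N].
by apply: exceptional_bigcup; case.
Qed.

(** The new exceptional family consists of all curves with infinite integral of [rho]. A curve
    outside it has a finite such integral on each subcurve, so no subcurve belongs to the old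
    family. *)
Lemma wug_along (O : set X) (u : X -> R) (g h : X -> \bar R) :
  weak_upper_gradient mu O (EFin \o u) g -> borel_fun h ->
  (forall x, 0 <= h x) -> (forall x, O x -> g x <= h x) ->
  exists2 G, exceptional mu G &
    forall c, curve_in O c -> ~ G c -> upper_along u h c.
Proof.
move=> [mg g0 [G [rho [brho rho0 irho rhoG]] GP]] bh h0 gh.
exists [set c | curve_integral c rho = +oo].
  exists rho; split => //.
move=> c cO nc s t s0 st tL.
have [<-|neq] := eqVneq s t.
  by rewrite subrr normr0 integral_ge0.
have {neq}st : (s < t)%R by rewrite lt_neqAle neq.
have [c' [lc' c'E]] := subcurve_exists s0 st tL.
have c'O : curve_in O c'.
  move=> _ [r /= rL <-]; rewrite c'E; apply: cO; exists (s + r)%R => //=.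
  by move: rL; rewrite !in_itv/= lc' => /andP[? ?]; apply/andP; split; lra.
have nc' : ~ G c'.
  move=> /rhoG H; apply: nc; apply/eqP; rewrite -leye_eq -H.
  rewrite (@integral_subcurve _ _ c c' rho s t)//; exact: integral_subcurve_le.
have := GP c' c'O nc'; rewrite /gradient_ineq /cstart /cend lc' !c'E addr0.
have -> : (s + (t - s) = t)%R by rewrite addrC subrK.
rewrite /= distrC => /le_trans; apply.
rewrite -(@integral_subcurve _ _ c c' h s t)//.
apply: ge0_le_lower_integral => r rL.
  by apply: g0; apply: c'O; exists r.
by apply: gh; apply: c'O; exists r.
Qed.

Lemma along_wug (O : set X) (u : X -> R) (h : X -> \bar R) (G : set (curve X)) :
  cara O -> borel_fun h -> (forall x, 0 <= h x) -> exceptional mu G ->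
  (forall c, curve_in O c -> ~ G c -> upper_along u h c) ->
  weak_upper_gradient mu O (EFin \o u) h.
Proof.
move=> cO bh h0 eG H; split => //; first exact: borel_mfun.
exists G => // c cO' nG; have := H c cO' nG 0%R (clen c) (lexx _) _ (lexx _).
by move=> /(_ (ltW (clen_gt0 c))); rewrite /gradient_ineq /= distrC.
Qed.

Lemma upper_along_mine (u : X -> R) (h1 h2 : X -> \bar R) (c : curve X) :
  borel_fun h1 -> borel_fun h2 ->
  (forall x, 0 <= h1 x) -> (forall x, 0 <= h2 x) ->
  curve_integral c h1 < +oo -> curve_integral c h2 < +oo ->
  upper_along u h1 c -> upper_along u h2 c ->
  upper_along u (fun x => mine (h1 x) (h2 x)) c.
Proof.
move=> b1 b2 h10 h20 i1 i2 u1 u2 s t s0 st tL.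
have int h : borel_fun h -> (forall x, 0 <= h x) -> curve_integral c h < +oo ->
    leb.-integrable `[s, t] (fun r => h (c r)).
  move=> bh h0 ih; apply/integrableP; split; first exact: measurable_subcurve.
  under eq_integral do rewrite gee0_abs//.
  by apply: le_lt_trans ih; exact: integral_subcurve_le.
apply: (@le_integral_mine R (fun r => u (c r)) (fun r => h1 (c r)) (fun r => h2 (c r))) => //.
- exact: int.
- exact: int.
- move=> a b sa ab bt; apply: u1 => //; [exact: le_trans sa|exact: le_trans tL].
- move=> a b sa ab bt; apply: u2 => //; [exact: le_trans sa|exact: le_trans tL].
Qed.

Lemma borel_mine (h1 h2 : X -> \bar R) : borel_fun h1 -> borel_fun h2 ->
  borel_fun (fun x => mine (h1 x) (h2 x)).
Proof. by move=> b1 b2; exact: measurable_mine. Qed.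

Lemma borel_patch (h : X -> \bar R) (A : set X) : <<s @open X >> A ->
  borel_fun h -> borel_fun (h \_ A).
Proof.
move=> bA bh; have mA : measurable (A : set (g_sigma_algebraType (@open X))) by [].
pose h' : g_sigma_algebraType (@open X) -> \bar R := h.
have mh := (measurable_restrictT h' mA).1; apply: mh.
exact: measurable_funTS.
Qed.


(** Dominated convergence along the curve, the first function being the dominating one. *)
Lemma upper_along_lim (u : X -> R) (k : nat -> X -> \bar R) (c : curve X) :
  (forall n, borel_fun (k n)) -> (forall n x, 0 <= k n x) ->
  (forall x, nonincreasing_seq (k ^~ x)) ->
  curve_integral c (k 0%N) < +oo ->
  (forall n, upper_along u (k n) c) ->
  upper_along u (fun x => ereal_inf (range (k ^~ x))) c.
Proof.
move=> bk k0 nik ik uk s t s0 st tL.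
have ck x : k ^~ x @ \oo --> ereal_inf (range (k ^~ x)).
  exact: ereal_nonincreasing_cvgn.
have mk n : measurable_fun `[s, t] (fun r => k n (c r)) by exact: measurable_subcurve.
have ik0 : leb.-integrable `[s, t] (fun r => k 0%N (c r)).
  apply/integrableP; split; first exact: mk.
  under eq_integral do rewrite gee0_abs//.
  by apply: le_lt_trans ik; exact: integral_subcurve_le.
have mst : @measurable _ (measurableTypeR R) [set` `[s, t]].
  exact: measurable_itv.
have mg : measurable_fun `[s, t] (fun r => ereal_inf (range (k ^~ (c r)))).
  exact: (@emeasurable_fun_cvg _ _ _ _ (fun n r => k n (c r))).
have ck' : {ae leb, forall r, [set` `[s, t]] r ->
    (fun n => k n (c r)) @ \oo --> ereal_inf (range (k ^~ (c r)))}.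
  by apply: aeW => r _; exact: ck.
have dom : {ae leb, forall r n, [set` `[s, t]] r -> `|k n (c r)| <= k 0%N (c r)}.
  by apply: aeW => r n _; rewrite gee0_abs//; exact: (nik _ 0%N n).
have [_ _ cv] := dominated_convergence mst mk mg ck' ik0 dom.
rewrite -(cvg_lim _ cv)//; apply: lime_ge; first by apply/cvg_ex; eexists; exact: cv.
by apply: nearW => n; exact: uk.
Qed.

Lemma borel_inf (k : nat -> X -> \bar R) : (forall n, borel_fun (k n)) ->
  borel_fun (fun x => ereal_inf (range (k ^~ x))).
Proof.
move=> bk; have := @measurable_fun_einfs _ (g_sigma_algebraType (@open X)) R setT k.
move=> /(_ bk 0%N); congr measurable_fun; apply/funext => x.
by congr ereal_inf; apply/seteqP; split => y [n _ <-]; exists n.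
Qed.

Lemma curve_integral_mono (c : curve X) (f g : X -> \bar R) :
  (forall x, 0 <= f x) -> (forall x, f x <= g x) ->
  curve_integral c f <= curve_integral c g.
Proof. by move=> f0 fg; apply: ge0_le_lower_integral. Qed.

Lemma exceptional_curve_in (O : set X) (h : X -> \bar R) : open O ->
  borel_fun h -> (forall x, 0 <= h x) -> \int[mmu]_(x in O) h x < +oo ->
  exceptional mu [set c | curve_in O c /\ curve_integral c h = +oo].
Proof.
move=> oO bh h0 ih; apply: exceptional_sub; last first.
  apply: (@exceptional_integrable (h \_ O)).
  - by apply: borel_patch => //; exact: open_borel.
  - by apply: erestrict_ge0 => x _.
  - by rewrite -integral_mkcond.
move=> c [cO ch]; rewrite /= -ch; apply: eq_integral => r rL.
by rewrite patchE mem_set//; apply: cO; exists r; rewrite // inE in rL.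
Qed.

(** [h] need not be integrable on [O], but the image of a curve in [O] is compact and lies in one
    set of the exhaustion, where [h] is integrable. *)
Lemma exceptional_L1_loc (O : set X) (h : X -> \bar R) : open O ->
  borel_fun h -> (forall x, 0 <= h x) -> L1_loc mu O h ->
  exceptional mu [set c | curve_in O c /\ curve_integral c h = +oo].
Proof.
move=> oO bh h0 ih.
apply: (@exceptional_sub _
  (\bigcup_n [set c | curve_integral c (h \_ (exhaustion O n)) = +oo])); last first.
  apply: exceptional_bigcup => n; apply: exceptional_integrable.
  - apply: borel_patch => //; have /open_borel := closed_openC (@closed_exhaustion _ _ O n).
    have [_ + _] := smallest_sigma_algebra [set: X] (@open X).
    by move=> /[apply]; rewrite setTD setCK.
  - by apply: erestrict_ge0 => x _.
  - rewrite -integral_mkcond.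
    have /integrableP[_] := L1_exhaustion mu_regular mu_doubling n oO ih.
    by apply: le_lt_trans; apply: ge0_le_lower_integral => // x _; rewrite gee0_abs.
move=> c [cO ch]; have [n cn] := compact_sub_exhaustion oO (@compact_curve _ _ c) cO.
exists n => //=; rewrite -ch; apply: eq_integral => r rL.
by rewrite patchE mem_set//; apply: cn; exists r; rewrite // inE in rL.
Qed.

(** The minimum is at most [g] and has the same finite integral on [O], hence on every measurable
    part of [O]; so it equals [g] almost everywhere. *)
Lemma ae_le_of_integral_mine (O : set X) (g h : X -> \bar R) : cara O ->
  mfun O g -> mfun O h -> (forall x, O x -> 0 <= g x) -> (forall x, O x -> 0 <= h x) ->
  \int[mmu]_(x in O) g x < +oo ->
  \int[mmu]_(x in O) g x <= \int[mmu]_(x in O) mine (g x) (h x) ->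
  {ae mmu, forall x, O x -> g x <= h x}.
Proof.
move=> cO mg mh g0 h0 gfin gm.
have mm : mfun O (fun x => mine (g x) (h x)) by exact: measurable_mine.
have m0 x : O x -> 0 <= mine (g x) (h x) by move=> Ox; rewrite le_min g0// h0.
have ig : mmu.-integrable O g.
  apply/integrableP; split => //.
  apply: le_lt_trans gfin; apply: ge0_le_lower_integral => // x Ox.
  by rewrite gee0_abs ?g0.
have : ae_eq mmu O g (fun x => mine (g x) (h x)).
  apply: integral_ae_eq => // E EO cE.
  have sub F : F `<=` O -> cara F ->
      \int[mmu]_(x in F) mine (g x) (h x) <= \int[mmu]_(x in F) g x.
    move=> FO cF; apply: ge0_le_lower_integral => x Fx; first exact/m0/FO.
    by rewrite ge_min lexx.
  have cOE : cara (O `\` E) by exact: caratheodory_measurable_setD.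
  have split_ f : mfun O f -> (forall x, O x -> 0 <= f x) ->
      \int[mmu]_(x in O) f x =
      \int[mmu]_(x in E) f x + \int[mmu]_(x in O `\` E) f x.
    move=> mf f0; rewrite -[in LHS](setDUK EO) ge0_integral_setU//.
    - by rewrite setDUK.
    - by move=> x; rewrite setDUK//; exact: f0.
    - by apply/disj_setPS => x [Ex []].
  apply/eqP; rewrite eq_le sub// andbT leNgt; apply/negP => lt.
  move: gm; rewrite (split_ g)// (split_ (fun x => mine (g x) (h x)))// leNgt => /negP; apply.
  have fin F : F `<=` O -> cara F -> \int[mmu]_(x in F) g x \is a fin_num.
    move=> FO cF; rewrite ge0_fin_numE; last by apply: integral_ge0 => x /FO/g0.
    by apply: le_lt_trans gfin; exact: ge0_subset_integral.
  apply: lte_leD => //.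
  - rewrite ge0_fin_numE; last by apply: integral_ge0 => x [/m0].
    apply: (le_lt_trans (sub _ _ cOE)); first exact: subDsetl.
    by rewrite -ge0_fin_numE; [apply: fin => //|apply: integral_ge0 => x [/g0]].
  - by apply: sub => //; exact: subDsetl.
apply: filterS => x /= gx Ox; rewrite gx//.
by rewrite ge_min lexx orbT.
Qed.

(* The infimum of a minimizing sequence of the energy among the weak upper
   gradients, which are stable under minima and monotone limits. *)
Lemma minimal_weak_upper_gradient_exists (O : set X) (u : X -> R)
    (g0 : X -> \bar R) : open O ->
  weak_upper_gradient mu O (EFin \o u) g0 ->
  \int[mmu]_(x in O) g0 x < +oo ->
  exists g, minimal_weak_upper_gradient mu O (EFin \o u) g /\
    \int[mmu]_(x in O) g x <= \int[mmu]_(x in O) g0 x.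
Proof.
move=> oO wg0 ig0.
have cO := open_cara mu_regular oO.
(* Borel competitors suffice, each gradient having a Borel majorant equal to it almost everywhere;
   they are measurable along every curve. *)
pose adm (h : X -> \bar R) := [/\ borel_fun h, (forall x, 0 <= h x) &
  weak_upper_gradient mu O (EFin \o u) h].
pose E (h : X -> \bar R) := \int[mmu]_(x in O) h x.
have E0 h : adm h -> 0 <= E h by move=> [_ h0 _]; apply: integral_ge0.
have admG h : adm h -> exists2 G, exceptional mu G &
    forall c, curve_in O c -> ~ G c -> upper_along u h c.
  by move=> [bh h0 wh]; apply: (wug_along wh).
have hull g : weak_upper_gradient mu O (EFin \o u) g ->
    exists h, adm h /\ {ae mmu, forall x, O x -> h x = g x}.
  move=> wg; have [mg gge0 _] := wg.
  have [h [bh h0 _ gh hg]] := borel_majorant mu_regular mu_doubling oO mg gge0.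
  exists h; split => //; split => //.
  have [G eG GP] := wug_along wg bh h0 gh.
  exact: along_wug GP.
have [h0 [adm0 h0g]] := hull _ wg0.
have Eh0 : E h0 = \int[mmu]_(x in O) g0 x.
  have [mg gge0 _] := wg0; have [bh hh0 _] := adm0.
  by apply: ge0_ae_eq_integral => //; exact: borel_mfun.
pose I := ereal_inf [set E h | h in adm].
have I0 : 0 <= I by apply/ereal_infP => _ [h /E0 ? <-].
have Ile h : adm h -> I <= E h by move=> ah; apply: ereal_inf_lbound; exists h.
have Ifin : I \is a fin_num.
  rewrite ge0_fin_numE//; apply: le_lt_trans ig0; rewrite -Eh0; exact: Ile.
have /choice[h hP] : forall n : nat, exists h, adm h /\ E h < I + (n.+1%:R^-1)%:E.
  move=> n; have n0 : (0 < n.+1%:R^-1 :> R)%R by rewrite invr_gt0.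
  have [_ [h ah <-] hI] := lb_ereal_inf_adherent n0 Ifin.
  by exists h.
(* Running minima started at [h0]: all of them are dominated by [h0], whose line integral is finite
   on almost every curve in [O]. *)
pose k := fix k n := if n is m.+1 then (fun x => mine (k m x) (h m x)) else h0.
have bk n : borel_fun (k n).
  elim: n => [|n IH] /=; first by case: adm0.
  by apply: borel_mine => //; have [[]] := hP n.
have k0 n x : 0 <= k n x.
  elim: n => [|n IH] /=; first by case: adm0.
  by rewrite le_min IH; have [[_ -> _]] := hP n.
have nik x : nonincreasing_seq (k ^~ x).
  by apply/nonincreasing_seqP => n /=; rewrite ge_min lexx.
have /choice[G GP] : forall n, exists G, exceptional mu G /\
    forall c, curve_in O c -> ~ G c -> upper_along u (h n) c /\
      curve_integral c (h n) < +oo.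
  move=> n; have [[bh hh0 wh] hI] := hP n.
  have [G eG H] := admG _ (hP n).1.
  exists (G `|` [set c | curve_in O c /\ curve_integral c (h n) = +oo]); split.
    apply: exceptionalU => //; apply: exceptional_curve_in => //.
    by apply: (lt_trans hI); rewrite -(fineK Ifin) -EFinD ltry.
  move=> c cO' /not_orP[nG nc]; split; first exact: H.
  by rewrite ltey; apply/eqP => ci; apply: nc.
have [G0 eG0 G0P] := admG _ adm0.
pose GG := (G0 `|` [set c | curve_in O c /\ curve_integral c h0 = +oo])
  `|` \bigcup_n G n.
have eGG : exceptional mu GG.
  apply: exceptionalU; last first.
    by apply: exceptional_bigcup => n; have [] := GP n.
  apply: exceptionalU => //; apply: exceptional_curve_in => //; [by case: adm0|by case: adm0|].
  by rewrite -[X in X < _]/(E h0) Eh0.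
have GGP c : curve_in O c -> ~ GG c -> curve_integral c h0 < +oo /\
    forall n, upper_along u (k n) c.
  move=> cO' /not_orP[/not_orP[nG0 nc] nG].
  have ch0 : curve_integral c h0 < +oo.
    by rewrite ltey; apply/eqP => ci; apply: nc.
  have kfin n : curve_integral c (k n) < +oo.
    apply: le_lt_trans ch0; apply: curve_integral_mono => // x.
    exact: (nik x 0%N n).
  split => //; elim => [|n IH]; first exact: G0P.
  have [] := (GP n).2 c cO' _; first by move=> Gn; apply: nG; exists n.
  have [[bh hh0 wh] hI] := hP n.
  by move=> un ufin; apply: upper_along_mine.
pose g x := ereal_inf (range (k ^~ x)).
have bg : borel_fun g by exact: borel_inf.
have gge0 x : 0 <= g x by apply/ereal_infP => _ [n _ <-].
have gk n x : g x <= k n x by apply: ereal_inf_lbound; exists n.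
have gP c : curve_in O c -> ~ GG c -> upper_along u g c.
  by move=> cO' nG; have [ch0 uk] := GGP c cO' nG; apply: upper_along_lim.
have wg : weak_upper_gradient mu O (EFin \o u) g by exact: along_wug gP.
have EgI : E g <= I.
  apply/lee_addgt0Pr => e e0.
  pose n := Num.truncn e^-1.
  apply: (@le_trans _ _ (I + (n.+1%:R^-1)%:E)).
    apply: (le_trans _ (ltW (hP n).2)); apply: ge0_le_lower_integral => // x _.
    by apply: (le_trans (gk n.+1 x)); rewrite /= ge_min lexx orbT.
  rewrite leeD2l// lee_fin -[leRHS]invrK lef_pV2 ?posrE ?invr_gt0//.
  by rewrite ltW// truncnS_gt.
have Egfin : E g < +oo by apply: le_lt_trans EgI _; rewrite ltey_eq Ifin.
exists g; split; last by rewrite -Eh0; apply: (le_trans EgI); exact: Ile.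
split => // g' wg' Lg'.
have [h' [adm' h'g']] := hull _ wg'.
have [bh' h'0 wh'] := adm'.
have Lh' : L1_loc mu O h'.
  move=> x Ox; have [r r0 Lr] := Lg' x Ox; exists r => //.
  have cOr : cara (O `&` ball x r).
    by apply: open_cara => //; apply: openI => //; exact: open_mball.
  move/integrableP : Lr => [mg' ig']; apply/integrableP; split; first exact: borel_mfun.
  apply: le_lt_trans ig'; rewrite le_eqVlt; apply/orP; left; apply/eqP.
  apply: ge0_ae_eq_integral => //.
  - by apply: measurableT_comp => //; exact: borel_mfun.
  - exact: measurableT_comp.
  - case: h'g' => N [mN N0 NP]; exists N; split => // y /= H; apply: NP => /= H2.
    by apply: H => -[Oy _]; rewrite H2.
have [G' eG' G'P] := admG _ adm'.
pose H' := [set c | curve_in O c /\ curve_integral c h' = +oo].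
have eH' : exceptional mu H' by exact: exceptional_L1_loc.
(* The competitor may have infinite energy on [O], but its minimum with [g] is admissible, hence has
   energy at least [I], and so at least that of [g]. This forces [g <= h'] almost everywhere. *)
have wm : weak_upper_gradient mu O (EFin \o u) (fun x => mine (g x) (h' x)).
  apply: (@along_wug O u _ (GG `|` (G' `|` H'))) => //.
  - exact: borel_mine.
  - by move=> x; rewrite le_min gge0 h'0.
  - by do 2 apply: exceptionalU => //.
  - move=> c cO' /not_orP[nGG /not_orP[nG' nH']].
    have [ch0 _] := GGP c cO' nGG.
    apply: upper_along_mine => //.
    + by apply: le_lt_trans ch0; apply: curve_integral_mono => // x; exact: (gk 0%N).
    + by rewrite ltey; apply/eqP => ci; apply: nH'.
    + exact: gP.
    + exact: G'P.
have am : adm (fun x => mine (g x) (h' x)).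
  split => //; first exact: borel_mine.
  by move=> x; rewrite le_min gge0 h'0.
have gh' : {ae mmu, forall x, O x -> g x <= h' x}.
  apply: ae_le_of_integral_mine => //.
  - exact: borel_mfun.
  - exact: borel_mfun.
  - by apply: (le_trans EgI); exact: Ile.
case: gh' => N [mN N0 NP]; case: h'g' => N' [mN' N'0 NP'].
exists (N `|` N'); split; first exact: measurableU.
  apply/eqP; rewrite eq_le [X in _ && X]outer_measure_ge0 andbT.
  by apply: (le_trans (outer_measureU2 mu _ _)); rewrite -[mu N]/(mmu N) -[mu N']/(mmu N') N0 N'0 adde0.
move=> x /= /not_implyP[Ox nle].
have [nH|/contrapT H] := pselect (~ (O x -> g x <= h' x)); first by left; exact: NP.
right; apply: NP' => /= H2; apply: nle; rewrite -H2//; exact: H.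
Qed.

End weak_upper_gradients.

(** * Product of a truncated function with a cutoff *)

Section cutoff_product.
Context {R : realType} {X : completeMetricType R}.
Notation leb := (@lebesgue_measure R).

Definition uniformly_locally_lipschitz (f : X -> R) :=
  exists L r : R, [/\ 0 <= L, 0 < r &
    forall x y, mdist x y <= r -> `|f x - f y| <= L * mdist x y].

Definition truncation (M a : R) : R := Num.max (- M) (Num.min a M).

Lemma truncation_bound (M a : R) : 0 <= M -> `|truncation M a| <= M.
Proof.
move=> M0; rewrite /truncation ler_norml le_max lexx/= ge_max ge_min lexx orbT andbT.
by lra.
Qed.

Lemma truncation_lip (M a b : R) : `|truncation M a - truncation M b| <= `|a - b|.
Proof.
have m1 (x y : R) : `|Num.max (- M) x - Num.max (- M) y| <= `|x - y|.
  rewrite ler_norml; have := ler_norm (x - y); have := ler_norm (- (x - y)); rewrite normrN.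
  by case: (leP (- M) x) => ?; case: (leP (- M) y) => ? ? ?; apply/andP; split; lra.
have m2 (x y : R) : `|Num.min x M - Num.min y M| <= `|x - y|.
  rewrite ler_norml; have := ler_norm (x - y); have := ler_norm (- (x - y)); rewrite normrN.
  by case: (leP x M) => ?; case: (leP y M) => ? ? ?; apply/andP; split; lra.
exact: le_trans (m1 _ _) (m2 _ _).
Qed.

(** Lifts the level 1/2 to the value 1, so that [1 - cut (f x)] vanishes where [f > 1/2] and is 1
    where [f] vanishes; the price is the Lipschitz constant 2. *)
Definition cut (a : R) : R := Num.min 1 (2 * a).

Lemma cut_lip (a b : R) : `|cut a - cut b| <= 2 * `|a - b|.
Proof.
rewrite -[X in X * _](ger0_norm (_ : 0 <= 2))// -normrM mulrBr /cut.
set x := 2 * a; set y := 2 * b.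
rewrite ler_norml; have := ler_norm (x - y); have := ler_norm (- (x - y)); rewrite normrN.
by case: (leP 1 x) => ?; case: (leP 1 y) => ? ? ?; apply/andP; split; lra.
Qed.

Lemma cut01 (a : R) : 0 <= a -> 0 <= cut a <= 1.
Proof.
by move=> a0; rewrite /cut ge_min lexx/= le_min ler01 mulr_ge0.
Qed.

Lemma cut1 (a : R) : 2^-1 < a -> cut a = 1.
Proof.
move=> a2; rewrite /cut; apply/min_idPl.
have : (2 : R) * 2^-1 = 1 by rewrite divff.
by lra.
Qed.

Definition cutoff (M : R) (p f : X -> R) (x : X) : R :=
  truncation M (p x) * (1 - cut (f x)).

Lemma uniformly_locally_lipschitz_continuous (f : X -> R) :
  uniformly_locally_lipschitz f -> continuous f.
Proof.
move=> [L [r [L0 r0 Lf]]] x; apply/cvg_ballP => e e0.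
near=> y; rewrite /ball/=.
have : ball x (Num.min r (e / (L + 1))) y.
  near: y; apply: nbhsx_ballx.
  by rewrite lt_min r0 divr_gt0// ltr_wpDl.
rewrite ballEmdist/= lt_min => /andP[xyr xye].
apply: (le_lt_trans (Lf _ _ (ltW xyr))).
have L1 : 0 < L + 1 by rewrite ltr_wpDl.
rewrite ltr_pdivlMr// in xye; apply: le_lt_trans xye.
by rewrite mulrC ler_wpM2l ?mdist_ge0// lerDl.
Unshelve. all: by end_near. Qed.

Lemma uniformly_locally_lipschitz_borel (f : X -> R) :
  uniformly_locally_lipschitz f -> borel_fun (EFin \o f).
Proof.
move=> /uniformly_locally_lipschitz_continuous/continuousP cf.
apply/measurable_EFinP; apply: (measurability _ (RGenOpens.measurableE R)).
move=> _ [_ [a [b ->] <-]]; rewrite setTI; apply: open_borel.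
by apply: cf; exact: interval_open.
Qed.

Lemma uniformly_locally_lipschitz_cut (f : X -> R) :
  uniformly_locally_lipschitz f ->
  uniformly_locally_lipschitz (fun x => 1 - cut (f x)).
Proof.
move=> [L [r [L0 r0 Lf]]]; exists (2 * L), r; split => //; first by rewrite mulr_ge0.
move=> x y /Lf fxy; rewrite opprD addrACA subrr add0r opprK addrC distrC.
rewrite distrC -normrN opprB; apply: (le_trans (cut_lip _ _)).
by rewrite -mulrA ler_wpM2l// distrC.
Qed.

Lemma lip_loc_cutoff (O : set X) (M : R) (p f : X -> R) : 0 <= M ->
  lip_loc O p -> uniformly_locally_lipschitz f ->
  (forall x, 0 <= f x) -> lip_loc O (cutoff M p f).
Proof.
move=> M0 lp [L [r [L0 r0 Lf]]] f0 x Ox.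
have [s s0 [K Kp]] := lp x Ox.
have sr0 : 0 < Num.min s (r / 2) by rewrite lt_min s0 divr_gt0.
exists (Num.min s (r / 2)) => //.
exists (`|K| + M * (2 * L)) => y z [Oy xy] [Oz xz].
move: xy xz; rewrite !ballEmdist/= !lt_min => /andP[xys xyr] /andP[xzs xzr].
have yz : mdist y z <= r.
  have := metric_triangle y x z; rewrite (metric_sym y x).
  by have := splitr r; lra.
have Py : `|p y - p z| <= `|K| * mdist y z.
  apply: (le_trans (Kp y z _ _)); try by split; rewrite ?ballEmdist.
  by rewrite ler_wpM2r ?mdist_ge0// ler_norm.
have Fy := Lf _ _ yz.
rewrite /cutoff.
have -> : truncation M (p y) * (1 - cut (f y)) - truncation M (p z) * (1 - cut (f z)) =
  (truncation M (p y) - truncation M (p z)) * (1 - cut (f y)) +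
  truncation M (p z) * (cut (f z) - cut (f y)) by ring.
apply: (le_trans (ler_normD _ _)); rewrite [leRHS]mulrDl lerD//.
  have /andP[c0 c1] := cut01 (f0 y).
  rewrite normrM (ger0_norm (_ : 0 <= 1 - cut (f y))); last by lra.
  apply: (@le_trans _ _ (`|p y - p z| * 1)); last by rewrite mulr1.
  by apply: ler_pM => //; [lra|exact: truncation_lip|lra].
rewrite normrM -mulrA; apply: ler_pM => //; first exact: truncation_bound.
apply: (le_trans (cut_lip _ _)); rewrite distrC -mulrA ler_wpM2l//.
Qed.

Local Open Scope ereal_scope.

(* On short pieces [cut (f (c r))] is almost constant, so that the product rule
   holds up to a small multiple of the integral of [g]. *)
Lemma upper_along_cutoff (M : R) (p f : X -> R) (g h : X -> \bar R) (c : curve X) :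
  (0 <= M)%R -> borel_fun g -> borel_fun h ->
  (forall x, 0 <= g x) -> (forall x, 0 <= h x) ->
  uniformly_locally_lipschitz f -> (forall x, (0 <= f x)%R) ->
  curve_integral c g < +oo -> upper_along p g c -> upper_along f h c ->
  upper_along (cutoff M p f)
    (fun x => (1 - cut (f x))%:E * g x + (2 * M)%:E * h x) c.
Proof.
move=> M0 bg bh g0 h0 lf f0 ig up uf s t s0 st tL.
have [L [r [L0 r0 Lf]]] := lf.
have cu x : (0 <= 1 - cut (f x) <= 1)%R.
  by have /andP[? ?] := cut01 (f0 x); apply/andP; split; lra.
have cu0 x : (0 <= 1 - cut (f x))%R by have /andP[] := cu x.
have bcut := uniformly_locally_lipschitz_borel (uniformly_locally_lipschitz_cut lf).
pose k x := (1 - cut (f x))%:E * g x + (2 * M)%:E * h x.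
have k1 x : 0 <= (1 - cut (f x))%:E * g x by rewrite mule_ge0// lee_fin.
have k2 x : 0 <= (2 * M)%:E * h x by rewrite mule_ge0// lee_fin mulr_ge0.
have k0 x : 0 <= k x by rewrite adde_ge0.
have bk : borel_fun k.
  apply: emeasurable_funD; first exact: emeasurable_funM.
  exact: measurable_funeM.
have mst : @measurable _ (measurableTypeR R) [set` `[s, t]].
  exact: measurable_itv.
set J := \int[leb]_(r in `[s, t]) g (c r).
have J0 : 0 <= J by apply: integral_ge0.
have Jfin : J \is a fin_num.
  by rewrite ge0_fin_numE//; apply: le_lt_trans ig; exact: integral_subcurve_le.
apply/lee_addgt0Pr => e e0.
(* An error [d] in the coefficient of [g] costs [d * J], which is at most [e]; adding 1 avoids a
   zero denominator. *)
pose d := (e / (fine J + 1))%R.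
have fJ : (0 < fine J + 1)%R by rewrite ltr_wpDl// fine_ge0.
have d0 : (0 < d)%R by rewrite divr_gt0.
have mg : measurable_fun `[s, t] (fun r => g (c r)) by exact: measurable_subcurve.
have mk : measurable_fun `[s, t] (fun r => k (c r)) by exact: measurable_subcurve.
apply: (@le_trans _ _ (\int[leb]_(r in `[s, t]) (k (c r) + d%:E * g (c r)))); last first.
  rewrite ge0_integralD//; last 2 first.
  - by move=> x _; rewrite mule_ge0// lee_fin ltW.
  - exact: measurable_funeM.
  rewrite ge0_integralZl_EFin//; last exact: ltW.
  rewrite leeD2l// -/J -(fineK Jfin) -EFinM lee_fin /d mulrAC ler_pdivrMr//.
  by rewrite ler_wpM2l ?lerDl// ltW.
(* On pieces of this length [f] is [L]-Lipschitz along the curve and [cut] of it varies by at most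
   [d]. *)
pose rho : R := Num.min r (d / (2 * L + 1))%R.
have L1 : (0 < 2 * L + 1)%R by rewrite ltr_wpDl// mulr_ge0.
have rho0 : (0 < rho)%R by rewrite lt_min r0 divr_gt0.
apply: (@local_le_integral R (fun x => cutoff M p f (c x)) _ s t rho) => //.
- by apply: emeasurable_funD => //; exact: measurable_funeM.
- by move=> x _; rewrite adde_ge0// mule_ge0// lee_fin ltW.
move=> a b sa ab bt; rewrite le_min => /andP[abr abd].
have a0 := le_trans s0 sa; have bL := le_trans bt tL.
have mab : @measurable _ (measurableTypeR R) [set` `[a, b]].
  exact: measurable_itv.
have mgab : measurable_fun `[a, b] (fun r => g (c r)) by exact: measurable_subcurve.
have mhab : measurable_fun `[a, b] (fun r => h (c r)) by exact: measurable_subcurve.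
have := up a b a0 ab bL; have := uf a b a0 ab bL.
set Ig := \int[leb]_(x in `[a, b]) g (c x).
set Ih := \int[leb]_(x in `[a, b]) h (c x) => fab pab.
apply: (@le_trans _ _ ((1 - cut (f (c a)))%:E * Ig + (2 * M)%:E * Ih)).
  apply: (@le_trans _ _ ((1 - cut (f (c a))) * `|p (c b) - p (c a)| +
      (2 * M) * `|f (c b) - f (c a)|)%:E).
    rewrite lee_fin /cutoff.
    have -> : (truncation M (p (c b)) * (1 - cut (f (c b))) -
        truncation M (p (c a)) * (1 - cut (f (c a))) =
      (1 - cut (f (c a))) * (truncation M (p (c b)) - truncation M (p (c a))) +
      truncation M (p (c b)) * (cut (f (c a)) - cut (f (c b))))%R by ring.
    apply: (le_trans (ler_normD _ _)); rewrite !normrM ger0_norm// lerD//.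
      by rewrite ler_wpM2l// truncation_lip.
    rewrite (mulrC 2%R) -mulrA; apply: ler_pM => //; first exact: truncation_bound.
    by rewrite distrC; exact: cut_lip.
  rewrite EFinD !EFinM; apply: leeD; apply: lee_wpmul2l => //.
  - by rewrite lee_fin.
  - by rewrite lee_fin mulr_ge0.
rewrite -ge0_integralZl_EFin// -ge0_integralZl_EFin//; last by rewrite mulr_ge0.
rewrite -ge0_integralD//; last 2 first.
- by apply: measurable_funeM.
- by apply: measurable_funeM.
- apply: ge0_le_lower_integral => x xab.
    by rewrite adde_ge0// mule_ge0// lee_fin.
  rewrite /k addeAC leeD2r// -ge0_muleDl ?lee_fin//; last exact: ltW.
  apply: lee_wpmul2r => //; rewrite -EFinD lee_fin.
  move: xab; rewrite /= in_itv/= => /andP[ax xb].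
  have cd : (mdist (c a) (c x) <= x - a)%R by apply: curve_lipschitz => //; exact: le_trans bL.
  have cdr : (mdist (c a) (c x) <= r)%R by lra.
  have := cut_lip (f (c a)) (f (c x)); have := Lf _ _ cdr.
  have := ler_norm (cut (f (c x)) - cut (f (c a))); rewrite distrC => h1 h2 h3.
  have : (2 * (L * mdist (c a) (c x)) <= d)%R.
    apply: (@le_trans _ _ ((2 * L + 1) * (b - a))%R).
      rewrite mulrA; apply: ler_pM; rewrite ?mdist_ge0 ?mulr_ge0//; lra.
    by rewrite mulrC -ler_pdivlMr.
  lra.
- by move=> x _; rewrite mule_ge0// lee_fin.
Qed.

End cutoff_product.

Section cutoff_gradient.
Context {R : realType} {X : completeMetricType R}.
Variable mu : {outer_measure set X -> \bar R}.
Hypothesis mu_regular : borel_regular mu.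
Hypothesis mu_doubling : doubling mu.

Notation cara := (mu.-caratheodory).
Notation mmu := (cmeas mu).
Notation mfun A f := (@measurable_fun _ _ (caratheodory_type mu) _ A f).
Local Open Scope ereal_scope.

(** The coefficient of the gradient of [p] is 0 where [f > 1/2] and at most 1 elsewhere. The factor
    [2 * M] is the height of the truncation times the Lipschitz constant of [cut]. *)
Lemma cutoff_weak_upper_gradient (O : set X) (M : R) (p f : X -> R)
    (g h : X -> \bar R) : open O -> (0 <= M)%R ->
  weak_upper_gradient mu O (EFin \o p) g -> \int[mmu]_(x in O) g x < +oo ->
  borel_fun h -> (forall x, 0 <= h x) -> (forall c, upper_along f h c) ->
  uniformly_locally_lipschitz f -> (forall x, (0 <= f x)%R) ->
  exists k, weak_upper_gradient mu O (EFin \o cutoff M p f) k /\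
    \int[mmu]_(x in O) k x <=
    \int[mmu]_(x in O `\` [set x | (2^-1 < f x)%R]) g x +
    (2 * M)%:E * \int[mmu]_x h x.
Proof.
move=> oO M0 wg ig bh h0 uf lf f0.
have cO := open_cara mu_regular oO.
have [mg gge0 _] := wg.
have [g' [bg' g'0 _ gg' g'g]] := borel_majorant mu_regular mu_doubling oO mg gge0.
have ig' : \int[mmu]_(x in O) g' x < +oo.
  have -> // : \int[mmu]_(x in O) g' x = \int[mmu]_(x in O) g x.
  by apply: ge0_ae_eq_integral => //; exact: borel_mfun.
have [G eG GP] := wug_along wg bg' g'0 gg'.
have cf := uniformly_locally_lipschitz_continuous lf.
have cu x : (0 <= 1 - cut (f x) <= 1)%R.
  by have /andP[? ?] := cut01 (f0 x); apply/andP; split; lra.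
have cu0 x : (0 <= 1 - cut (f x))%R by have /andP[] := cu x.
have bcut := uniformly_locally_lipschitz_borel (uniformly_locally_lipschitz_cut lf).
pose k x := (1 - cut (f x))%:E * g' x + (2 * M)%:E * h x.
have k1 x : 0 <= (1 - cut (f x))%:E * g' x by rewrite mule_ge0// lee_fin.
have k2 x : 0 <= (2 * M)%:E * h x by rewrite mule_ge0// lee_fin mulr_ge0.
have b1 : borel_fun (fun x => (1 - cut (f x))%:E * g' x) by exact: emeasurable_funM.
have b2 : borel_fun (fun x => (2 * M)%:E * h x) by exact: measurable_funeM.
exists k; split.
  apply: (@along_wug _ _ _ mu_regular O _ k
      (G `|` [set c | curve_in O c /\ curve_integral c g' = +oo])) => //.
  - exact: emeasurable_funD.
  - by move=> x; rewrite adde_ge0.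
  - by apply: exceptionalU => //; exact: exceptional_curve_in.
  - move=> c cO' /not_orP[nG nc]; apply: upper_along_cutoff => //; last exact: GP.
    by rewrite ltey; apply/eqP => ci; apply: nc.
pose V := [set x | (2^-1 < f x)%R].
have oV : open V.
  have -> : V = f @^-1` [set y | (2^-1 < y)%R] by [].
  by apply: open_comp; [move=> x _; exact: cf|exact: open_gt].
have cV := open_cara mu_regular oV.
have cOV : cara (O `\` V) by exact: caratheodory_measurable_setD.
rewrite ge0_integralD//; [|exact: borel_mfun|exact: borel_mfun].
apply: leeD; last first.
  rewrite ge0_integralZl_EFin//; [|exact: borel_mfun|by rewrite mulr_ge0].
  apply: lee_wpmul2l; first by rewrite lee_fin mulr_ge0.
  by apply: ge0_subset_integral => //; apply: borel_mfun => //; exact: caraT.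
have -> : \int[mmu]_(x in O `\` V) g x = \int[mmu]_(x in O `\` V) g' x.
  apply: ge0_ae_eq_integral => //.
  - by apply: measurable_funS mg => //; exact: subDsetl.
  - exact: borel_mfun.
  - by move=> x [/gge0].
  - case: g'g => N [mN N0 NP]; exists N; split => // x /= H; apply: NP => /= H2.
    by apply: H => -[Ox _]; rewrite H2.
rewrite -(setIidr (@subDsetl _ O V)) integral_mkcondr.
apply: ge0_le_lower_integral => // x Ox; rewrite patchE.
have [xOV|xOV] := boolP (x \in O `\` V).
  by rewrite -[leRHS]mul1e; apply: lee_wpmul2r => //; rewrite lee_fin; have /andP[] := cu x.
have Vx : V x.
  by apply: contrapT => nV; move/negP : xOV; apply; rewrite inE.
by rewrite cut1// subrr mul0e.
Qed.

End cutoff_gradient.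

(** * Lower semicontinuous majorants *)

Section lsc_majorant.
Context {R : realType} {X : completeMetricType R}.
Variable mu : {outer_measure set X -> \bar R}.
Hypothesis mu_regular : borel_regular mu.
Hypothesis mu_doubling : doubling mu.

Notation cara := (mu.-caratheodory).
Notation mmu := (cmeas mu).
Notation mfun A f := (@measurable_fun _ _ (caratheodory_type mu) _ A f).
Local Open Scope ereal_scope.

(** Lower semicontinuous when the sets are open. The weights are fixed in advance; they tend to 0
    with divergent sum, so that every value in [[0, +oo]] is a sum of some of them. *)
Definition open_sum (U : nat -> set X) (x : X) : \bar R :=
  \sum_(i <oo) (i.+1%:R^-1 * \1_(U i) x)%:E.

Lemma open_sum_ge0 U x : 0 <= open_sum U x.
Proof. by apply: nneseries_ge0 => n _ _; rewrite lee_fin mulr_ge0. Qed.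

Section greedy.
Variable g : X -> \bar R.
Hypothesis g0 : forall x, 0 <= g x.

(** Greedy expansion of [g x] in the harmonic weights: a weight is taken whenever the sum stays at
    most [g x]. *)
Fixpoint greedy (i : nat) (x : X) : R :=
  if i is j.+1 then
    (greedy j x + if `[< ((greedy j x + j.+1%:R^-1)%:E <= g x)%E >]
                  then j.+1%:R^-1 else 0)%R
  else 0%R.

Definition greedy_set i := [set x | (greedy i x + i.+1%:R^-1)%:E <= g x].

Lemma greedyS i x :
  (greedy i.+1 x = greedy i x + i.+1%:R^-1 * \1_(greedy_set i) x)%R.
Proof.
rewrite /= indicE; case: asboolP => h.
  by rewrite mem_set// mulr1.
by rewrite memNset// mulr0.
Qed.

Lemma greedy_le i x : (greedy i x)%:E <= g x.
Proof. by elim: i => [//|i IH] /=; case: asboolP => //; rewrite addr0. Qed.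

Lemma greedy_sum i x :
  \sum_(0 <= j < i) (j.+1%:R^-1 * \1_(greedy_set j) x)%:E = (greedy i x)%:E.
Proof.
elim: i => [|i IH]; first by rewrite big_geq.
by rewrite greedyS EFinD -IH big_nat_recr.
Qed.

Lemma open_sum_greedy_le x : open_sum greedy_set x <= g x.
Proof.
apply: lime_le.
  by apply: is_cvg_nneseries => n _ _; rewrite lee_fin mulr_ge0.
by apply: nearW => n; rewrite greedy_sum; exact: greedy_le.
Qed.

(* Otherwise all but finitely many of the sets contain [x], and the harmonic
   series would converge. *)
Lemma open_sum_greedy_ge x : g x <= open_sum greedy_set x.
Proof.
rewrite leNgt; apply/negP => lt.
have [T TE] : exists T, open_sum greedy_set x = T%:E.
  exists (fine (open_sum greedy_set x)); rewrite fineK//.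
  by rewrite ge0_fin_numE ?open_sum_ge0// (lt_le_trans lt (leey _)).
have ST i : (greedy i x <= T)%R.
  rewrite -lee_fin -TE -greedy_sum; apply: nneseries_lim_ge => n _ _.
  by rewrite lee_fin mulr_ge0.
have [e e0 eg] : exists2 e, (0 < e)%R & (T + e)%:E <= g x.
  case: (g x) lt => [s| |]; rewrite TE.
  - rewrite lte_fin => Ts; exists (s - T)%R; first by rewrite subr_gt0.
    by rewrite addrC subrK.
  - by move=> _; exists 1%R => //; rewrite leey.
  - by [].
pose N := Num.truncn e^-1.
have gin i : (N <= i)%N -> greedy_set i x.
  move=> Ni; rewrite /greedy_set/=; apply: le_trans eg; rewrite lee_fin lerD//.
  rewrite -[leRHS]invrK lef_pV2 ?posrE ?invr_gt0//.
  by rewrite (le_trans (ltW (truncnS_gt _)))// ler_nat ltnS.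
have harm k : (series harmonic (N + k)%N <= series harmonic N + T)%R.
  have : (series harmonic (N + k)%N - series harmonic N <= greedy (N + k) x)%R.
    elim: k => [|k IH].
      rewrite addn0 subrr -lee_fin -greedy_sum; apply: sume_ge0 => i _.
      by rewrite lee_fin mulr_ge0.
    rewrite addnS greedyS indicE mem_set; last by apply: gin; exact: leq_addr.
    rewrite mulr1.
    by rewrite seriesS -addrA [leRHS]addrC lerD2l.
  by have := ST (N + k)%N; lra.
apply: (@dvg_harmonic R); apply: nondecreasing_is_cvgn.
  apply/nondecreasing_seqP => n; rewrite seriesS lerDr /harmonic/=.
  by rewrite invr_ge0.
exists (series harmonic N + T)%R => _ [n _ <-].
have [Nn|/ltnW nN] := leqP N n; first by rewrite -(subnKC Nn).
apply: (le_trans _ (harm 0%N)); rewrite addn0.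
rewrite -(subnKC nN); elim: (N - n)%N => [|k IH]; first by rewrite addn0.
by rewrite addnS seriesS (le_trans IH)// lerDr /harmonic/= invr_ge0.
Qed.

Lemma greedy_measurable : mfun setT g -> forall i, cara (greedy_set i).
Proof.
move=> mg.
have E i : mfun setT (greedy i) -> cara (greedy_set i).
  move=> m; rewrite -[greedy_set i]setTI.
  apply: (@measurable_lee _ (caratheodory_type mu)) => //.
  by apply/measurable_EFinP; apply: measurable_funD.
have H i : mfun setT (greedy i).
  elim: i => [|i IH]; first exact: measurable_cst.
  rewrite (_ : greedy i.+1 =
      fun x => (greedy i x + i.+1%:R^-1 * \1_(greedy_set i) x)%R).
    apply: measurable_funD => //; apply: measurable_funM => //.
    exact: (@measurable_indic _ (caratheodory_type mu) R setT _ (E i IH)).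
  by apply/funext => x; exact: greedyS.
by move=> i; exact: E.
Qed.

End greedy.

Lemma integral_open_sum (U : nat -> set X) : (forall i, cara (U i)) ->
  \int[mmu]_x open_sum U x = \sum_(i <oo) (i.+1%:R^-1)%:E * mu (U i).
Proof.
move=> cU.
have mi i : mfun setT (fun x => (\1_(U i) x : R)%:E).
  by apply/measurable_EFinP; exact: (@measurable_indic _ (caratheodory_type mu) R setT (U i) (cU i)).
have c0 (i : nat) : (0 <= i.+1%:R^-1 :> R)%R by rewrite invr_ge0.
rewrite integral_nneseries//.
- apply: eq_eseriesr => i _.
  under eq_integral do rewrite EFinM.
  rewrite ge0_integralZl_EFin//.
  have := @integral_indic _ (caratheodory_type mu) R mmu setT measurableT (U i) (cU i).
  by rewrite setIT => ->.
- move=> n; under eq_fun do rewrite EFinM.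
  exact: measurable_funeM.
Qed.

(** The Vitali-Caratheodory theorem: [g] equals the sum over its greedy sets, and these are enlarged
    to open sets with excess measure [e / 2 ^ (i + 1)]; the weights, at most 1, do not increase the
    errors. *)
Lemma lsc_majorant (g : X -> \bar R) (e : R) : (0 < e)%R -> mfun setT g ->
  (forall x, 0 <= g x) ->
  exists U : nat -> set X, [/\ forall i, open (U i),
    forall x, g x <= open_sum U x &
    \int[mmu]_x open_sum U x <= \int[mmu]_x g x + e%:E].
Proof.
move=> e0 mg g0; have cE := greedy_measurable mg.
have /choice[U UP] : forall i : nat, exists U, [/\ open U, greedy_set g i `<=` U &
    mu U <= mu (greedy_set g i) + (e / (2 ^ i.+1)%:R)%:E].
  move=> i; apply: (outer_regular mu_regular mu_doubling).
  by rewrite divr_gt0// ltr0n expn_gt0.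
exists U; split.
- by move=> i; have [] := UP i.
- move=> x; apply: (le_trans (open_sum_greedy_ge g x)).
  apply: lee_nneseries => [i _ _|i _]; first by rewrite lee_fin mulr_ge0.
  rewrite lee_fin ler_wpM2l ?invr_ge0// !indicE ler_nat.
  have [/[!inE] xE|//] := boolP (x \in greedy_set g i).
  by rewrite mem_set//; have [_ + _] := UP i; exact.
- rewrite integral_open_sum; last first.
    by move=> i; apply: open_cara => //; have [] := UP i.
  apply: (@le_trans _ _ (\sum_(i <oo) ((i.+1%:R^-1)%:E * mu (greedy_set g i) +
      (e / (2 ^ i.+1)%:R)%:E))).
    apply: lee_nneseries => [i _ _|i _].
      by rewrite mule_ge0// ?outer_measure_ge0// lee_fin invr_ge0.
    have [_ _ Ui] := UP i.
    have i0 : (0 <= i.+1%:R^-1 :> R)%R by rewrite invr_ge0.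
    apply: (@le_trans _ _ ((i.+1%:R^-1)%:E * (mu (greedy_set g i) +
        (e / (2 ^ i.+1)%:R)%:E))); first exact: lee_wpmul2l.
    have ei0 : (0 <= e / (2 ^ i.+1)%:R)%R by rewrite divr_ge0// ltW.
    rewrite ge0_muleDr ?outer_measure_ge0//.
    rewrite leeD2l// -EFinM lee_fin ler_piMl// invf_le1//.
    by rewrite ler1n.
  apply: (le_trans (epsilon_trick _ _ (ltW e0))).
    by move=> i; rewrite mule_ge0// ?outer_measure_ge0// lee_fin invr_ge0.
  rewrite leeD2r// -integral_open_sum//.
  apply: ge0_le_lower_integral => x _; first exact: open_sum_ge0.
  exact: open_sum_greedy_le.
Qed.

End lsc_majorant.

(** * Ramps, ultralimits and chain functions *)

Section ramp.
Context {R : realType} {X : completeMetricType R}.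
Implicit Types U : set X.

(* [min 1 (n * dist (x, ~` U))]; it increases to the indicator of an open [U]. *)
Definition ramp (n : nat) (U : set X) (x : X) : R :=
  inf ([set 1] `|` [set n%:R * mdist x y | y in ~` U]).

Let ramp_lb n U x : lbound ([set 1] `|` [set n%:R * mdist x y | y in ~` U]) 0.
Proof. by move=> _ [->//|[y _ <-]]; rewrite mulr_ge0// mdist_ge0. Qed.

Let ramp_has n U x : has_inf ([set 1] `|` [set n%:R * mdist x y | y in ~` U]).
Proof. by split; [exists 1; left|exists 0; exact: ramp_lb]. Qed.

Lemma ramp_ge n U x a : a <= 1 ->
  (forall y, ~ U y -> a <= n%:R * mdist x y) -> a <= ramp n U x.
Proof.
move=> a1 ay; apply: lb_le_inf; first by exists 1; left.
by move=> _ [->//|[y nUy <-]]; exact: ay.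
Qed.

Lemma ramp_ge0 n U x : 0 <= ramp n U x.
Proof. by apply: ramp_ge => // y _; rewrite mulr_ge0// mdist_ge0. Qed.

Lemma ramp_le1 n U x : ramp n U x <= 1.
Proof. by apply: ge_inf; [case: (ramp_has n U x)|left]. Qed.

Lemma ramp_le n U x y : ~ U y -> ramp n U x <= n%:R * mdist x y.
Proof.
by move=> nUy; apply: ge_inf; [case: (ramp_has n U x)|right; exists y].
Qed.

Lemma ramp_out n U x : ~ U x -> ramp n U x = 0.
Proof.
move=> nUx; apply/eqP; rewrite eq_le ramp_ge0 andbT.
by have := ramp_le n x nUx; rewrite mdistxx mulr0.
Qed.

Lemma ramp_mono m n U x : (m <= n)%N -> ramp m U x <= ramp n U x.
Proof.
move=> mn; apply: ramp_ge => [|y nUy]; first exact: ramp_le1.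
by rewrite (le_trans (ramp_le _ _ nUy))// ler_wpM2r ?mdist_ge0// ler_nat.
Qed.

Lemma ramp_lip n U x y : `|ramp n U x - ramp n U y| <= n%:R * mdist x y.
Proof.
have one a b : ramp n U a - ramp n U b <= n%:R * mdist a b.
  rewrite lerBlDr -lerBlDl; apply: ramp_ge.
    by rewrite lerBlDr (le_trans (ramp_le1 _ _ _))// lerDl mulr_ge0// mdist_ge0.
  move=> z nUz; rewrite lerBlDr (le_trans (ramp_le _ _ nUz))//.
  by rewrite -mulrDr ler_wpM2l// addrC metric_triangle.
have := one x y; have := one y x; rewrite (metric_sym y x) => h1 h2.
by rewrite ler_norml; apply/andP; split; lra.
Qed.

Lemma ramp_in U x : open U -> U x -> exists N, forall n, (N <= n)%N -> ramp n U x = 1.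
Proof.
move=> oU Ux; have [r r0 rU] := open_ball_subP oU Ux.
exists (Num.truncn r^-1).+1 => n Nn; apply/eqP; rewrite eq_le ramp_le1/=.
apply: ramp_ge => // y nUy.
have ry : r <= mdist x y.
  by rewrite leNgt; apply/negP => xy; apply: nUy; apply: rU; rewrite ballEmdist.
have rn : r^-1 <= n%:R.
  by rewrite (le_trans (ltW (truncnS_gt _)))// ler_nat.
rewrite -[leLHS](mulVf (lt0r_neq0 r0)); apply: ler_pM => //; first by rewrite invr_ge0 ltW.
exact: ltW.
Qed.

Lemma ramp_lt1 n U x : ramp n U x < 1 -> exists2 y, ~ U y & n%:R * mdist x y < 1.
Proof.
move=> r1; have e0 : 0 < 1 - ramp n U x by rewrite subr_gt0.
have [_ [->|[y nUy <-]]] := inf_adherent e0 (ramp_has n U x).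
  by rewrite -/(ramp n U x) addrC subrK ltxx.
by rewrite -/(ramp n U x) addrC subrK => ?; exists y.
Qed.

End ramp.

Section ultralimit.

Lemma ultra_compact_lim (T : Type) (Y : topologicalType) (F : set_system T)
    (f : T -> Y) (A : set Y) : UltraFilter F -> compact A -> F (f @^-1` A) ->
  exists2 p, A p & f @ F --> p.
Proof.
move=> FU cA FA; have FP : ProperFilter F by exact: ultra_proper.
have [p [Ap clp]] := cA (f @ F) _ FA; exists p => // B Bp.
have [//|nB] := in_ultra_setVsetC (f @^-1` B) FU.
by have [y [nBy By]] := clp (~` B) B nB Bp.
Qed.

End ultralimit.

Lemma integral_itv_cst (R : realType) (a b K : R) : a <= b ->
  (\int[@lebesgue_measure R]_(r in `[a, b]) K%:E = (K * (b - a))%:E)%E.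
Proof.
move=> ab; rewrite integral_cst; last exact: measurable_itv.
move: ab; rewrite le_eqVlt => /predU1P[->|ab] /=.
  by rewrite lebesgue_measure_itv/= ltxx mule0 subrr mulr0.
by rewrite lebesgue_measure_itv/= lte_fin ab EFinM.
Qed.

Section chains.
Context {R : realType} {X : completeMetricType R}.
Variables (U : set X) (h : nat -> X -> R).
Variables (La B : nat -> R).
Hypothesis oU : open U.
Hypothesis h0 : forall n x, 0 <= h n x.
Hypothesis h_mono : forall m n x, (m <= n)%N -> h m x <= h n x.
Hypothesis h_lip : forall n x y, `|h n x - h n y| <= La n * mdist x y.
Hypothesis La0 : forall n, 0 <= La n.
Hypothesis hB : forall n x, h n x <= B n.
Hypothesis h_ramp : forall n x, ramp n U x <= h n x.

(** A step starts where the ramp is 1, hence where [h n >= 1]: the cost of a chain then bounds its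
    length. *)
Definition chain_step n (a b : X) : bool :=
  `[< ramp n U a = 1 >] && (mdist a b <= n.+1%:R^-1).

Fixpoint chain_cost n (x : X) (l : seq X) : R :=
  if l is y :: l' then h n x * mdist x y + chain_cost n y l' else 0.

Definition chain n x l := path (chain_step n) x l /\ ramp n U (last x l) < 1.

(* The largest function vanishing where [ramp n U] is less than [1], bounded by
   [1], whose increments over distances at most [1 / (n + 1)] are controlled by
   [h n]. *)
Definition chain_fun n (x : X) : R :=
  inf ([set 1] `|` [set chain_cost n x l | l in chain n x]).

Lemma chain_cost_ge0 n x l : 0 <= chain_cost n x l.
Proof. by elim: l x => //= y l IH x; rewrite addr_ge0// mulr_ge0// mdist_ge0. Qed.

Let chain_has n x : has_inf ([set 1] `|` [set chain_cost n x l | l in chain n x]).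
Proof.
split; first by exists 1; left.
by exists 0 => _ [->//|[l _ <-]]; exact: chain_cost_ge0.
Qed.

Lemma chain_fun_ge n x a : a <= 1 ->
  (forall l, chain n x l -> a <= chain_cost n x l) -> a <= chain_fun n x.
Proof.
move=> a1 al; apply: lb_le_inf; first by exists 1; left.
by move=> _ [->//|[l cl <-]]; exact: al.
Qed.

Lemma chain_fun_le n x l : chain n x l -> chain_fun n x <= chain_cost n x l.
Proof. by move=> cl; apply: ge_inf; [case: (chain_has n x)|right; exists l]. Qed.

Lemma chain_fun_le1 n x : chain_fun n x <= 1.
Proof. by apply: ge_inf; [case: (chain_has n x)|left]. Qed.

Lemma chain_fun_ge0 n x : 0 <= chain_fun n x.
Proof. by apply: chain_fun_ge => // l _; exact: chain_cost_ge0. Qed.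

Lemma chain_fun_ramp n x : ramp n U x < 1 -> chain_fun n x = 0.
Proof.
move=> rx; apply/eqP; rewrite eq_le chain_fun_ge0 andbT.
by have := @chain_fun_le n x [::]; apply; split.
Qed.

Lemma chain_fun_out n x : ~ U x -> chain_fun n x = 0.
Proof. by move=> nUx; apply: chain_fun_ramp; rewrite ramp_out. Qed.

(** Prepend [x] to a chain from [y]; where no step may start, the left-hand side is already 0. *)
Lemma chain_fun_step n x y : mdist x y <= n.+1%:R^-1 ->
  chain_fun n x <= chain_fun n y + h n x * mdist x y.
Proof.
move=> xy; have p0 : 0 <= h n x * mdist x y by rewrite mulr_ge0// mdist_ge0.
have [rx|rx] := ltP (ramp n U x) 1.
  by rewrite chain_fun_ramp// addr_ge0// chain_fun_ge0.
have {}rx : ramp n U x = 1 by apply/eqP; rewrite eq_le ramp_le1.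
rewrite -lerBlDr; apply: chain_fun_ge.
  by rewrite lerBlDr (le_trans (chain_fun_le1 _ _))// lerDl.
move=> l [pl rl]; rewrite lerBlDr addrC.
apply: (@chain_fun_le n x (y :: l)); split => //=.
by rewrite pl andbT /chain_step xy andbT; apply/asboolP.
Qed.

(** A chain of level [n], stopped at its first point where [ramp m U] is below 1, is a chain of
    level [m], and [h m <= h n] makes it cheaper. *)
Lemma chain_fun_mono m n x : (m <= n)%N -> chain_fun m x <= chain_fun n x.
Proof.
move=> mn; apply: chain_fun_ge => [|l]; first exact: chain_fun_le1.
elim: l x => [|y l IH] x [/= pl rl].
  rewrite chain_fun_ramp//; apply: le_lt_trans rl; exact: ramp_mono.
move: pl => /andP[/andP[_ xy] pl].
apply: (@le_trans _ _ (chain_fun m y + h m x * mdist x y)).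
  apply: chain_fun_step; apply: (le_trans xy).
  by rewrite lef_pV2 ?posrE// ler_nat ltnS.
rewrite addrC lerD//; first by rewrite ler_wpM2r ?mdist_ge0// h_mono.
exact: IH.
Qed.

Lemma chain_fun_dist n x y : mdist x y <= n.+1%:R^-1 ->
  `|chain_fun n x - chain_fun n y| <= Num.max (h n x) (h n y) * mdist x y.
Proof.
move=> xy; have := chain_fun_step xy.
have yx : mdist y x <= n.+1%:R^-1 by rewrite metric_sym.
have := chain_fun_step yx; rewrite (metric_sym y x) => h1 h2.
have d0 := mdist_ge0 x y.
have m1 : h n x * mdist x y <= Num.max (h n x) (h n y) * mdist x y.
  by rewrite ler_wpM2r// le_max lexx.
have m2 : h n y * mdist x y <= Num.max (h n x) (h n y) * mdist x y.
  by rewrite ler_wpM2r// le_max lexx orbT.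
by rewrite ler_norml; apply/andP; split; lra.
Qed.

Lemma chain_fun_lip n : uniformly_locally_lipschitz (chain_fun n).
Proof.
have B0 : 0 <= B n by exact: le_trans (h0 n point) (hB n point).
exists (B n), n.+1%:R^-1; split; [by []|by rewrite invr_gt0|].
move=> x y xy; apply: (le_trans (chain_fun_dist xy)).
by rewrite ler_wpM2r ?mdist_ge0// ge_max !hB.
Qed.

Lemma h_ull n : uniformly_locally_lipschitz (h n).
Proof.
exists `|La n|, 1; split => // x y _; apply: (le_trans (h_lip n x y)).
by rewrite ler_wpM2r ?mdist_ge0// ler_norm.
Qed.

(** On pieces so short that [h n] varies by at most [d], the increment is at most the larger end
    value of [h n] times the length, hence at most the integral of [h n + d]. *)
Lemma chain_fun_upper n c : upper_along (chain_fun n) (fun x => (h n x)%:E) c.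
Proof.
move=> s t s0 st tL.
have bh := uniformly_locally_lipschitz_borel (h_ull n).
apply/lee_addgt0Pr => e e0.
have mst : @measurable _ (measurableTypeR R) [set` `[s, t]].
  exact: measurable_itv.
pose d := e / (t - s + 1).
have ts : 0 < t - s + 1 by lra.
have d0 : 0 < d by rewrite divr_gt0.
have mh : measurable_fun `[s, t] (fun r => (h n (c r))%:E).
  exact: (@measurable_subcurve _ _ c (EFin \o h n)).
apply: (@le_trans _ _ (\int[lebesgue_measure]_(r in `[s, t]) ((h n (c r))%:E + d%:E))%E); last first.
  rewrite ge0_integralD//; last 2 first.
    by move=> x _; rewrite lee_fin.
    by move=> x _; rewrite lee_fin ltW.
  rewrite leeD2l// integral_itv_cst// lee_fin /d mulrAC ler_pdivrMr//.
  by rewrite ler_wpM2l; [lra|exact: ltW|lra].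
pose r := Num.min n.+1%:R^-1 (d / (`|La n| + 1)).
have L0 : 0 < `|La n| + 1 by rewrite ltr_wpDl.
have r0 : 0 < r by rewrite lt_min invr_gt0 ltr0n/= divr_gt0.
apply: (@local_le_integral R (fun x => chain_fun n (c x)) _ s t r) => //.
- by apply: emeasurable_funD => //; exact: measurable_cst.
- by move=> x _; rewrite -EFinD lee_fin addr_ge0// ltW.
move=> a b sa ab bt; rewrite le_min => /andP[abn abd].
have a0 := le_trans s0 sa; have bL := le_trans bt tL.
have cab : mdist (c a) (c b) <= b - a by exact: curve_lipschitz.
rewrite distrC.
apply: (@le_trans _ _ (Num.max (h n (c a)) (h n (c b)) * (b - a))%:E).
  rewrite lee_fin; apply: (le_trans (chain_fun_dist _)); first exact: le_trans abn.
  by rewrite ler_wpM2l// le_max h0.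
have mab : @measurable _ (measurableTypeR R) [set` `[a, b]].
  exact: measurable_itv.
rewrite -integral_itv_cst//.
apply: ge0_le_lower_integral => x; rewrite /= in_itv/= => /andP[ax xb].
  by rewrite lee_fin le_max h0.
have near u v : 0 <= u -> u <= v -> v <= clen c -> v - u <= b - a ->
    `|h n (c u) - h n (c v)| <= d.
  move=> u0 uv vL uvab; apply: (le_trans (h_lip _ _ _)).
  have cuv : mdist (c u) (c v) <= v - u by exact: curve_lipschitz.
  apply: (@le_trans _ _ ((`|La n| + 1) * (b - a))).
    apply: (@le_trans _ _ ((`|La n| + 1) * mdist (c u) (c v))).
      rewrite ler_wpM2r ?mdist_ge0//; have := ler_norm (La n); lra.
    by rewrite ler_wpM2l; [|exact: ltW|lra].
  by rewrite mulrC -ler_pdivlMr.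
rewrite -EFinD lee_fin ge_max.
have := near a x a0 ax (le_trans xb bL) ltac:(lra).
have := near x b (le_trans a0 ax) xb bL ltac:(lra).
by rewrite !ler_norml => /andP[? ?] /andP[? ?]; apply/andP; split; lra.
Qed.

Fixpoint chain_length (x : X) (l : seq X) : R :=
  if l is y :: l' then mdist x y + chain_length y l' else 0.

Lemma chain_length_ge0 x l : 0 <= chain_length x l.
Proof. by elim: l x => //= y l IH x; rewrite addr_ge0// mdist_ge0. Qed.

Lemma chain_length_le n x l : path (chain_step n) x l ->
  chain_length x l <= chain_cost n x l.
Proof.
elim: l x => //= y l IH x /andP[/andP[/asboolP rx _] pl].
rewrite lerD ?IH// ler_peMl ?mdist_ge0//.
by rewrite -rx h_ramp.
Qed.

(** Stay at [x] for a time equal to the distance to the next point, then jump there. A step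
    function, since the points of a chain need not be joined by short paths. *)
Fixpoint walk (x : X) (l : seq X) (t : R) : X :=
  if l is y :: l' then (if t < mdist x y then x else walk y l' (t - mdist x y))
  else x.

Lemma walk_start x l t : 0 <= t -> mdist x (walk x l t) <= t.
Proof.
elim: l x t => [|y l IH] x t t0 /=; first by rewrite mdistxx.
case: ltP => dt; first by rewrite mdistxx.
have := metric_triangle x y (walk y l (t - mdist x y)).
by have := IH y (t - mdist x y) ltac:(rewrite subr_ge0//); lra.
Qed.

(** Waiting times equal step lengths, so the walk is ahead of a 1-Lipschitz motion by at most one
    step. *)
Lemma walk_dist x l t t' s : 0 <= s ->
  path (fun a b => mdist a b <= s) x l -> 0 <= t -> t <= t' ->
  mdist (walk x l t) (walk x l t') <= t' - t + s.
Proof.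
move=> s0; elim: l x t t' => [|y l IH] x t t' /= pl t0 tt'.
  by rewrite mdistxx; lra.
move: pl => /andP[xy pl]; case: ltP => dt; case: ltP => dt'.
- by rewrite mdistxx; lra.
- have := metric_triangle x y (walk y l (t' - mdist x y)).
  by have := @walk_start y l (t' - mdist x y) ltac:(rewrite subr_ge0//); lra.
- lra.
- by have := IH y (t - mdist x y) (t' - mdist x y) pl
    ltac:(rewrite subr_ge0//) ltac:(lra); lra.
Qed.

Lemma walk_last x l t : chain_length x l <= t -> walk x l t = last x l.
Proof.
elim: l x t => [//|y l IH] x t /= lxt.
case: ltP => dt; first by exfalso; have := chain_length_ge0 y l; lra.
by apply: IH; lra.
Qed.


Hypothesis X_proper : forall (x : X) (r : R), compact [set y | mdist x y <= r].

Notation leb := (@lebesgue_measure R).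

Section curve_of_chains.
Variables (m : nat) (c : curve X).

Let J (v : R) : R := fine (\int[leb]_(r in `[0%R, v]) (h m (c r))%:E)%E.

Let mJ a b : 0 <= a -> b <= clen c ->
  measurable_fun `[a, b] (fun r => (h m (c r))%:E).
Proof.
move=> a0 bL; apply: (@measurable_subcurve _ _ c (EFin \o h m)) => //.
exact: (uniformly_locally_lipschitz_borel (h_ull m)).
Qed.

Let intle a b K : 0 <= a -> a <= b -> b <= clen c ->
  (forall r, a <= r -> r <= b -> h m (c r) <= K) ->
  (\int[leb]_(r in `[a, b]) (h m (c r))%:E <= (K * (b - a))%:E)%E.
Proof.
move=> a0 ab bL hK.
have mab : @measurable _ (measurableTypeR R) [set` `[a, b]].
  exact: measurable_itv.
apply: (@le_trans _ _ (\int[leb]_(r in `[a, b]) K%:E)%E).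
  apply: ge0_le_lower_integral => r; rewrite /= in_itv/= => /andP[ar rb].
    by rewrite lee_fin.
  by rewrite lee_fin hK.
by rewrite integral_itv_cst.
Qed.

Lemma chain_integral_fin a b : 0 <= a -> a <= b -> b <= clen c ->
  (\int[leb]_(r in `[a, b]) (h m (c r))%:E)%E \is a fin_num.
Proof.
move=> a0 ab bL; rewrite ge0_fin_numE; last first.
  by apply: integral_ge0 => r _; rewrite lee_fin.
apply: (le_lt_trans (@intle a b (B m) a0 ab bL _)); first by move=> *; exact: hB.
exact: ltry.
Qed.

Lemma chain_integral_increment a b K : 0 <= a -> a <= b -> b <= clen c ->
  (forall r, a <= r -> r <= b -> h m (c r) <= K) -> J b - J a <= K * (b - a).
Proof.
move=> a0 ab bL hK; rewrite lerBlDl -lee_fin EFinD.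
rewrite /J !fineK; [|exact: chain_integral_fin (le_trans ab bL)|
  exact: (chain_integral_fin (lexx _) (le_trans a0 ab) bL)].
rewrite (ge0_integral_itvD a0 ab (@mJ 0 b (lexx _) bL))//.
  by rewrite leeD2l//; exact: intle.
by move=> r _; rewrite lee_fin.
Qed.

Lemma chain_integral0 : J 0 = 0.
Proof. by rewrite /J set_itv1 integral_set1. Qed.

End curve_of_chains.

(* The curve is an ultrafilter limit of the step functions [walk] along almost
   optimal chains of finer and finer mesh. *)
Lemma chain_curve (x : X) : U x -> (forall n, chain_fun n x <= 2^-1) ->
  exists c : curve X, [/\ cstart c = x, ~ U (cend c) &
    forall m, (curve_integral c (fun y => (h m y)%:E) <= (3 / 4)%:E)%E].
Proof.
move=> Ux fx.
(* An infimum at most 1/2 is approached within 1/4; being below 1, the value found is the cost of a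
   chain and not the default 1. *)
have /choice[l lP] : forall n, exists l, chain n x l /\ chain_cost n x l < 3 / 4.
  move=> n; have e0 : 0 < 1 / 4 :> R by rewrite divr_gt0.
  have [_ [->|[l cl <-]]] := inf_adherent e0 (chain_has n x).
    by rewrite -/(chain_fun n x) => h1; have := fx n; lra.
  by rewrite -/(chain_fun n x) => h1; exists l; split => //; have := fx n; lra.
pose len n := chain_length x (l n).
pose i (n : nat) : R := n.+1%:R^-1.
have len0 n : 0 <= len n by exact: chain_length_ge0.
have len1 n : len n < 3 / 4.
  have [[pl _] cl] := lP n; apply: le_lt_trans cl; exact: chain_length_le pl.
have ple n : path (fun a b => mdist a b <= i n) x (l n).
  have [[pl _] _] := lP n; apply: sub_path pl => a b; by move=> /andP[].
pose W n (t : R) := walk x (l n) (Num.max 0 t).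
have Wd n t t' : mdist (W n t) (W n t') <= `|t - t'| + i n.
  have w1 a b : a <= b -> mdist (W n a) (W n b) <= `|a - b| + i n.
    move=> ab; apply: (le_trans (@walk_dist _ _ _ _ (i n) _ (ple n) _ _)).
    - by rewrite invr_ge0.
    - by rewrite le_max lexx.
    - by rewrite ge_max !le_max lexx ab orbT.
    - rewrite lerD2r distrC; have := ler_norm (b - a).
      by case: (leP 0 a) => ?; case: (leP 0 b) => ? ?; lra.
  have [/w1//|/ltW/w1] := leP t t'.
  by rewrite metric_sym (distrC t).
have [F [FU Foo]] := @ultraFilterLemma nat \oo _.
have FP : ProperFilter F by exact: ultra_proper.
have Finf k : F [set n | (k <= n)%N] by apply: Foo; exact: nbhs_infty_ge.
have Fsmall e : 0 < e -> F [set n | i n < e].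
  move=> e0; apply: filterS (Finf (Num.truncn e^-1)) => n /= en.
  rewrite /i -[ltRHS]invrK ltf_pV2 ?posrE ?invr_gt0//.
  by rewrite (lt_le_trans (truncnS_gt _))// ler_nat ltnS.
(* For fixed [t] the walks stay in a compact ball about [x]. Their jumps shrink to 0, so the limit
   is 1-Lipschitz. *)
have /choice[g gP] : forall t : R, exists p : X, (W^~ t) @ F --> p.
  move=> t; have [|p _ Fp] := @ultra_compact_lim _ _ F (W^~ t) _ FU (@X_proper x (Num.max 0 t)).
    apply: filterS (Finf 0%N) => n _ /=; apply: walk_start.
    by rewrite le_max lexx.
  by exists p.
have gE t e : 0 < e -> F [set n | mdist (g t) (W n t) < e].
  move=> e0; have := gP t _ (nbhsx_ballx (g t) e e0).
  by rewrite /nbhs/=; apply: filterS => n; rewrite ballEmdist.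
have glip t t' : mdist (g t) (g t') <= `|t - t'|.
  apply/ler_addgt0Pr => e e0; have e3 : 0 < e / 3 by rewrite divr_gt0.
  have [n [[n1 n2] n3]] := @filter_ex _ F FP _
    (filterI (filterI (gE t _ e3) (gE t' _ e3)) (Fsmall _ e3)).
  have := metric_triangle (g t) (W n t) (g t').
  have := metric_triangle (W n t) (W n t') (g t').
  rewrite (metric_sym (W n t') (g t')); have := Wd n t t'.
  by move: n1 n2 n3 => /=; lra.
have g0x : g 0 = x.
  apply: mdist_positivity; apply/eqP; rewrite eq_le mdist_ge0 andbT.
  apply/ler_addgt0Pr => e e0; rewrite add0r.
  have [n /= n1] := @filter_ex _ F FP _ (gE 0 _ e0).
  have w0 : mdist x (W n 0) <= 0 by rewrite /W maxxx; exact: walk_start.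
  have := metric_triangle (g 0) (W n 0) x; rewrite (metric_sym (W n 0) x); lra.
(* Lengths are bounded by costs, hence below 1; from the limit length [ell] on, [g] is constant. *)
have [|ell ellI ellP] := @ultra_compact_lim _ _ F len _ FU (@segment_compact R 0 1).
  apply: filterS (Finf 0%N) => n _ /=; rewrite in_itv/= len0/=.
  by have := len1 n; lra.
have /andP[ell0 ell1] : 0 <= ell <= 1 by move: ellI; rewrite /= in_itv.
have ellE e : 0 < e -> F [set n | `|ell - len n| < e].
  move=> e0; have := ellP _ (nbhsx_ballx ell e e0).
  by rewrite /nbhs/=; apply: filterS => n.
have Wlast n t : len n <= t -> W n t = last x (l n).
  move=> lt_; rewrite /W (max_idPr _); last exact: le_trans lt_.
  exact: walk_last.
have gconst t : ell <= t -> g t = g ell.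
  rewrite le_eqVlt => /predU1P[->//|et].
  apply: mdist_positivity; apply/eqP; rewrite eq_le mdist_ge0 andbT.
  apply/ler_addgt0Pr => e e0; rewrite add0r.
  have e4 : 0 < e / 4 by rewrite divr_gt0.
  have te : 0 < t - ell by rewrite subr_gt0.
  have [n [[[[n1 n2] n3] n4] n5]] := @filter_ex _ F FP _ (filterI (filterI (filterI
    (filterI (gE t _ e4) (gE ell _ e4)) (Fsmall _ e4)) (ellE _ e4)) (ellE _ te)).
  move: n1 n2 n3 n4 n5 => /= n1 n2 n3 n4 n5.
  have lnt : len n <= t by move: n5; rewrite ltr_norml => /andP[? ?]; lra.
  have := metric_triangle (g t) (W n t) (g ell).
  have := metric_triangle (W n t) (W n ell) (g ell).
  rewrite (metric_sym (W n ell) (g ell)); have := Wd n (len n) ell.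
  by move: n1; rewrite distrC (Wlast n t)// (Wlast n (len n))//; lra.
(* The last point of the [n]-th chain is within [1 / n] of the closed complement of [U]. *)
have nUg : ~ U (g ell).
  move=> Ug; have [r r0 rU] := open_ball_subP oU Ug.
  have r4 : 0 < r / 4 by rewrite divr_gt0.
  have [n [[[n1 n2] n3] n4]] := @filter_ex _ F FP _ (filterI (filterI
    (filterI (gE ell _ r4) (Fsmall _ r4)) (ellE _ r4)) (Finf (Num.truncn (r / 4)^-1).+1)).
  move: n1 n2 n3 n4 => /= n1 n2 n3 n4.
  have [[_ rl] _] := lP n; have [y nUy ny] := ramp_lt1 rl.
  apply: nUy; apply: rU; rewrite ballEmdist/=.
  have yr : mdist (last x (l n)) y < r / 4.
    rewrite ltNge; apply/negP => ry.
    have nr : (r / 4)^-1 <= n%:R.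
      by rewrite (le_trans (ltW (truncnS_gt _)))// ler_nat.
    have : 1 <= n%:R * mdist (last x (l n)) y.
      rewrite -[leLHS](mulVf (lt0r_neq0 r4)); apply: ler_pM => //.
        by rewrite invr_ge0 ltW.
      exact: ltW.
    by rewrite leNgt ny.
  have := metric_triangle (g ell) (W n ell) y.
  have := metric_triangle (W n ell) (W n (len n)) y.
  have := Wd n ell (len n); rewrite (Wlast n (len n))//.
  by have := splitr r; lra.
have g0l : g 0 != g ell.
  by apply/eqP => gE0; apply: nUg; rewrite -gE0 g0x.
have [c [s [s0 sl slip cs]]] := arclength_reparam ell0 glip g0l.
exists c; split.
- by rewrite /cstart -s0 cs ?lexx.
- by rewrite /cend -sl cs ?ell0 ?lexx.
move=> m; apply/lee_addgt0Pr => e e0.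
have B0 : 0 <= B m by exact: le_trans (h0 m x) (hB m x).
pose J (v : R) : R := fine (\int[leb]_(r in `[0%R, v]) (h m (c r))%:E)%E.
(* [len n] may exceed [ell], and [s] is only controlled up to [ell], after which [g] stands
   still. *)
pose s' t := s (Num.min t ell).
pose Js t := J (s' t).
have min0 t : 0 <= t -> 0 <= Num.min t ell by move=> t0; rewrite le_min t0.
have minl t : Num.min t ell <= ell by rewrite ge_min lexx orbT.
have s'lip t t' : 0 <= t -> t <= t' -> 0 <= s' t' - s' t <= t' - t.
  move=> t0 tt'; have mm : Num.min t ell <= Num.min t' ell.
    by rewrite le_min minl ge_min tt'.
  have /andP[h1 h2] := slip _ _ (min0 _ t0) mm (minl t').
  rewrite h1/=; apply: (le_trans h2).
  by case: (leP t ell) => ?; case: (leP t' ell) => ?; lra.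
have s'0 t : 0 <= t -> 0 <= s' t.
  by move=> t0; have /andP[] := s'lip 0 t (lexx _) t0; rewrite /s' (min_idPl ell0) s0 subr0.
have s'L t : 0 <= t -> s' t <= clen c.
  move=> t0; rewrite -sl -subr_ge0 /s'.
  by have /andP[] := slip _ _ (min0 _ t0) (minl t) (lexx _).
have cs' t : 0 <= t -> c (s' t) = g t.
  move=> t0; rewrite /s' cs; last by rewrite min0//=.
  by case: (leP t ell) => // /ltW et; rewrite gconst.
have JsD t t' K : 0 <= t -> t <= t' -> 0 <= K ->
    (forall r, t <= r -> r <= t' -> h m (g r) <= K) -> Js t' - Js t <= K * (t' - t).
  move=> t0 tt' K0 hK; have t'0 := le_trans t0 tt'.
  have /andP[i1 i2] := s'lip _ _ t0 tt'.
  apply: (@le_trans _ _ (K * (s' t' - s' t))); last by rewrite ler_wpM2l.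
  apply: chain_integral_increment; [exact: s'0|by rewrite -subr_ge0|exact: s'L|].
  move=> v v1 v2; have [||r] := @IVT_lipschitz R s' t t' v tt'.
  - by move=> a b ta ab bt'; apply: s'lip => //; exact: le_trans ta.
  - by rewrite v1 v2.
  - rewrite in_itv/= => /andP[tr rt'] <-; rewrite cs'; last exact: le_trans tr.
    exact: hK.
(* Pointwise convergence is uniform on [[0, 1]], because the walks are 1-Lipschitz up to their
   mesh. *)
have unif e1 : 0 < e1 ->
    F [set n | forall t, 0 <= t -> t <= 1 -> mdist (g t) (W n t) <= e1].
  move=> e10; have e4 : 0 < e1 / 4 by rewrite divr_gt0.
  have /(compact_near_coveringP _).1 := @segment_compact R 0 1.
  move=> H; have : F [set n | `[0, 1]%classic `<=` (fun t => mdist (g t) (W n t) <= e1)].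
    apply: (H nat F (fun n t => mdist (g t) (W n t) <= e1)) => t _.
    rewrite /prop_near1/nbhs/=; exists (ball t (e1 / 4),
      [set n | mdist (g t) (W n t) < e1 / 4] `&` [set n | i n < e1 / 4]).
      split => /=; first exact: nbhsx_ballx.
      by apply: filterI; [exact: gE|exact: Fsmall].
    move=> [t' n] /= [tt' [n1 n2]].
    have := metric_triangle (g t') (g t) (W n t').
    have := metric_triangle (g t) (W n t) (W n t').
    have := glip t' t; have := Wd n t t'; rewrite (distrC t' t).
    by move: tt'; rewrite /ball/= => tt'; have := splitr e1; lra.
  by apply: filterS => n Hn t t0 t1; apply: Hn; rewrite /= in_itv/= t0.
(* During the step leaving [z] the limit path stays within [e1 + i n] of [z]. The index [m] is
   fixed, so [La m] does not grow with [n], while [h m z <= h n z] brings in the cost of the [n]-th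
   chain. *)
have piece n e1 l' z T : (m <= n)%N -> 0 <= T -> 0 <= e1 ->
    path (chain_step n) z l' ->
    (forall u, 0 <= u -> u <= chain_length z l' ->
       mdist (g (T + u)) (walk z l' u) <= e1) ->
    Js (T + chain_length z l') - Js T <=
    chain_cost n z l' + La m * (e1 + i n) * chain_length z l'.
  move=> mn + e10; have i0 : 0 <= i n by rewrite invr_ge0.
  elim: l' z T => [|y l' IH] z T T0 /=; first by rewrite addr0 subrr mulr0 addr0.
  move=> /andP[/andP[_ +] pl] near; rewrite -/(i n) => zy.
  have d0 := mdist_ge0 z y; have cl0 := chain_length_ge0 y l'.
  have first_ : Js (T + mdist z y) - Js T <=
      (h n z + La m * (e1 + i n)) * mdist z y.
    have -> : mdist z y = T + mdist z y - T :> R by rewrite addrC addKr.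
    rewrite [X in Js X - _](_ : _ = T + mdist z y); last by lra.
    apply: JsD => //.
    - by rewrite lerDl.
    - by rewrite addr_ge0// mulr_ge0// addr_ge0.
    - move=> r Tr rT; have nr := near (r - T) ltac:(rewrite subr_ge0//) ltac:(lra).
      have Er : T + (r - T) = r by rewrite addrC subrK.
      rewrite Er in nr.
      have wz : mdist z (walk z (y :: l') (r - T)) <= r - T.
        by apply: walk_start; rewrite subr_ge0.
      have gz : mdist (g r) z <= e1 + i n.
        have := metric_triangle (g r) (walk z (y :: l') (r - T)) z.
        rewrite (metric_sym (walk _ _ _) z).
        move: nr wz; rewrite -/(walk z (y :: l') (r - T)).
        move: (walk z (y :: l') (r - T)) => w; lra.
      have := h_lip m (g r) z; have := ler_norm (h m (g r) - h m z).
      have := h_mono z mn; have := ler_wpM2l (La0 m) gz; lra.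
  have := IH y (T + mdist z y) ltac:(exact: addr_ge0) pl.
  have near' u : 0 <= u -> u <= chain_length y l' ->
      mdist (g (T + mdist z y + u)) (walk y l' u) <= e1.
    move=> u0 ul; have := near (mdist z y + u) (addr_ge0 d0 u0).
    rewrite lerD2l => /(_ ul); rewrite ltNge lerDl u0/=.
    by rewrite (addrC (mdist z y) u) addrK (addrC u) addrA.
  move=> /(_ near'); rewrite -addrA.
  by rewrite mulrDr; lra.
(* Twice [La m] since [i n < e1] and the length is below 1; [B m] for the time between [len n] and
   [ell]; 1 for positivity. *)
pose K := 2 * La m + B m + 1.
have K0 : 0 < K by rewrite /K; have := La0 m; lra.
pose e1 := e / K.
have e10 : 0 < e1 by rewrite divr_gt0.
have [n [[[n1 n2] n3] n4]] := @filter_ex _ F FP _ (filterI (filterI (filterI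
  (unif _ e10) (Fsmall _ e10)) (ellE _ e10)) (Finf m)).
move: n1 n2 n3 n4 => /= n1 n2 n3 n4.
have [[pl _] cl] := lP n.
have := piece n e1 (l n) x 0 n4 (lexx _) (ltW e10) pl.
rewrite add0r => H; have {}H := H ltac:(
  move=> u u0 ul; rewrite add0r; have := n1 u u0 ltac:(have := len1 n; rewrite /len; lra);
  by rewrite /W (max_idPr u0)).
have last_ : Js ell - Js (len n) <= B m * e1.
  have [le_|el] := leP (len n) ell.
    apply: (@le_trans _ _ (B m * (ell - len n))).
      by apply: JsD => // r _ _; exact: hB.
    by rewrite ler_wpM2l// ltW// (le_lt_trans _ n3)// ler_norm.
  rewrite /Js /s' (min_idPr (ltW el)) minxx subrr mulr_ge0//; exact: ltW.
have Js0 : Js 0 = 0.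
  by rewrite /Js /s' (min_idPl ell0) s0; exact: chain_integral0.
have JsL : Js ell = J (clen c) by rewrite /Js /s' minxx sl.
have -> : curve_integral c (fun y => (h m y)%:E) = (J (clen c))%:E.
  rewrite /J fineK//; apply: chain_integral_fin => //; exact/ltW/clen_gt0.
rewrite -EFinD lee_fin -JsL.
have KE : K * e1 = e by rewrite /e1 mulrC divfK// lt0r_neq0.
have b1 : La m * (e1 + i n) * chain_length x (l n) <= La m * (2 * e1).
  rewrite -mulrA ler_wpM2l//; apply: (@le_trans _ _ ((2 * e1) * 1)); last by rewrite mulr1.
  have i0 : 0 <= i n by rewrite invr_ge0.
  apply: ler_pM; [exact: addr_ge0 (ltW e10) i0|exact: len0|lra|].
  by have := len1 n; rewrite /len; lra.
rewrite Js0 subr0 -/(len n) in H b1 *.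
have : La m * (2 * e1) + B m * e1 <= e by rewrite -KE /K; lra.
by lra.
Qed.

End chains.

(** * Cutoffs obtained from small capacity *)

Section ramp_sum.
Context {R : realType} {X : completeMetricType R}.
Variables (U : nat -> set X) (V : set X).
Hypothesis oU : forall i, open (U i).
Hypothesis oV : open V.

(** Lipschitz functions increasing to [open_sum U] plus the indicator of [V]. The summand for [V]
    makes the cost of chains dominate their length. *)
Definition ramp_sum (n : nat) (x : X) : R :=
  \sum_(0 <= i < n) i.+1%:R^-1 * ramp n (U i) x + ramp n V x.

Let i0 (i : nat) : 0 <= i.+1%:R^-1 :> R. Proof. by rewrite invr_ge0. Qed.

Let i1 (i : nat) : i.+1%:R^-1 <= 1 :> R. Proof. by rewrite invf_le1// ler1n. Qed.

Lemma ramp_sum_ge0 n x : 0 <= ramp_sum n x.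
Proof.
by rewrite addr_ge0 ?ramp_ge0// sumr_ge0// => i _; rewrite mulr_ge0 ?ramp_ge0.
Qed.

Lemma ramp_sum_mono m n x : (m <= n)%N -> ramp_sum m x <= ramp_sum n x.
Proof.
move=> mn; rewrite lerD ?ramp_mono// (@big_cat_nat _ _ _ m 0 n)//=.
rewrite -[leLHS]addr0 lerD// ?ler_sum// => [i _|]; first by rewrite ler_wpM2l ?ramp_mono.
by rewrite sumr_ge0// => i _; rewrite mulr_ge0 ?ramp_ge0.
Qed.

Lemma ramp_sum_ramp n x : ramp n V x <= ramp_sum n x.
Proof.
by rewrite lerDr sumr_ge0// => i _; rewrite mulr_ge0 ?ramp_ge0.
Qed.

Lemma ramp_sum_bound n x : ramp_sum n x <= n%:R + 1.
Proof.
rewrite lerD ?ramp_le1// (le_trans (_ : _ <= \sum_(0 <= i < n) 1))//; last first.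
  by rewrite sumr_const_nat subn0.
by apply: ler_sum => i _; rewrite mulr_ile1 ?ramp_ge0 ?ramp_le1.
Qed.

Lemma ramp_sum_lip n x y :
  `|ramp_sum n x - ramp_sum n y| <= (n%:R * n%:R + n%:R) * mdist x y.
Proof.
rewrite /ramp_sum opprD addrACA -sumrB mulrDl (le_trans (ler_normD _ _))//.
rewrite lerD ?ramp_lip// (le_trans (ler_norm_sum _ _ _))//.
rewrite (le_trans (_ : _ <= \sum_(0 <= i < n) n%:R * mdist x y))//; last first.
  by rewrite sumr_const_nat subn0 -[leLHS]mulr_natl mulrA.
apply: ler_sum => i _; rewrite -mulrBr normrM ger0_norm//.
by rewrite -[leRHS]mul1r ler_pM ?ramp_lip.
Qed.

Let near_ramp (W : set X) x : open W ->
  \forall n \near \oo, \1_W x <= ramp n W x :> R.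
Proof.
move=> oW; rewrite indicE; have [/[!inE] Wx|_] := boolP (x \in W); last first.
  by apply: nearW => n; exact: ramp_ge0.
have [N hN] := ramp_in oW Wx.
by exists N => // n /= Nn; rewrite hN.
Qed.

Let ramp_indic n (W : set X) x : ramp n W x <= \1_W x.
Proof.
rewrite indicE; have [_|] := boolP (x \in W); first exact: ramp_le1.
by rewrite notin_setE => nW; rewrite ramp_out.
Qed.

Lemma ramp_sum_cvg x :
  ((ramp_sum n x)%:E @[n --> \oo] --> open_sum U x + (\1_V x)%:E)%E.
Proof.
set S := (X in _ --> X).
have nd : nondecreasing_seq (fun n => (ramp_sum n x)%:E).
  by move=> m n mn; rewrite lee_fin; exact: ramp_sum_mono.
have := ereal_nondecreasing_cvgn nd; set s := ereal_sup _.
suff -> : s = S by [].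
apply/eqP; rewrite eq_le; apply/andP; split.
  apply: ge_ereal_sup => _ [n _ <-]; rewrite /S /ramp_sum EFinD leeD//.
    apply: (@le_trans _ _ (\sum_(0 <= i < n) (i.+1%:R^-1 * \1_(U i) x)%:E)%E).
      by rewrite sumEFin lee_fin; apply: ler_sum => i _; rewrite ler_wpM2l.
    by apply: nneseries_lim_ge => i _ _; rewrite lee_fin mulr_ge0.
  by rewrite lee_fin.
rewrite /S -leeBrDr//; apply: lime_le.
  by apply: is_cvg_nneseries => i _ _; rewrite lee_fin mulr_ge0.
apply: nearW => N; rewrite leeBrDr// sumEFin -EFinD.
have H : \forall n \near \oo, \sum_(0 <= i < N) i.+1%:R^-1 * \1_(U i) x <=
    \sum_(0 <= i < N) i.+1%:R^-1 * ramp n (U i) x.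
  elim: N => [|N IH]; first by apply: nearW => n; rewrite !big_geq.
  near=> n; rewrite !big_nat_recr//= lerD//; first by near: n.
  by rewrite ler_wpM2l//; near: n; exact: near_ramp.
have [n [[n1 n2] n3]] := @filter_ex _ _ _ _
  (filterI (filterI H (near_ramp x oV)) (nbhs_infty_ge N)).
apply: (@le_trans _ _ (ramp_sum n x)%:E); last by apply: ereal_sup_ubound; exists n.
rewrite lee_fin lerD//; apply: (le_trans n1).
rewrite (@big_cat_nat _ _ _ N 0 n)//= lerDl sumr_ge0// => i _.
by rewrite mulr_ge0 ?ramp_ge0.
Unshelve. all: by end_near.
Qed.

Lemma ramp_sum_ull n : uniformly_locally_lipschitz (ramp_sum n).
Proof.
exists (n%:R * n%:R + n%:R), 1; split => //.
by move=> x y _; exact: ramp_sum_lip.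
Qed.

Lemma borel_open_sum_indic : borel_fun (fun x => open_sum U x + (\1_V x)%:E)%E.
Proof.
apply: (@emeasurable_fun_cvg _ (g_sigma_algebraType (@open X)) R setT
  (fun n x => (ramp_sum n x)%:E)).
  by move=> n; exact: uniformly_locally_lipschitz_borel (ramp_sum_ull n).
by move=> x _; exact: ramp_sum_cvg.
Qed.

End ramp_sum.

Section capacity.
Context {R : realType} {X : completeMetricType R}.
Variable mu : {outer_measure set X -> \bar R}.
Hypothesis mu_regular : borel_regular mu.
Hypothesis mu_doubling : doubling mu.

Notation cara := (mu.-caratheodory).
Notation mmu := (cmeas mu).
Notation mfun A f := (@measurable_fun _ _ (caratheodory_type mu) _ A f).

Local Open Scope ereal_scope.

Lemma curve_integral_leZ (c : curve X) (K : R) (f h : X -> \bar R) :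
  (0 <= K)%R -> borel_fun h -> (forall x, 0 <= f x) -> (forall x, 0 <= h x) ->
  (forall x, f x <= K%:E * h x) ->
  curve_integral c f <= K%:E * curve_integral c h.
Proof.
move=> K0 bh f0 h0 fh; apply: (le_trans (curve_integral_mono c f0 fh)).
rewrite /curve_integral ge0_integralZl_EFin//.
exact: measurable_curve.
Qed.

(** Along a non-exceptional curve from [A] to the complement of [V], [w] falls from at least 1 to
    below 1/2, so the integral of [g] exceeds 1/2; since [h >= 2 * g], a curve of cost at most 3/4
    would make it at most 3/8. The integral of [h] is at most [6 * d]: [2 * d] from [w] and [g]
    together, [2 * d] from [rho], and [d] for each of the two outer approximations. *)
Lemma capacity_cutoff (A : set X) (d : R) : (0 < d)%R -> Cap1 mu A < d%:E ->
  exists (f : nat -> X -> R) (h : X -> \bar R) (V : set X),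
  [/\ forall n x, (0 <= f n x <= 1)%R,
      forall m n x, (m <= n)%N -> (f m x <= f n x)%R &
      forall n, uniformly_locally_lipschitz (f n)] /\
  [/\ borel_fun h, forall x, 0 <= h x, \int[mmu]_x h x <= (8 * d)%:E &
      forall n c, upper_along (f n) h c] /\
  [/\ open V, mu V <= (3 * d)%:E, forall n x, ~ V x -> f n x = 0%R &
      forall x, A x -> exists n, (2^-1 < f n x)%R].
Proof.
move=> d0 /ereal_inf_lt[_ [w [[[wL1 _] wA] <-]] wd].
have cT : cara [set: X] by exact: caraT.
have mw : mfun setT w by case/integrableP: wL1.
set a := \int[mmu]_x `|w x| in wd.
have a_ge0 : 0 <= a by exact: integral_ge0.
have afin : a \is a fin_num by rewrite ge0_fin_numE//; case/integrableP: wL1.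
move: wd; rewrite /N11_norm -/a -lteBrDl// => /ereal_inf_lt[_ [g [mg g0 [G Gex Gg]] <-]].
rewrite lteBrDl// => agd.
have gfin : \int[mmu]_x g x \is a fin_num.
  rewrite ge0_fin_numE; last by apply: integral_ge0 => x _; exact: g0.
  apply: le_lt_trans (ltry d); apply: le_trans (ltW agd).
  by rewrite leeDr.
have {}g0 x : 0 <= g x by exact: g0.
have [rho [brho rho0 rhoL1 Grho]] := Gex.
have mrho : mfun setT rho by case/integrableP: rhoL1.
pose r := fine (\int[mmu]_x rho x).
have rfin : \int[mmu]_x rho x = r%:E.
  rewrite fineK// ge0_fin_numE; last exact: integral_ge0.
  case/integrableP: rhoL1 => _; congr (_ < _); apply: eq_integral => x _.
  by rewrite gee0_abs.
have r0 : (0 <= r)%R by rewrite -lee_fin -rfin integral_ge0.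
(* [t * rho] has integral at most [d], yet makes exceptional curves infinitely expensive; a curve of
   finite cost is then not exceptional. *)
pose t := (d / (r + 1))%R.
have t0 : (0 < t)%R by rewrite divr_gt0// ltr_wpDl.
have tr : (t * r <= d)%R.
  rewrite /t mulrAC ler_pdivrMr ?ltr_wpDl// ler_wpM2l ?(ltW d0)//.
  by rewrite lerDl.
pose g2 x := 2%:E * g x + (2 * t)%:E * rho x.
have t20 : (0 <= 2 * t)%R by rewrite mulr_ge0// ltW.
have g20 x : 0 <= g2 x by rewrite adde_ge0// mule_ge0.
have mg2 : mfun setT g2.
  by apply: emeasurable_funD; exact: measurable_funeM.
have Ig2 : \int[mmu]_x g2 x = 2%:E * \int[mmu]_x g x + (2 * t)%:E * r%:E.
  rewrite ge0_integralD//; last 4 first.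
  - by move=> x _; rewrite mule_ge0.
  - exact: measurable_funeM.
  - by move=> x _; rewrite mule_ge0.
  - exact: measurable_funeM.
  by rewrite !ge0_integralZl_EFin// rfin.
have [U [oU g2U IU]] := lsc_majorant mu_regular mu_doubling d0 mg2 g20.
(* Contains [A], has measure at most [2 * a] by Chebyshev's inequality, and off it [w] is finite and
   below 1/2. *)
pose E := [set x | (2^-1)%:E <= `|w x|].
have cE : cara E.
  have := @emeasurable_fun_c_infty _ (caratheodory_type mu) R setT (fun x => `|w x|).
  move=> /(_ _ _ (2^-1)%:E); rewrite setTI; apply=> //.
  exact: measurableT_comp.
have muE : mu E <= 2%:E * a.
  have := @le_integral_abse _ (caratheodory_type mu) R mmu setT measurableT w (2^-1)%R mw.
  rewrite setTI -/E -/a => /(_ ltac:(by rewrite invr_gt0)) H.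
  have := @lee_wpmul2l _ 2%:E ltac:(by rewrite lee_fin) _ _ H.
  by rewrite muleA -EFinM mulfV ?pnatr_eq0// mul1e.
have [V [oV EV muV]] := outer_regular mu_regular mu_doubling E d0.
pose h x := open_sum U x + (\1_V x)%:E.
pose hn n x := ramp_sum U V n x.
have bh : borel_fun h by exact: borel_open_sum_indic.
have h0 x : 0 <= h x by rewrite adde_ge0 ?open_sum_ge0// lee_fin.
have hcvg x : (hn n x)%:E @[n --> \oo] --> h x by exact: ramp_sum_cvg.
have hhn n x : (hn n x)%:E <= h x.
  rewrite -(cvg_lim (@ereal_hausdorff R) (hcvg x)).
  apply: lime_ge; first by apply/cvg_ex; eexists; exact: hcvg.
  by exists n => // m /= nm; rewrite lee_fin; exact: ramp_sum_mono.
pose La (n : nat) : R := (n%:R * n%:R + n%:R)%R.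
pose B (n : nat) : R := (n%:R + 1)%R.
have hn0 n x : (0 <= hn n x)%R by exact: ramp_sum_ge0.
have hn_mono m n x : (m <= n)%N -> (hn m x <= hn n x)%R by exact: ramp_sum_mono.
have hn_lip n x y : (`|hn n x - hn n y| <= La n * mdist x y)%R by exact: ramp_sum_lip.
have La0 n : (0 <= La n)%R by rewrite addr_ge0// mulr_ge0.
have hnB n x : (hn n x <= B n)%R by exact: ramp_sum_bound.
have hn_ramp n x : (ramp n V x <= hn n x)%R by exact: ramp_sum_ramp.
exists (chain_fun V hn), h, V; split; [split|split; split].
- by move=> n x; rewrite chain_fun_ge0//= chain_fun_le1.
- by move=> m n x; exact: chain_fun_mono.
- by move=> n; exact: chain_fun_lip.
- by [].
- by [].
- rewrite /h ge0_integralD//; last 3 first.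
  + by move=> x _; exact: open_sum_ge0.
  + have bS : borel_fun (open_sum U).
      have := borel_open_sum_indic oU (@open0 X); congr borel_fun.
      by apply/funext => x; rewrite indic0 adde0.
    exact: borel_mfun.
  + apply/measurable_EFinP.
    exact: (@measurable_indic _ (caratheodory_type mu) R setT V (open_cara mu_regular oV)).
  have -> : \int[mmu]_x (\1_V x)%:E = mu V.
    have := @integral_indic _ (caratheodory_type mu) R mmu setT measurableT V
      (open_cara mu_regular oV).
    by rewrite setIT.
  apply: (le_trans (leeD IU muV)); rewrite Ig2.
  move: muE agd; rewrite -(fineK afin) -(fineK gfin) => muE agd.
  apply: (@le_trans _ _ (2%:E * (fine (\int[mmu]_x g x))%:E + (2 * t)%:E * r%:E + d%:E +
    (2%:E * (fine a)%:E + d%:E))); first by rewrite leeD2l// leeD2r.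
  move: agd; rewrite -!EFinM -!EFinD lee_fin lte_fin; lra.
- move=> n c s t' s0 st tL; apply: (le_trans (chain_fun_upper V hn0 hn_lip n s0 st tL)).
  by apply: ge0_le_lower_integral => y _; rewrite ?lee_fin.
- by [].
- apply: (le_trans muV); move: muE agd; rewrite -(fineK afin) -(fineK gfin) => muE agd.
  apply: (@le_trans _ _ (2%:E * (fine a)%:E + d%:E)); first by rewrite leeD2r.
  have : 0 <= (fine (\int[mmu]_x g x))%:E by rewrite fineK// integral_ge0.
  move: agd; rewrite -!EFinM -!EFinD !lee_fin lte_fin; lra.
- by move=> n x; exact: chain_fun_out.
(* Otherwise [chain_curve] gives one curve on which all approximations of [h] have integral at most
   3/4, and so does [h] by monotone convergence. *)
move=> x Ax; apply: contrapT => /forallNP fx.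
have EX y : ~ V y -> `|w y| < (2^-1)%:E.
  by move=> nVy; rewrite ltNge; apply/negP => Ey; apply: nVy; exact: EV.
have Vx : V x.
  apply: contrapT => /EX; apply/negP; rewrite -leNgt.
  rewrite (le_trans _ (lee_abs _))// (le_trans _ (wA x Ax))// lee_fin.
  by rewrite invf_le1// ler1n.
have X_proper (y : X) (s : R) : compact [set z | (mdist y z <= s)%R].
  apply: (@closed_bounded_compact _ _ mu _ _ _ y (s + 1)%R) => //.
    exact: closed_mdist_le.
  by move=> z; rewrite ballEmdist/= => ys; rewrite (le_lt_trans ys)// ltrDl.
have fx2 n : (chain_fun V hn n x <= 2^-1)%R by rewrite leNgt; apply/negP; exact: fx.
have [c [cx ncV cI]] :=
  chain_curve oV hn0 hn_mono hn_lip La0 hnB hn_ramp X_proper Vx fx2.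
have ch : curve_integral c h <= (3 / 4)%:E.
  have bhn n : borel_fun (fun y => (hn n y)%:E).
    exact: uniformly_locally_lipschitz_borel (ramp_sum_ull U V n).
  have H := @cvg_monotone_convergence _ _ R (@lebesgue_measure R) `[0%R, clen c]
    (measurable_itv _) (fun n t => (hn n (c t))%:E)
    (fun n => @measurable_curve _ _ c _ (bhn n)) (fun n t _ => hn0 n (c t))
    (fun t _ m n mn => hn_mono m n (c t) mn).
  have -> : curve_integral c h = 
      \int[lebesgue_measure]_(t in `[0%R, clen c]) limn (fun n => (hn n (c t))%:E).
    apply: eq_integral => t' _; apply/esym/cvg_lim => //; exact: hcvg.
  rewrite -(cvg_lim _ H)//; apply: lime_le; first by apply/cvg_ex; eexists; exact: H.
  by apply: nearW => n; exact: cI.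
have [Gc|nGc] := pselect (G c).
  have : curve_integral c rho <= ((2 * t)^-1)%:E * curve_integral c h.
    apply: curve_integral_leZ => //; first by rewrite invr_ge0.
    move=> y; rewrite -(@lee_pmul2l _ (2 * t)%:E)//; last by rewrite lte_fin mulr_gt0.
    rewrite muleA -EFinM mulfV ?mul1e; last by rewrite gt_eqF// mulr_gt0.
    apply: le_trans (le_trans (g2U y) _).
      by rewrite /g2 leeDr// mule_ge0.
    by rewrite /h leeDl// lee_fin.
  rewrite Grho// => H; have : +oo <= ((2 * t)^-1)%:E * (3 / 4)%:E :> \bar R.
    by apply: (le_trans H); rewrite lee_wpmul2l// lee_fin invr_ge0.
  by rewrite -EFinM leye_eq.
have := Gg c (fun _ _ => I) nGc; rewrite /gradient_ineq cx.
have : curve_integral c g <= (2^-1)%:E * curve_integral c h.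
  apply: curve_integral_leZ => // y; rewrite -(@lee_pmul2l _ 2%:E)//.
  rewrite muleA -EFinM mulfV ?mul1e; last by rewrite pnatr_eq0.
  apply: le_trans (le_trans (g2U y) _).
    by rewrite /g2 leeDl// mule_ge0.
  by rewrite /h leeDl// lee_fin.
move=> cg /le_trans /(_ cg) H.
have {}H : `|w x - w (cend c)| <= (2^-1)%:E * (3 / 4)%:E.
  by apply: (le_trans H); rewrite lee_wpmul2l// lee_fin invr_ge0.
have := EX _ ncV; have := wA x Ax; move: H; rewrite -EFinM.
case: (w (cend c)) => [b| |]//; case: (w x) => [b'| |]//=.
rewrite !lee_fin !lte_fin => H b1 b2.
by move: H; rewrite leNgt => /negP; apply; move: b2; rewrite ltr_norml => /andP[? ?];
  rewrite lter_normr; apply/orP; left; lra.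
Qed.

End capacity.

(** * Total variation and the diagonal argument *)

Section limn_einf_bounds.
Context {R : realType}.
Local Open Scope ereal_scope.

Lemma limn_einf_le (a : (\bar R)^nat) (b : \bar R) N :
  (forall n, (N <= n)%N -> a n <= b) -> limn_einf a <= b.
Proof.
move=> ab; rewrite limn_einf_lim; apply: lime_le; first exact: is_cvg_einfs.
apply: nearW => n; apply: (le_trans _ (ab (maxn n N) (leq_maxr _ _))).
by apply: ereal_inf_lbound; exists (maxn n N) => //=; exact: leq_maxl.
Qed.

Lemma limn_einf_ge (a : (\bar R)^nat) (b : \bar R) N :
  (forall n, (N <= n)%N -> b <= a n) -> b <= limn_einf a.
Proof.
move=> ba; rewrite limn_einf_lim; apply: lime_ge; first exact: is_cvg_einfs.
exists N => // n /= Nn; apply/ereal_infP => _ [k /= nk <-].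
by apply: ba; exact: leq_trans nk.
Qed.

Lemma limn_einf_lt (a : (\bar R)^nat) (b : \bar R) : limn_einf a < b ->
  forall N, exists2 n, (N <= n)%N & a n < b.
Proof.
move=> ab N; apply: contrapT => H; move: ab; apply/negP; rewrite -leNgt.
apply: (@limn_einf_ge _ _ N) => n Nn; rewrite leNgt; apply/negP => anb.
by apply: H; exists n.
Qed.

Lemma ereal_cvg_lt (a : (\bar R)^nat) (l b : \bar R) : a n @[n --> \oo] --> l ->
  l < b -> \forall n \near \oo, a n < b.
Proof.
move=> al lb; apply: (al [set x | x < b]); apply: open_nbhs_nbhs; split => //.
exact: open_ereal_lt_ereal.
Qed.

End limn_einf_bounds.

Lemma truncation_excess (R : realType) (M r : R) : 0 <= M ->
  `|truncation M r - r| <= Num.max (`|r| - M) 0.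
Proof.
move=> M0; rewrite /truncation ler_norml; have := ler_norm r; have := ler_norm (- r).
rewrite normrN; case: (leP (`|r| - M) 0) => ?; case: (leP r M) => ?.
- by case: (leP (- M) r) => ? ? ?; apply/andP; split; lra.
- by case: (leP (- M) M) => ? ? ?; apply/andP; split; lra.
- by case: (leP (- M) r) => ? ? ?; apply/andP; split; lra.
- by case: (leP (- M) M) => ? ? ?; apply/andP; split; lra.
Qed.

Section total_variation.
Context {R : realType} {X : completeMetricType R}.
Variable mu : {outer_measure set X -> \bar R}.
Hypothesis mu_regular : borel_regular mu.
Hypothesis mu_doubling : doubling mu.

Notation cara := (mu.-caratheodory).
Notation mmu := (cmeas mu).
Notation mfun A f := (@measurable_fun _ _ (caratheodory_type mu) _ A f).

Local Open Scope ereal_scope.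

Lemma tv_open_ge0 (O : set X) (u : X -> \bar R) : 0 <= tv_open mu O u.
Proof.
apply/ereal_infP => _ [[p g] /= [_ _ pg] <-].
apply: (@limn_einf_ge _ _ _ 0%N) => n _; apply: integral_ge0.
by have [[_ + _] _] := pg n; exact.
Qed.

Lemma L1_loc_subset (O O' : set X) (u : X -> \bar R) : open O -> open O' ->
  O' `<=` O -> L1_loc mu O u -> L1_loc mu O' u.
Proof.
move=> oO oO' O'O uO x O'x; have [r r0 ur] := uO x (O'O x O'x).
exists r => //; apply: L1S ur; try (apply: open_cara => //; apply: openI => //;
  exact: open_mball).
exact: setSI.
Qed.

Lemma L1_loc_cvg_subset (O O' : set X) u_ (u : X -> \bar R) : open O -> open O' ->
  O' `<=` O -> L1_loc_cvg mu O u_ u -> L1_loc_cvg mu O' u_ u.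
Proof.
move=> oO oO' O'O uO x O'x; have [r r0 ur] := uO x (O'O x O'x).
exists r => //; apply: L1_cvgS ur; try (apply: open_cara => //; apply: openI => //;
  exact: open_mball).
exact: setSI.
Qed.

Lemma L1_loc_cvg_comp (O : set X) u_ (u : X -> \bar R) (j : nat -> nat) :
  (forall n, (n <= j n)%N) -> L1_loc_cvg mu O u_ u ->
  L1_loc_cvg mu O (fun n => u_ (j n)) u.
Proof.
move=> jn uO x Ox; have [r r0 [ui ul ucvg]] := uO x Ox.
exists r => //; split=> //.
have jc : j n @[n --> \oo] --> \oo.
  move=> S [N _ NS]; exists N => // n /= Nn; apply: NS => /=.
  exact: leq_trans (jn n).
exact: (cvg_comp _ _ jc ucvg).
Qed.

Lemma weak_upper_gradient_subset (O O' : set X) (u g : X -> \bar R) :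
  cara O -> O' `<=` O -> weak_upper_gradient mu O u g ->
  weak_upper_gradient mu O' u g.
Proof.
move=> cO O'O [mg g0 [G Gex Gg]]; split.
- exact: measurable_funS mg.
- by move=> x /O'O; exact: g0.
- exists G => // c cO' nGc; apply: Gg => //; exact: subset_trans cO' O'O.
Qed.

Lemma open_superlevel (f : X -> R) (a : R) : uniformly_locally_lipschitz f ->
  open [set x | (a < f x)%R].
Proof.
move=> fl; have := @open_comp _ _ f [set y | (a < y)%R]; apply.
  by move=> x _; exact: uniformly_locally_lipschitz_continuous.
exact: open_gt.
Qed.

(* Minimal gradients on [O'] of the approximants chosen for [O] compete for the
   variation on [O']. *)
Lemma tv_open_approx (O O' : set X) (v : X -> \bar R) (eta b : R) (m : nat) :
  open O -> open O' -> O' `<=` O -> (0 < eta)%R ->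
  tv_open mu O v < +oo -> b%:E < tv_open mu O' v ->
  exists (p : X -> R) (g : X -> \bar R),
  [/\ lip_loc O p, forall n, L1 mu (exhaustion O n) (EFin \o p),
      \int[mmu]_(x in exhaustion O m) `|(p x)%:E - v x| < eta%:E &
      minimal_weak_upper_gradient mu O (EFin \o p) g] /\
  \int[mmu]_(x in O) g x < tv_open mu O v + eta%:E /\
  b%:E < \int[mmu]_(x in O') g x.
Proof.
move=> oO oO' O'O eta0 Tfin bT.
have Tf : tv_open mu O v \is a fin_num by rewrite ge0_fin_numE ?tv_open_ge0.
have : tv_open mu O v < tv_open mu O v + eta%:E by rewrite lteDl.
move=> /ereal_inf_lt[_ [[p g] /= [pl pc pg] <-]] pT.
(* A lower limit only provides near optimality along a subsequence, which still converges to [v]. *)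
have /choice[j jP] : forall N, exists n, (N <= n)%N /\
    \int[mmu]_(x in O) g n x < tv_open mu O v + eta%:E.
  by move=> N; have [n] := limn_einf_lt pT N; exists n.
have g0 n x : O x -> 0 <= g n x by have [[_ + _] _] := pg n; exact.
have mg n : mfun O (g n) by have [[+ _ _] _] := pg n.
have gO' n : \int[mmu]_(x in O') g (j n) x <= \int[mmu]_(x in O) g (j n) x.
  apply: ge0_subset_integral => //; [exact: open_cara|exact: open_cara|exact: g0].
have Tlt n : \int[mmu]_(x in O') g (j n) x < +oo.
  apply: (le_lt_trans (gO' n)); apply: lt_trans (jP n).2 _.
  by rewrite -(fineK Tf) -EFinD ltry.
have /choice[g' g'P] : forall n, exists g', minimal_weak_upper_gradient mu O'
    (EFin \o p (j n)) g' /\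
    \int[mmu]_(x in O') g' x <= \int[mmu]_(x in O') g (j n) x.
  move=> n; apply: minimal_weak_upper_gradient_exists => //.
  by apply: weak_upper_gradient_subset O'O (pg (j n)).1; exact: open_cara.
have TO' : tv_open mu O' v <= limn_einf (fun n => \int[mmu]_(x in O') g' n x).
  apply: ereal_inf_lbound; exists (p \o j, g') => //; split => /= n.
  - by move=> x O'x; have [r r0 [L pL]] := pl (j n) x (O'O x O'x); exists r => //;
      exists L => y z [/O'O Oy by_] [/O'O Oz bz]; exact: pL.
  - move: n; apply: L1_loc_cvg_subset O'O _ => //.
    by apply: (@L1_loc_cvg_comp _ (fun i => EFin \o p i)) => // n; have [] := jP n.
  - by have [] := g'P n.
have [pi pv pcvg] := @L1_cvg_exhaustion _ _ mu mu_regular mu_doubling O m _ _ oO pc.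
have [N _ NP] : \forall n \near \oo,
    \int[mmu]_(x in exhaustion O m) `|(p n x)%:E - v x| < eta%:E.
  exact: (ereal_cvg_lt pcvg).
(* If the energies on [O'] were at most [b] from [N] on, so would be the variation on [O']. *)
have [n [Nn bn]] : exists n, (N <= n)%N /\ b%:E < \int[mmu]_(x in O') g (j n) x.
  apply: contrapT => /forallNP H; move: (lt_le_trans bT TO'); apply/negP.
  rewrite -leNgt; apply: (@limn_einf_le _ _ _ N) => n Nn.
  apply: (le_trans (g'P n).2); rewrite leNgt; apply/negP => bn.
  by apply: (H n).
exists (p (j n)), (g (j n)); split; split => //.
- move=> k; have [+ _ _] := @L1_cvg_exhaustion _ _ mu mu_regular mu_doubling O k _ _ oO pc.
  exact.
- by apply: NP => /=; apply: leq_trans Nn (jP n).1.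
- exact: (jP n).2.
Qed.

(** The term [16 * M * d] is [2 * M] times the bound [8 * d] on the integral of [h]. The bound on
    [q] minus the truncated [p] is supported on [V], whose measure is of order [d], which controls
    their distance in the mean. *)
Lemma cutoff_competitor (O A : set X) (v : X -> \bar R) (eps d M eta : R) (m : nat) :
  open O -> A `<=` O -> (0 < d)%R -> Cap1 mu A < d%:E -> (0 <= M)%R -> (0 < eta)%R ->
  L1_loc mu O v -> tv_open mu O v < +oo -> (0 < eps)%R -> eps%:E <= tv mu A v ->
  exists (q p : X -> R) (g : X -> \bar R) (V : set X),
  [/\ lip_loc O q, minimal_weak_upper_gradient mu O (EFin \o q) g &
      \int[mmu]_(x in O) g x <= tv_open mu O v + (eta - eps / 2 + 16 * M * d)%:E] /\
  [/\ forall n, L1 mu (exhaustion O n) (EFin \o q),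
      forall n, L1 mu (exhaustion O n) (EFin \o p) &
      \int[mmu]_(x in exhaustion O m) `|(p x)%:E - v x| < eta%:E] /\
  [/\ open V, mu V <= (3 * d)%:E &
      forall x, (`|q x - truncation M (p x)| <= M * \1_V x)%R].
Proof.
move=> oO AO d0 Ad M0 eta0 vO Tfin eps0 epsA.
have [f [h [V [[f01 fmono fl] [[bh h0 hI fh] [oV muV fV Af]]]]]] :=
  capacity_cutoff mu_regular mu_doubling d0 Ad.
pose S n := [set x | (2^-1 < f n x)%R].
pose On n := O `&` S n.
have oS n : open (S n) by exact: open_superlevel.
have oOn n : open (On n) by exact: openI.
have cOn n : cara (On n) by exact: open_cara.
pose O' := \bigcup_n On n.
have oO' : open O' by apply: bigcup_open => n _; exact: oOn.
have O'O : O' `<=` O by move=> x [n _ []].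
have bO' : (eps / 2)%:E < tv_open mu O' v.
  apply: (@lt_le_trans _ _ eps%:E).
    by rewrite lte_fin; lra.
  apply: (le_trans epsA); apply: ereal_inf_lbound; exists O' => //; split => //.
    by move=> x Ax; have [n fn] := Af x Ax; exists n => //; split => //; exact: AO.
  exact: (L1_loc_subset oO oO' O'O vO).
have [p [g [[pl pL1 pv [wg mg_]] [gT gO']]]] :=
  tv_open_approx m oO oO' O'O eta0 Tfin bO'.
have [mg g0 _] := wg.
have Tf : tv_open mu O v \is a fin_num by rewrite ge0_fin_numE ?tv_open_ge0.
have gfin : \int[mmu]_(x in O) g x < +oo.
  by apply: lt_trans gT _; rewrite -(fineK Tf) -EFinD ltry.
(* The sets [On n] increase to [O'], so a single cutoff already captures more than [eps / 2] of the
   energy. *)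
have [n gn] : exists n, (eps / 2)%:E < \int[mmu]_(x in On n) g x.
  apply: contrapT => /forallNP H; move: gO'; apply/negP; rewrite -leNgt.
  have C : (\int[mmu]_(x in On i) g x) @[i --> \oo] --> \int[mmu]_(x in O') g x.
    apply: ge0_nondecreasing_set_cvg_integral.
    - move=> i j ij; apply/subsetPset => x [Ox fx]; split => //.
      exact: lt_le_trans fx (fmono _ _ x ij).
    - exact: cOn.
    - by move=> i; apply: measurable_funS mg; [exact: open_cara|move=> x []].
    - by move=> i x [Ox _]; exact: g0.
  rewrite -(cvg_lim _ C)//; apply: lime_le; first by apply/cvg_ex; eexists; exact: C.
  by apply: nearW => i; rewrite leNgt; apply/negP; exact: H.
have f0 x : (0 <= f n x)%R by have /andP[] := f01 n x.
have [k [wk kI]] := cutoff_weak_upper_gradient mu_regular mu_doubling oO M0 wg gfin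
  bh h0 (fh n) (fl n) f0.
have cD : cara (O `\` S n).
  have := @measurableD _ (caratheodory_type mu) O (S n) (open_cara mu_regular oO)
    (open_cara mu_regular (oS n)).
  exact.
have split_ : \int[mmu]_(x in O) g x =
    \int[mmu]_(x in O `\` S n) g x + \int[mmu]_(x in On n) g x.
  have OE : O = (O `\` S n) `|` On n by rewrite setUC setUIDK.
  rewrite [in LHS]OE ge0_integral_setU//.
  - exact: cOn.
  - by rewrite -OE.
  - by rewrite -OE.
  - by apply/disj_setPS => x [[_ nS] [_ Sx]].
have kT : \int[mmu]_(x in O) k x <= tv_open mu O v + (eta - eps / 2 + 16 * M * d)%:E.
  have Ifin : \int[mmu]_(x in O) g x \is a fin_num.
    by rewrite ge0_fin_numE//; exact: integral_ge0.
  have g1 : 0 <= \int[mmu]_(x in O `\` S n) g x by apply: integral_ge0 => x [/g0].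
  have g2 : 0 <= \int[mmu]_(x in On n) g x by apply: integral_ge0 => x [/g0].
  move: Ifin gT gn kI; rewrite split_ fin_numD => /andP[F1 F2].
  rewrite -(fineK F1) -(fineK F2) -(fineK Tf) -/(S n) => gT gn kI.
  apply: (le_trans kI); rewrite -(fineK F1).
  apply: (@le_trans _ _ ((fine (\int[mmu]_(x in O `\` S n) g x))%:E +
      (2 * M)%:E * (8 * d)%:E)).
    by rewrite leeD2l// lee_wpmul2l// lee_fin mulr_ge0.
  by move: gT gn; rewrite -!EFinM -!EFinD !lte_fin lee_fin; lra.
have kfin : \int[mmu]_(x in O) k x < +oo.
  by apply: (le_lt_trans kT); rewrite -(fineK Tf) -EFinD ltry.
have [G [mG GI]] := minimal_weak_upper_gradient_exists mu_regular mu_doubling oO wk kfin.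
exists (cutoff M p (f n)), p, G, V; split; [split|split; split] => //.
- exact: lip_loc_cutoff.
- exact: le_trans GI kT.
- move=> i; have cE := exhaustion_cara mu_regular O i.
  have /integrableP[/measurable_EFinP mp _] := pL1 i.
  apply: (@le_integrable _ (caratheodory_type mu) R mmu _ cE _ _ _ _ (pL1 i)).
    apply/measurable_EFinP; apply: measurable_funM.
      apply: measurable_maxr; first exact: measurable_cst.
      by apply: measurable_minr => //; exact: measurable_cst.
    apply/measurable_EFinP; apply: (borel_mfun mu_regular _ cE).
    exact: uniformly_locally_lipschitz_borel (uniformly_locally_lipschitz_cut (fl n)).
  move=> x _ /=; rewrite lee_fin /cutoff normrM -[leRHS]mulr1.
  have /andP[c0 c1] := cut01 (f0 x).
  apply: ler_pM => //; last by rewrite ger0_norm ?subr_ge0// gerBl.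
  have := truncation_lip M (p x) 0; rewrite subr0 {2}/truncation (min_idPl M0).
  by have /max_idPr-> : (- M <= 0)%R; rewrite ?oppr_le0 ?subr0.
- move=> x; rewrite /cutoff -[X in (_ - X)%R]mulr1 -mulrBr addrAC subrr add0r mulrN.
  rewrite normrN normrM; apply: ler_pM => //; first exact: truncation_bound.
  rewrite indicE; have [_|] := boolP (x \in V).
    by have /andP[c0 c1] := cut01 (f0 x); rewrite ger0_norm.
  by rewrite notin_setE => nVx; rewrite fV// /cut mulr0 (min_idPr _)// normr0.
Qed.

(** The error of truncating [a] at height [M]. *)
Definition excess (M : R) (a : \bar R) : \bar R := maxe (`|a| - M%:E) 0.

(** Truncation is 1-Lipschitz, so its error can be measured at the limit value [a] instead of at
    [p], where it tends to 0 as [M] grows. If [a] or [v] is infinite, so is the right-hand side. *)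
Lemma competitor_dist (q p M c : R) (v a : \bar R) : (0 <= M)%R ->
  (`|q - truncation M p| <= c)%R ->
  `|q%:E - a| <= c%:E + `|p%:E - v| + `|v - a| + excess M a.
Proof.
move=> M0 qc; have c0 : (0 <= c)%R by exact: le_trans qc.
have e0 b : 0 <= excess M b by rewrite /excess le_max lexx orbT.
have R4 : excess M a <= c%:E + `|p%:E - v| + `|v - a| + excess M a.
  by rewrite leeDr// !adde_ge0.
have R2 : `|p%:E - v| <= c%:E + `|p%:E - v| + `|v - a| + excess M a.
  by rewrite (le_trans _ (leeDl _ (e0 a)))// (le_trans _ (leeDl _ (abse_ge0 _)))// leeDr.
case: a R2 R4 => [r| |] R2 R4.
- case: v R2 R4 => [s| |] R2 R4; [|exact: le_trans (leey _) R2|exact: le_trans (leey _) R2].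
  rewrite /excess /= -!EFinB -EFin_max -!EFinD lee_fin.
  have := truncation_excess r M0.
  have := truncation_lip M p r; have := ler_distD s p r.
  have := ler_distD (truncation M p) q r; have := ler_distD (truncation M r) (truncation M p) r.
  by move: qc; lra.
- by apply: (le_trans _ R4); rewrite /excess le_max leey.
- by apply: (le_trans _ R4); rewrite /excess le_max leey.
Qed.

Section diagonal.
Variables (O : set X) (u_ : nat -> X -> \bar R) (u : X -> \bar R).
Hypothesis oO : open O.
Hypothesis uO : L1_loc mu O u.
Hypothesis u_tv : tv_open mu O u < +oo.
Hypothesis ui_loc : forall i, L1_loc mu O (u_ i).
Hypothesis ui_tv : forall i, tv_open mu O (u_ i) < +oo.
Hypothesis ui_cvg : L1_loc_cvg mu O u_ u.
Hypothesis ui_tv_cvg : tv_open mu O (u_ i) @[i --> \oo] --> tv_open mu O u.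

Lemma measurable_excess (A : set X) (M : R) : L1 mu A u ->
  mfun A (fun x => excess M (u x)).
Proof.
move=> /integrableP[mA _]; apply: measurable_maxe; last exact: measurable_cst.
apply: emeasurable_funB; last exact: measurable_cst.
exact: measurableT_comp.
Qed.

(** Dominated by the absolute value of [u], and eventually 0 wherever [u] is finite. *)
Lemma excess_cvg m : (\int[mmu]_(x in exhaustion O m) excess k.+1%:R (u x))
  @[k --> \oo] --> 0.
Proof.
have cE := exhaustion_cara mu_regular O m.
have uE : L1 mu (exhaustion O m) u by exact: L1_exhaustion.
have [|||||_ dc _] := @dominated_convergence _ (caratheodory_type mu) R mmu _ cE
  (fun k x => excess k.+1%:R (u x)) (cst 0) (fun x => `|u x|).
- by move=> k; exact: measurable_excess.
- exact: measurable_cst.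
- have := @integrable_ae _ (caratheodory_type mu) R mmu _ cE _ uE.
  move=> [S [mS S0 SP]]; exists S; split => //; apply: subset_trans SP => x /= nx ux.
  apply: nx => Ex; have {}ux := ux Ex.
  apply: cvg_near_cst; exists (Num.truncn (fine `|u x|)) => // k /= xk.
  rewrite /excess max_r//.
  have afin : `|u x| \is a fin_num by rewrite abse_fin_num.
  rewrite -(fineK afin) -EFinB lee_fin subr_le0 ltW// (lt_le_trans (truncnS_gt _))//.
  by rewrite ler_nat ltnS.
- exact: integrable_abse.
- apply/aeW => x k _; rewrite gee0_abs; last by rewrite /excess le_max lexx orbT.
  by rewrite /excess ge_max abse_ge0 andbT leeBlDr// leeDl.
apply: cvg_trans dc; apply: near_eq_cvg; apply: nearW => k /=.
apply: eq_integral => x _.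
by rewrite sube0 gee0_abs// /excess le_max lexx orbT.
Qed.

Lemma tail_variation_small (eps : R) : (0 < eps)%R ->
  exists2 d : R, (0 < d)%R & exists N, forall A, A `<=` O -> Cap1 mu A < d%:E ->
  forall i, (N <= i)%N -> tv mu A (u_ i) < eps%:E.
Proof.
move=> eps0; apply: contrapT => no.
(* Capacity below [s k * s k] and height [k + 1] give [M * d = s k]; with [eta = s k] the total
   error in the energy is [17 * s k]. *)
pose s (k : nat) : R := (k.+1%:R^-1)%R.
have s0 k : (0 < s k)%R by rewrite invr_gt0.
have sM k : (k.+1%:R * (s k * s k) = s k)%R by rewrite mulrA mulfV ?mul1r// pnatr_eq0.
have H k : exists A i, [/\ A `<=` O, Cap1 mu A < (s k * s k)%:E, (k <= i)%N &
    eps%:E <= tv mu A (u_ i)].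
  apply: contrapT => H; apply: no; exists (s k * s k)%R; first by rewrite mulr_gt0.
  exists k => A AO Ad i ki; rewrite ltNge; apply/negP => iA.
  by apply: H; exists A, i.
have /choice[z zP] : forall k, exists z : nat * (X -> R) * (X -> R) * (X -> \bar R) * set X,
    let: (i, q, p, g, V) := z in (k <= i)%N /\
    [/\ lip_loc O q, minimal_weak_upper_gradient mu O (EFin \o q) g &
      \int[mmu]_(x in O) g x <= tv_open mu O (u_ i) + (17 * s k - eps / 2)%:E] /\
    [/\ forall n, L1 mu (exhaustion O n) (EFin \o q),
      forall n, L1 mu (exhaustion O n) (EFin \o p) &
      \int[mmu]_(x in exhaustion O k) `|(p x)%:E - u_ i x| < (s k)%:E] /\
    [/\ open V, mu V <= (3 * (s k * s k))%:E &
      forall x, (`|q x - truncation k.+1%:R (p x)| <= k.+1%:R * \1_V x)%R].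
  move=> k; have [A [i [AO Ad ki iA]]] := H k.
  have [q [p [g [V [[ql qg gI] Q]]]]] := cutoff_competitor k oO AO
    (mulr_gt0 (s0 k) (s0 k)) Ad (ler0n R k.+1) (s0 k) (ui_loc i) (ui_tv i) eps0 iA.
  exists (i, q, p, g, V); split => //; split=> //; split => //.
  apply: (le_trans gI); rewrite leeD2l// lee_fin -mulrA sM; lra.
pose i k := (z k).1.1.1.1; pose q k := (z k).1.1.1.2; pose p k := (z k).1.1.2.
pose g k := (z k).1.2; pose V k := (z k).2.
have {}zP k : (k <= i k)%N /\
    [/\ lip_loc O (q k), minimal_weak_upper_gradient mu O (EFin \o q k) (g k) &
      \int[mmu]_(x in O) g k x <= tv_open mu O (u_ (i k)) + (17 * s k - eps / 2)%:E] /\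
    [/\ forall n, L1 mu (exhaustion O n) (EFin \o q k),
      forall n, L1 mu (exhaustion O n) (EFin \o p k) &
      \int[mmu]_(x in exhaustion O k) `|(p k x)%:E - u_ (i k) x| < (s k)%:E] /\
    [/\ open (V k), mu (V k) <= (3 * (s k * s k))%:E &
      forall x, (`|q k x - truncation k.+1%:R (p k x)| <= k.+1%:R * \1_(V k) x)%R].
  by have := zP k; rewrite /i /q /p /g /V; case: (z k) => [[[[]]]].
have ioo : i k @[k --> \oo] --> \oo.
  by move=> S [N _ NS]; exists N => // k /= Nk; apply: NS; exact: leq_trans (zP k).1.
have scvg : (s k)%:E @[k --> \oo] --> 0.
  apply/cvg_EFin; first exact: nearW.
  exact: cvg_harmonic.
have qcvg : L1_loc_cvg mu O (fun k => EFin \o q k) u.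
  apply: (L1_loc_cvg_exhaustion mu_regular oO) => m.
  have cE := exhaustion_cara mu_regular O m.
  have uE : L1 mu (exhaustion O m) u by exact: L1_exhaustion.
  have [uiE _ uicvg] := L1_cvg_exhaustion mu_regular mu_doubling m oO ui_cvg.
  split => // [k|]; first by have [_ [_ [[qL _ _] _]]] := zP k.
  (* Of [4 * s k], the part [3 * s k] is the height times the measure bound for [V k], and [s k] is
     the distance from [p k] to [u_ (i k)]. *)
  apply: (@squeeze_cvge _ _ _ _ (cst 0) _ (fun k => (4 * s k)%:E +
    \int[mmu]_(x in exhaustion O m) `|u_ (i k) x - u x| +
    \int[mmu]_(x in exhaustion O m) excess k.+1%:R (u x))).
  (* The closeness of [p k] is known on the [k]-th set of the exhaustion, which contains the [m]-th
     one only for [k >= m]. *)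
  - exists m => // k /= mk; rewrite integral_ge0//=.
    have [_ [_ [[qL pL pu] [oV muV qV]]]] := zP k.
    have cV := open_cara mu_regular oV.
    have mA : mfun (exhaustion O m) (fun x => (k.+1%:R * \1_(V k) x)%:E : \bar R).
      apply/measurable_EFinP; apply: measurable_funM; first exact: measurable_cst.
      exact: (@measurable_indic _ (caratheodory_type mu) R _ (V k) cV).
    have mB : mfun (exhaustion O m) (fun x => `|(p k x)%:E - u_ (i k) x|).
      exact: (L1_measurable_diff (pL m) (uiE (i k))).
    have mC : mfun (exhaustion O m) (fun x => `|u_ (i k) x - u x|).
      exact: (L1_measurable_diff (uiE (i k)) uE).
    have A0 x : 0 <= (k.+1%:R * \1_(V k) x)%:E :> \bar R by rewrite lee_fin mulr_ge0.
    have D0 x : 0 <= excess k.+1%:R (u x) by rewrite /excess le_max lexx orbT.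
    apply: (@le_trans _ _ (\int[mmu]_(x in exhaustion O m)
      ((k.+1%:R * \1_(V k) x)%:E + `|(p k x)%:E - u_ (i k) x| + `|u_ (i k) x - u x| +
      excess k.+1%:R (u x)))).
      apply: ge0_le_lower_integral => x _ //; exact: competitor_dist.
    rewrite ge0_integralD//; last 3 first.
    + by move=> x _; rewrite !adde_ge0.
    + by apply: emeasurable_funD => //; exact: emeasurable_funD.
    + exact: measurable_excess.
    rewrite leeD2r// ge0_integralD//; last 2 first.
    + by move=> x _; rewrite adde_ge0.
    + exact: emeasurable_funD.
    rewrite leeD2r// ge0_integralD//.
    have -> : (4 * s k = 3 * s k + s k)%R by lra.
    rewrite EFinD leeD//.
      under eq_integral do rewrite EFinM.
      rewrite ge0_integralZl_EFin//; last first.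
        apply/measurable_EFinP.
        exact: (@measurable_indic _ (caratheodory_type mu) R _ (V k) cV).
      have -> := @integral_indic _ (caratheodory_type mu) R mmu _ cE (V k) cV.
      apply: (@le_trans _ _ (k.+1%:R%:E * (3 * (s k * s k))%:E)).
        rewrite lee_wpmul2l// (le_trans _ muV)//; apply: le_outer_measure.
        exact: subIsetl.
      by rewrite -EFinM lee_fin mulrCA sM.
    apply: le_trans (ltW pu); apply: ge0_subset_integral => //.
    + exact: exhaustion_cara.
    + have [uiEk _ _] := L1_cvg_exhaustion mu_regular mu_doubling k oO ui_cvg.
      exact: (L1_measurable_diff (pL k) (uiEk (i k))).
    + exact: exhaustion_mono.
  - exact: cvg_cst.
  - rewrite -[X in _ --> X]adde0; apply: cvgeD => //; last exact: excess_cvg.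
    rewrite -[X in _ --> X]adde0; apply: cvgeD => //.
      rewrite -(mule0 4%:E); under eq_fun do rewrite EFinM.
      by apply: cvgeZl.
    exact: (cvg_comp _ _ ioo uicvg).
have Tf : tv_open mu O u \is a fin_num by rewrite ge0_fin_numE ?tv_open_ge0.
have : tv_open mu O u <= limn_einf (fun k => \int[mmu]_(x in O) g k x).
  apply: ereal_inf_lbound; exists (q, g) => //; split => //= k.
    by have [_ [[]]] := zP k.
  by have [_ [[]]] := zP k.
apply/negP; rewrite -ltNge.
(* One eighth of [eps] goes to the convergence of the variations and one eighth to [17 * s k]; a
   gain of [eps / 4] remains. *)
have [N1 _ N1P] : \forall k \near \oo, tv_open mu O (u_ (i k)) <
    tv_open mu O u + (eps / 8)%:E.
  apply: (ereal_cvg_lt (cvg_comp _ _ ioo ui_tv_cvg)).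
  by rewrite lteDl// lte_fin divr_gt0.
have [N2 _ N2P] : \forall k \near \oo, (s k)%:E < (eps / 17 / 8)%:E.
  by apply: (ereal_cvg_lt scvg); rewrite lte_fin !divr_gt0.
apply: (@le_lt_trans _ _ (tv_open mu O u + (- (eps / 4))%:E)); last first.
  by rewrite -(fineK Tf) -EFinD lte_fin gtrDl oppr_lt0 divr_gt0.
apply: (@limn_einf_le _ _ _ (maxn N1 N2)) => k; rewrite geq_max => /andP[k1 k2].
have [_ [[_ _ gI] _]] := zP k; apply: (le_trans gI).
have := N1P k k1; have := N2P k k2; rewrite /= lte_fin => sk.
have : tv_open mu O (u_ (i k)) \is a fin_num by rewrite ge0_fin_numE ?tv_open_ge0.
rewrite -(fineK Tf) => /fineK<-; rewrite -!EFinD lte_fin lee_fin; lra.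
Qed.

End diagonal.

Lemma L1_loc_cvg_cst (O : set X) (u : X -> \bar R) : open O -> L1_loc mu O u ->
  L1_loc_cvg mu O (fun=> u) u.
Proof.
move=> oO uO x Ox; have [r r0 ur] := uO x Ox; exists r => //; split => //.
have cA : cara (O `&` ball x r).
  by apply: open_cara => //; apply: openI => //; exact: open_mball.
suff -> : \int[mmu]_(y in O `&` ball x r) `|u y - u y| = 0 by exact: cvg_cst.
rewrite -(@integral0 _ (caratheodory_type mu) R mmu (O `&` ball x r)).
apply: ge0_ae_eq_integral => //.
- exact: (L1_measurable_diff ur ur).
have [S [mS S0 SP]] := @integrable_ae _ (caratheodory_type mu) R mmu _ cA _ ur.
exists S; split => //; apply: subset_trans SP => y /= ny uy.
by apply: ny => Oy; rewrite subee ?abse0//; exact: uy.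
Qed.

Lemma head_variation_small (O : set X) (u_ : nat -> X -> \bar R) (N : nat) (eps : R) :
  open O -> (forall i, L1_loc mu O (u_ i)) ->
  (forall i, tv_open mu O (u_ i) < +oo) -> (0 < eps)%R ->
  exists2 d : R, (0 < d)%R & forall A, A `<=` O -> Cap1 mu A < d%:E ->
  forall i, (i < N)%N -> tv mu A (u_ i) < eps%:E.
Proof.
move=> oO ui_loc ui_tv eps0; elim: N => [|N [d d0 dP]]; first by exists 1%R.
have [d' d'0 [K KP]] := tail_variation_small oO (ui_loc N) (ui_tv N)
  (fun=> ui_loc N) (fun=> ui_tv N) (L1_loc_cvg_cst oO (ui_loc N)) (cvg_cst _) eps0.
exists (Num.min d d'); first by rewrite lt_min d0.
move=> A AO; rewrite EFin_min lt_min => /andP[Ad Ad'] i.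
rewrite ltnS leq_eqVlt => /predU1P[->|]; last exact: dP.
(* The sequence being constant, its bound at the index [K] is the bound for [u_ N]. *)
exact: KP (leqnn K).
Qed.

End total_variation.

Theorem theorem5p6 (R : realType) (X : completeMetricType R)
  (mu : {outer_measure set X -> \bar R})
  (mu_regular : borel_regular mu) (mu_doubling : doubling mu)
  (mu_poincare : poincare mu)
  (Omega : set X) (Omega_open : open Omega)
  (u_ : nat -> X -> \bar R) (u : X -> \bar R)
  (u_loc : L1_loc mu Omega u) (u_tv : (tv_open mu Omega u < +oo)%E)
  (ui_loc : forall i, L1_loc mu Omega (u_ i))
  (ui_tv : forall i, (tv_open mu Omega (u_ i) < +oo)%E)
  (ui_cvg : L1_loc_cvg mu Omega u_ u)
  (ui_tv_cvg : tv_open mu Omega (u_ i) @[i --> \oo] --> tv_open mu Omega u) :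
  forall eps : R, 0 < eps ->
  exists2 delta : R, 0 < delta &
    forall A : set X, A `<=` Omega -> (Cap1 mu A < delta%:E)%E ->
    forall i, (tv mu A (u_ i) < eps%:E)%E.
Proof.
move=> eps eps0.
have [d d0 [N dP]] := tail_variation_small mu_regular mu_doubling Omega_open
  u_loc u_tv ui_loc ui_tv ui_cvg ui_tv_cvg eps0.
have [d' d'0 d'P] := head_variation_small mu_regular mu_doubling N Omega_open
  ui_loc ui_tv eps0.
exists (Num.min d d'); first by rewrite lt_min d0.
move=> A AO; rewrite EFin_min lt_min => /andP[Ad Ad'] i.
by have [Ni|iN] := leqP N i; [exact: dP|exact: d'P].
Qed.
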